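(* Let $p\ge 2$ and $m\in\mathbb{Z}_{\ge0}$. Let $\mathbf{c}=(c_1,\dots,c_{p+1})\in(\mathbb{C}\setminus\mathbb{Z})^{p+1}$ and $\mathbf{d}=(d_1,\dots,d_{p-1})\in(\mathbb{C}\setminus\mathbb{Z})^{p-1}$ with $\Re\big(\sum_{j=1}^{p-1}d_j-\sum_{j=1}^{p+1}c_j\big)>-m-1$, and assume the parameters are generic (pairwise differences among the $c_j$, among the $d_j$, and the differences $d_j-c_1$ are non-integers), so that all terms below are finite. Then \begin{multline*} \sum_{k=0}^{\infty}\frac{(\mathbf{c})_{k}}{(\mathbf{d})_{k}(m+k)!\,k!}\Big\{\sum_{d\in\mathbf{d}}\psi(d+k)+\psi(k+1)+\psi(1+m+k)-\sum_{c\in\mathbf{c}}\psi(c+k)\Big\}\\ =\frac{\pi}{m!}\Big[\sum_{c\in\mathbf{c}_{[1]}}\cot(\pi c)-\sum_{d\in\mathbf{d}_{[1]}}\cot(\pi d)\Big]{}_{p+1}F_p\!\left(\begin{matrix}\mathbf{c}\\1+m,\mathbf{d}\end{matrix}\right) +\frac{(1-\mathbf{d})_{1}}{(1-\mathbf{c})_{1}(m-1)!}{}_{p+2}F_{p+1}\!\left(\begin{matrix}1-m,2-\mathbf{d},1,1\\2-\mathbf{c}\end{matrix}\right)\\ +\frac{\Gamma(c_1)\Gamma(d_1)\Gamma(1-\mathbf{c}_{[1]})\Gamma(1-\mathbf{d}_{[1]}+c_1)}{(1-c_1)_m\Gamma(d_1-c_1)\Gamma(1-\mathbf{c}_{[1]}+c_1)\Gamma(1-\mathbf{d}_{[1]})}\,{}_{p+1}F_p\!\left(\begin{matrix}c_1,\,c_1-m,\,1-\mathbf{d}+c_1\\1-\mathbf{c}_{[1]}+c_1\end{matrix}\right)\\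 -\frac{(-1)^m\Gamma(1-\mathbf{c})\sin(\pi c_1)}{\Gamma(1-\mathbf{d})\sin(\pi d_1)}\sum_{k=2}^{p-1}\frac{\Gamma(d_k-m)\Gamma(d_k)\Gamma(d_k-\mathbf{d}_{[k]})\sin(\pi(d_k-d_1))}{(d_k-m-1)(d_k-1)\Gamma(d_k-\mathbf{c})\sin(\pi(d_k-c_1))}\,{}_{p+1}F_p\!\left(\begin{matrix}1+\mathbf{c}-d_k\\2-d_k,\,2-d_k+m,\,1+\mathbf{d}_{[k]}-d_k\end{matrix}\right). \end{multline*}
   Context: $\psi=\Gamma'/\Gamma$ is the digamma function and $(x)_k=\Gamma(x+k)/\Gamma(x)$ the Pochhammer symbol. For a vector $\mathbf{a}=(a_1,\dots,a_q)$ and scalar $\beta$: $\Gamma(\mathbf{a})=\prod_i\Gamma(a_i)$, $(\mathbf{a})_k=\prod_i(a_i)_k$, $\mathbf{a}+\beta=(a_1+\beta,\dots,a_q+\beta)$, $\beta-\mathbf{a}=(\beta-a_1,\dots,\beta-a_q)$, $\mathbf{a}_{[k]}$ is $\mathbf{a}$ with the $k$-th component removed, and $\sum_{a\in\mathbf{a}}$ runs over the components of $\mathbf{a}$. ${}_pF_q(\mathbf{a};\mathbf{b};z)=\sum_{k\ge0}\frac{(\mathbf{a})_k}{(\mathbf{b})_k}\frac{z^k}{k!}$; when the argument is omitted it is $z=1$. Listing several vectors/scalars separated by commas in a parameter row means concatenation. The term $\frac{1}{(m-1)!}{}_{p+2}F_{p+1}(1-m,2-\mathbf{d},1,1;2-\mathbf{c};1)$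 is understood as the finite sum $\sum_{j=0}^{m-1}\frac{(-1)^j(2-\mathbf{d})_j\, j!}{(2-\mathbf{c})_j\,(m-1-j)!}$, which is $0$ for $m=0$. *)

(* Defs.v *)
From Stdlib Require Import Reals List Arith.
From Coquelicot Require Import Coquelicot.
Import ListNotations.
Open Scope C_scope.

Definition nC (n : nat) : C := RtoC (INR n).

Definition sumC (l : list C) : C := fold_right Cplus 0 l.
Definition prodC (l : list C) : C := fold_right Cmult 1 l.

Definition poch (x : C) (k : nat) : C := prodC (map (fun i => x + nC i) (seq 0 k)).

Definition CSeries (a : nat -> C) : C :=
  (Series (fun k => Re (a k)), Series (fun k => Im (a k))).

Definition Clim (u : nat -> C) : C :=
  (real (Lim_seq (fun n => Re (u n))), real (Lim_seq (fun n => Im (u n)))).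

Definition Cexp (z : C) : C :=
  (exp (Re z) * cos (Im z), exp (Re z) * sin (Im z))%R.
Definition Csin (z : C) : C := (Cexp (Ci * z) - Cexp (- (Ci * z))) / (2 * Ci).
Definition Ccos (z : C) : C := (Cexp (Ci * z) + Cexp (- (Ci * z))) / 2.
Definition Ccot (z : C) : C := Ccos z / Csin z.

Definition npow (n : nat) (z : C) : C := Cexp (z * RtoC (ln (INR n))).

(** reciprocal Gamma function (entire), via Gauss' product formula:
    1/Gamma(z) = lim_n (z)_{n+1} / (n! n^z) *)
Definition RGamma (z : C) : C :=
  Clim (fun n => poch z (S n) / (nC (fact n) * npow n z)).
Definition CGamma (z : C) : C := / RGamma z.

Definition EulerGamma : R :=
  real (Lim_seq (fun n => (sum_f_R0 (fun i => / INR (S i)) n - ln (INR (S n)))%R)).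
Definition digamma (z : C) : C :=
  - RtoC EulerGamma + CSeries (fun n => / nC (S n) - / (nC n + z)).

Definition pochV (l : list C) (k : nat) : C := prodC (map (fun a => poch a k) l).
Definition GammaV (l : list C) : C := prodC (map CGamma l).
Definition RGammaV (l : list C) : C := prodC (map RGamma l).
Definition vadd (l : list C) (b : C) : list C := map (fun a => a + b) l.
Definition vsubr (b : C) (l : list C) : list C := map (fun a => b - a) l.

Definition hypF (a b : list C) : C :=
  CSeries (fun k => pochV a k / (pochV b k * nC (fact k))).

Definition notInt (z : C) : Prop := forall n : Z, z <> RtoC (IZR n).

(* Main.v *)
(** With u = c_1, v = d_1, the left side comes from the double poles s = 0, 1, 2, ... of
    Γ(-s) Γ(-m-s) Γ(u+s) ∏_{j≥2} Γ(1-d_j-s) / (Γ(v+s) ∏_{j≥2} Γ(1-c_j-s)).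
    Replacing every 1/Γ(z) by Gauss' truncation (z)_{N+1} / (N! N^z) turns this function into a
    rational one, so no contour integral is needed: the residues of a rational function of degree
    at most -2 sum to zero.  A rational cutoff (1 - s²/N²)^e / ∏_{l<L} (1 - s/(iN(l+1))) lowers the
    degree to at most -2 and damps the residues near |s| = N; its own poles contribute O(N^{-S}) with S > 0
    by the hypothesis on Re(Σd - Σc).  As N → ∞ Tannery's theorem sums the residues termwise.
    The double poles give the left side and, through ψ(1-x) = ψ(x) + π cot(πx), the cotangent term;
    the poles -1, ..., -m give the finite sum, the poles -u-n the third term, and the poles
    1-d_k+n the last sum. *)
Require Import Defs.
From Stdlib Require Import Reals List Arith Lra Lia Psatz Permutation.
From Coquelicot Require Import Coquelicot.
Import ListNotations.
Open Scope C_scope.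

(** Since Gamma(-m-s) = (-1)^m Gamma(-s) / (1+s)_m, the integrand is, up to sign, a square of
    Gamma(-s) divided by (1+s)_m: the double poles form one squared list, and -1, ..., -m are the
    zeros of (1+s)_m. With X = (c_j), j >= 2, and Y = (d_j), j >= 2, one has |X| = |Y| + 2, and this
    equality makes the factorials, signs and harmonic numbers created by the truncation cancel
    exactly. The obstacle is uniformity. A residue n steps away from its base point has size (n+1)^a
    (1-n/N)^b N^c, and b can be negative, so the terms with n near N escape domination. Zeros of
    order e at N and -N raise b to at least 0; in exchange the degree grows by 2e, which 2e+2 extra
    poles repair. On the imaginary axis these poles keep a distance of order N from every
    progression of poles. The exponent S = Re(sum d - sum c) + m + 1 acts twice: the limiting terms
    decay like n^(-S-1), and the residues at the extra poles like N^(-S). Gamma enters through its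
    reciprocal, because Gauss' quotient converges at every point. [Clim] and [CSeries] are total, so
    values always travel with proofs of convergence. *)

(** * Convergence of complex sequences *)

Definition cvgC (u : nat -> C) (l : C) : Prop :=
  forall eps : R, (0 < eps)%R -> exists N, forall n, (N <= n)%nat -> (Cmod (u n - l) < eps)%R.

Lemma Cmod_sub_sym (x y : C) : Cmod (x - y) = Cmod (y - x).
Proof. replace (x - y) with (- (y - x)) by ring. apply Cmod_opp. Qed.

Lemma Cmod_triangle_sub (x y : C) : (Cmod x - Cmod y <= Cmod (x - y))%R.
Proof.
  assert (H := Cmod_triangle (x - y) y).
  replace (x - y + y) with x in H by ring. lra.
Qed.

Lemma cvgC_const (l : C) : cvgC (fun _ => l) l.
Proof.
  intros eps He; exists 0%nat; intros n _.
  replace (l - l) with (RtoC 0) by ring. now rewrite Cmod_0.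
Qed.

Lemma cvgC_ext_loc (u v : nat -> C) (l : C) (N0 : nat) :
  (forall n, (N0 <= n)%nat -> u n = v n) -> cvgC u l -> cvgC v l.
Proof.
  intros E H eps He. destruct (H eps He) as [N HN].
  exists (Nat.max N N0); intros n Hn. rewrite <- E by lia. apply HN; lia.
Qed.

Lemma cvgC_ext (u v : nat -> C) (l : C) : (forall n, u n = v n) -> cvgC u l -> cvgC v l.
Proof. intros E; apply (cvgC_ext_loc u v l 0); auto. Qed.

Lemma cvgC_lim_eq (u : nat -> C) (l k : C) : cvgC u l -> l = k -> cvgC u k.
Proof. now intros H <-. Qed.

Lemma cvgC_plus (u v : nat -> C) (l k : C) :
  cvgC u l -> cvgC v k -> cvgC (fun n => u n + v n) (l + k).
Proof.
  intros Hu Hv eps He.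
  destruct (Hu (eps / 2)%R ltac:(lra)) as [N HN], (Hv (eps / 2)%R ltac:(lra)) as [M HM].
  exists (Nat.max N M); intros n Hn.
  replace (u n + v n - (l + k)) with ((u n - l) + (v n - k)) by ring.
  specialize (HN n ltac:(lia)); specialize (HM n ltac:(lia)).
  assert (H := Cmod_triangle (u n - l) (v n - k)). lra.
Qed.

Lemma cvgC_opp (u : nat -> C) (l : C) : cvgC u l -> cvgC (fun n => - u n) (- l).
Proof.
  intros Hu eps He. destruct (Hu eps He) as [N HN]. exists N; intros n Hn.
  replace (- u n - - l) with (- (u n - l)) by ring. rewrite Cmod_opp; auto.
Qed.

Lemma cvgC_minus (u v : nat -> C) (l k : C) :
  cvgC u l -> cvgC v k -> cvgC (fun n => u n - v n) (l - k).
Proof. intros Hu Hv. apply cvgC_plus; auto. now apply cvgC_opp. Qed.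

Lemma cvgC_bounded_loc (u : nat -> C) (l : C) :
  cvgC u l -> exists N, forall n, (N <= n)%nat -> (Cmod (u n) <= Cmod l + 1)%R.
Proof.
  intros H. destruct (H 1%R ltac:(lra)) as [N HN]. exists N; intros n Hn.
  specialize (HN n Hn). assert (T := Cmod_triangle_sub (u n) l). lra.
Qed.

Lemma eventually_bounded (u : nat -> R) (M : R) (N : nat) :
  (forall n, (N <= n)%nat -> (u n <= M)%R) -> exists M', (0 < M')%R /\ forall n, (u n <= M')%R.
Proof.
  induction N as [|N IH]; intros H.
  - exists (Rmax M 1). split; [apply Rlt_le_trans with 1%R; [lra | apply Rmax_r]|].
    intros n; eapply Rle_trans; [apply H; lia | apply Rmax_l].
  - assert (HH : exists M1, forall n, (N <= n)%nat -> (u n <= M1)%R).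
    { exists (Rmax M (u N)). intros n Hn. destruct (Nat.eq_dec n N) as [->|].
      - apply Rmax_r.
      - eapply Rle_trans; [apply H; lia | apply Rmax_l]. }
    destruct HH as [M1 H1].
    (* The outer induction hypothesis is tied to the fixed bound [M]; a second induction with the
       bound generalised absorbs the remaining values. *)
    clear IH H. revert M1 H1. induction N as [|N IH]; intros M1 H1.
    + exists (Rmax M1 1). split; [apply Rlt_le_trans with 1%R; [lra | apply Rmax_r]|].
      intros n; eapply Rle_trans; [apply H1; lia | apply Rmax_l].
    + apply (IH (Rmax M1 (u N))). intros n Hn. destruct (Nat.eq_dec n N) as [->|].
      * apply Rmax_r.
      * eapply Rle_trans; [apply H1; lia | apply Rmax_l].
Qed.

Lemma cvgC_bounded (u : nat -> C) (l : C) :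
  cvgC u l -> exists M, (0 < M)%R /\ forall n, (Cmod (u n) <= M)%R.
Proof.
  intros H. destruct (cvgC_bounded_loc u l H) as [N HN].
  apply (eventually_bounded (fun n => Cmod (u n)) _ N HN).
Qed.

Lemma cvgC_mult (u v : nat -> C) (l k : C) :
  cvgC u l -> cvgC v k -> cvgC (fun n => u n * v n) (l * k).
Proof.
  intros Hu Hv. destruct (cvgC_bounded u l Hu) as [A [HA0 HA]].
  intros eps He.
  assert (HK := Cmod_ge_0 k).
  assert (Hd1 : (0 < eps / 2 / (Cmod k + 1))%R) by (apply Rdiv_lt_0_compat; lra).
  assert (Hd2 : (0 < eps / 2 / A)%R) by (apply Rdiv_lt_0_compat; lra).
  destruct (Hu _ Hd1) as [N HN], (Hv _ Hd2) as [M HM].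
  exists (Nat.max N M); intros n Hn.
  replace (u n * v n - l * k) with (u n * (v n - k) + (u n - l) * k) by ring.
  specialize (HN n ltac:(lia)); specialize (HM n ltac:(lia)).
  eapply Rle_lt_trans; [apply Cmod_triangle|]. rewrite 2!Cmod_mult.
  assert (E1 : (Cmod (u n) * Cmod (v n - k) <= A * Cmod (v n - k))%R).
  { apply Rmult_le_compat_r; [apply Cmod_ge_0 | apply HA]. }
  assert (E2 : (A * Cmod (v n - k) < A * (eps / 2 / A))%R) by (apply Rmult_lt_compat_l; auto).
  replace (A * (eps / 2 / A))%R with (eps / 2)%R in E2 by (field; lra).
  assert (E3 : (Cmod (u n - l) * Cmod k <= (eps / 2 / (Cmod k + 1)) * Cmod k)%R).
  { apply Rmult_le_compat_r; lra. }
  assert (E4 : (eps / 2 / (Cmod k + 1) * Cmod k <= eps / 2 / (Cmod k + 1) * (Cmod k + 1))%R).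
  { apply Rmult_le_compat_l; lra. }
  replace (eps / 2 / (Cmod k + 1) * (Cmod k + 1))%R with (eps / 2)%R in E4 by (field; lra).
  lra.
Qed.

Lemma cvgC_lower (u : nat -> C) (l : C) : l <> 0 -> cvgC u l ->
  exists N, forall n, (N <= n)%nat -> (Cmod l / 2 <= Cmod (u n))%R.
Proof.
  intros Hl H. assert (Hm : (0 < Cmod l)%R) by now apply Cmod_gt_0.
  destruct (H (Cmod l / 2)%R ltac:(lra)) as [N HN]. exists N; intros n Hn.
  specialize (HN n Hn). rewrite Cmod_sub_sym in HN.
  assert (T := Cmod_triangle_sub l (u n)). lra.
Qed.

Lemma Cmod_pos_neq0 (z : C) : (0 < Cmod z)%R -> z <> 0.
Proof. apply Cmod_gt_0. Qed.

Lemma cvgC_inv (u : nat -> C) (l : C) : l <> 0 -> cvgC u l -> cvgC (fun n => / u n) (/ l).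
Proof.
  intros Hl H. destruct (cvgC_lower u l Hl H) as [N0 H0].
  assert (Hm : (0 < Cmod l)%R) by now apply Cmod_gt_0.
  intros eps He.
  destruct (H (eps * (Cmod l * Cmod l / 2))%R) as [N HN].
  { apply Rmult_lt_0_compat; auto. apply Rdiv_lt_0_compat; [nra|lra]. }
  exists (Nat.max N N0); intros n Hn.
  specialize (HN n ltac:(lia)); specialize (H0 n ltac:(lia)).
  assert (Hu : u n <> 0) by (apply Cmod_pos_neq0; lra).
  replace (/ u n - / l) with ((l - u n) / (u n * l)) by (field; auto).
  rewrite Cmod_div by (apply Cmult_neq_0; auto). rewrite Cmod_mult, Cmod_sub_sym.
  apply Rle_lt_trans with (Cmod (u n - l) / (Cmod l / 2 * Cmod l))%R.
  - apply Rmult_le_compat_l; [apply Cmod_ge_0|].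
    apply Rinv_le_contravar; nra.
  - apply Rlt_div_l; [nra|]. nra.
Qed.

Lemma cvgC_div (u v : nat -> C) (l k : C) :
  k <> 0 -> cvgC u l -> cvgC v k -> cvgC (fun n => u n / v n) (l / k).
Proof. intros Hk Hu Hv. apply cvgC_mult; auto. now apply cvgC_inv. Qed.

Lemma cvgC_unique (u : nat -> C) (l k : C) : cvgC u l -> cvgC u k -> l = k.
Proof.
  intros H1 H2. destruct (Ceq_dec l k) as [|Hn]; auto. exfalso.
  assert (Hm : (0 < Cmod (l - k))%R).
  { apply Cmod_gt_0. intros E. apply Hn. replace l with (l - k + k) by ring. rewrite E; ring. }
  destruct (H1 (Cmod (l - k) / 2)%R ltac:(lra)) as [N HN].
  destruct (H2 (Cmod (l - k) / 2)%R ltac:(lra)) as [M HM].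
  specialize (HN (Nat.max N M) ltac:(lia)); specialize (HM (Nat.max N M) ltac:(lia)).
  set (w := u (Nat.max N M)) in *.
  assert (T := Cmod_triangle (l - w) (w - k)).
  replace (l - w + (w - k)) with (l - k) in T by ring.
  rewrite (Cmod_sub_sym l w) in T. lra.
Qed.

Definition to_inf (f : nat -> nat) : Prop :=
  forall K, exists N, forall n, (N <= n)%nat -> (K <= f n)%nat.

Lemma cvgC_comp (u : nat -> C) (l : C) (f : nat -> nat) :
  to_inf f -> cvgC u l -> cvgC (fun n => u (f n)) l.
Proof.
  intros Hf H eps He. destruct (H eps He) as [N HN]. destruct (Hf N) as [M HM].
  exists M; intros n Hn. apply HN, HM, Hn.
Qed.

Lemma to_inf_id : to_inf (fun n => n).
Proof. intros K; exists K; auto. Qed.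

Lemma cvgC_Re (u : nat -> C) (l : C) : cvgC u l -> is_lim_seq (fun n => Re (u n)) (Re l).
Proof.
  intros H. apply is_lim_seq_spec. intros eps. destruct (H eps (cond_pos eps)) as [N HN].
  exists N; intros n Hn. specialize (HN n Hn).
  replace (Re (u n) - Re l)%R with (Re (u n - l)) by (unfold Re; simpl; ring).
  eapply Rle_lt_trans; [apply re_le_Cmod | exact HN].
Qed.

Lemma cvgC_Im (u : nat -> C) (l : C) : cvgC u l -> is_lim_seq (fun n => Im (u n)) (Im l).
Proof.
  intros H. apply is_lim_seq_spec. intros eps. destruct (H eps (cond_pos eps)) as [N HN].
  exists N; intros n Hn. specialize (HN n Hn).
  replace (Im (u n) - Im l)%R with (Im (u n - l)) by (unfold Im; simpl; ring).
  eapply Rle_lt_trans; [|exact HN].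
  eapply Rle_trans; [|apply Rmax_Cmod]. apply Rmax_r.
Qed.

Lemma cvgC_of_parts (u : nat -> C) (l : C) :
  is_lim_seq (fun n => Re (u n)) (Re l) -> is_lim_seq (fun n => Im (u n)) (Im l) -> cvgC u l.
Proof.
  intros H1 H2 eps He. apply is_lim_seq_spec in H1. apply is_lim_seq_spec in H2.
  assert (He2 : (0 < eps / 2)%R) by lra.
  destruct (H1 (mkposreal _ He2)) as [N HN], (H2 (mkposreal _ He2)) as [M HM]. simpl in *.
  exists (Nat.max N M); intros n Hn.
  specialize (HN n ltac:(lia)); specialize (HM n ltac:(lia)).
  eapply Rle_lt_trans; [apply Cmod_2Rmax|].
  change (fst (u n - l)) with (Re (u n) - Re l)%R. change (snd (u n - l)) with (Im (u n) - Im l)%R.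
  assert (Hs : (sqrt 2 < 2)%R).
  { rewrite <- (sqrt_square 2) at 2 by lra. apply sqrt_lt_1; lra. }
  assert (Hm : (Rmax (Rabs (Re (u n) - Re l)) (Rabs (Im (u n) - Im l)) < eps / 2)%R)
    by (apply Rmax_lub_lt; auto).
  assert (H0 : (0 <= Rmax (Rabs (Re (u n) - Re l)) (Rabs (Im (u n) - Im l)))%R).
  { eapply Rle_trans; [apply Rabs_pos | apply Rmax_l]. }
  assert (Hs0 := sqrt_pos 2). nra.
Qed.

Lemma cvgC_RtoC (u : nat -> R) (l : R) : is_lim_seq u l -> cvgC (fun n => RtoC (u n)) (RtoC l).
Proof. intros H. apply cvgC_of_parts; simpl; auto. apply is_lim_seq_const. Qed.

Lemma cvgC_squeeze (u : nat -> C) (l : C) (v : nat -> R) (N0 : nat) :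
  (forall n, (N0 <= n)%nat -> (Cmod (u n - l) <= v n)%R) -> is_lim_seq v 0 -> cvgC u l.
Proof.
  intros H Hv eps He. apply is_lim_seq_spec in Hv. destruct (Hv (mkposreal _ He)) as [N HN].
  simpl in HN. exists (Nat.max N N0); intros n Hn.
  specialize (HN n ltac:(lia)). rewrite Rminus_0_r in HN.
  eapply Rle_lt_trans; [apply H; lia|]. eapply Rle_lt_trans; [apply Rle_abs | exact HN].
Qed.

Lemma cvgC_Cmod (u : nat -> C) (l : C) : cvgC u l -> is_lim_seq (fun n => Cmod (u n)) (Cmod l).
Proof.
  intros H. apply is_lim_seq_spec. intros eps. destruct (H eps (cond_pos eps)) as [N HN].
  exists N; intros n Hn. specialize (HN n Hn).
  assert (A := Cmod_triangle_sub (u n) l). assert (B := Cmod_triangle_sub l (u n)).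
  rewrite Cmod_sub_sym in B. apply Rabs_def1; lra.
Qed.

Lemma cvgC_le (u : nat -> C) (l : C) (M : R) (N0 : nat) :
  (forall n, (N0 <= n)%nat -> (Cmod (u n) <= M)%R) -> cvgC u l -> (Cmod l <= M)%R.
Proof.
  intros H Hc.
  assert (T := is_lim_seq_le_loc (fun n => Cmod (u n)) (fun _ => M) (Cmod l) M).
  simpl in T. apply T.
  - exists N0. exact H.
  - now apply cvgC_Cmod.
  - apply is_lim_seq_const.
Qed.

(** [Clim] has an arbitrary value on divergent sequences, so it can be evaluated only through a
    proof of convergence. *)
Lemma cvgC_Clim (u : nat -> C) (l : C) : cvgC u l -> Clim u = l.
Proof.
  intros H. unfold Clim. rewrite (is_lim_seq_unique _ _ (cvgC_Re u l H)).
  rewrite (is_lim_seq_unique _ _ (cvgC_Im u l H)). simpl. now destruct l.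
Qed.

Lemma cvgC_cauchy (u : nat -> C) :
  (forall eps : R, (0 < eps)%R -> exists N, forall n m, (N <= n)%nat -> (N <= m)%nat ->
     (Cmod (u n - u m) < eps)%R) -> exists l, cvgC u l.
Proof.
  intros H.
  assert (H1 : ex_finite_lim_seq (fun n => Re (u n))).
  { apply ex_lim_seq_cauchy_corr. intros eps. destruct (H eps (cond_pos eps)) as [N HN].
    exists N; intros n m Hn Hm. specialize (HN n m Hn Hm).
    replace (Re (u n) - Re (u m))%R with (Re (u n - u m)) by (unfold Re; simpl; ring).
    eapply Rle_lt_trans; [apply re_le_Cmod | exact HN]. }
  assert (H2 : ex_finite_lim_seq (fun n => Im (u n))).
  { apply ex_lim_seq_cauchy_corr. intros eps. destruct (H eps (cond_pos eps)) as [N HN].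
    exists N; intros n m Hn Hm. specialize (HN n m Hn Hm).
    replace (Im (u n) - Im (u m))%R with (Im (u n - u m)) by (unfold Im; simpl; ring).
    eapply Rle_lt_trans; [|exact HN]. eapply Rle_trans; [|apply Rmax_Cmod]. apply Rmax_r. }
  destruct H1 as [a Ha], H2 as [b Hb]. exists (a, b). now apply cvgC_of_parts.
Qed.

(** * Finite sums and products *)

(** Written over [seq 0 n] so that [csum] is convertible with the finite sum of the theorem, and
    [cprod] with [poch]. *)
Definition csum (f : nat -> C) (n : nat) : C := sumC (map f (seq 0 n)).
Definition cprod (f : nat -> C) (n : nat) : C := prodC (map f (seq 0 n)).
Arguments csum _%_C_scope _%_nat_scope.
Arguments cprod _%_C_scope _%_nat_scope.

Lemma sumC_app (l k : list C) : sumC (l ++ k) = sumC l + sumC k.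
Proof. induction l as [|a l IH]; simpl; [ring|]. unfold sumC in *; simpl. rewrite IH. ring. Qed.

Lemma prodC_app (l k : list C) : prodC (l ++ k) = prodC l * prodC k.
Proof. induction l as [|a l IH]; simpl; [ring|]. unfold prodC in *; simpl. rewrite IH. ring. Qed.

Lemma sumC_cons (a : C) l : sumC (a :: l) = a + sumC l. Proof. reflexivity. Qed.
Lemma prodC_cons (a : C) l : prodC (a :: l) = a * prodC l. Proof. reflexivity. Qed.

Lemma csum_0 (f : nat -> C) : csum f 0 = 0. Proof. reflexivity. Qed.
Lemma cprod_0 (f : nat -> C) : cprod f 0 = 1. Proof. reflexivity. Qed.

Lemma csum_S (f : nat -> C) n : csum f (S n) = csum f n + f n.
Proof. unfold csum. rewrite seq_S, map_app, sumC_app. simpl. ring. Qed.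

Lemma cprod_S (f : nat -> C) n : cprod f (S n) = cprod f n * f n.
Proof. unfold cprod. rewrite seq_S, map_app, prodC_app. simpl. ring. Qed.

Lemma sumC_ext_in {A} (f g : A -> C) l : (forall x, In x l -> f x = g x) ->
  sumC (map f l) = sumC (map g l).
Proof. intros H. now rewrite (map_ext_in f g). Qed.

Lemma prodC_ext_in {A} (f g : A -> C) l : (forall x, In x l -> f x = g x) ->
  prodC (map f l) = prodC (map g l).
Proof. intros H. now rewrite (map_ext_in f g). Qed.

Lemma csum_ext (f g : nat -> C) n : (forall i, (i < n)%nat -> f i = g i) -> csum f n = csum g n.
Proof. intros H. apply sumC_ext_in. intros x Hx. apply in_seq in Hx. apply H; lia. Qed.

Lemma cprod_ext (f g : nat -> C) n : (forall i, (i < n)%nat -> f i = g i) -> cprod f n = cprod g n.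
Proof. intros H. apply prodC_ext_in. intros x Hx. apply in_seq in Hx. apply H; lia. Qed.

Lemma csum_add (f : nat -> C) n m : csum f (n + m) = csum f n + csum (fun i => f (n + i)%nat) m.
Proof.
  induction m as [|m IH]; [rewrite Nat.add_0_r; unfold csum at 3; simpl; ring|].
  rewrite Nat.add_succ_r, 2!csum_S, IH. ring.
Qed.

Lemma cprod_add (f : nat -> C) n m : cprod f (n + m) = cprod f n * cprod (fun i => f (n + i)%nat) m.
Proof.
  induction m as [|m IH]; [rewrite Nat.add_0_r; unfold cprod at 3; simpl; ring|].
  rewrite Nat.add_succ_r, 2!cprod_S, IH. ring.
Qed.

Lemma csum_S_l (f : nat -> C) n : csum f (S n) = f 0%nat + csum (fun i => f (S i)) n.
Proof. change (S n) with (1 + n)%nat. rewrite csum_add. unfold csum at 1; simpl. ring. Qed.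

Lemma cprod_S_l (f : nat -> C) n : cprod f (S n) = f 0%nat * cprod (fun i => f (S i)) n.
Proof. change (S n) with (1 + n)%nat. rewrite cprod_add. unfold cprod at 1; simpl. ring. Qed.

Lemma csum_rev (f : nat -> C) n : csum f n = csum (fun i => f (n - 1 - i)%nat) n.
Proof.
  induction n as [|n IH]; [reflexivity|].
  rewrite csum_S, csum_S_l, IH, Cplus_comm. f_equal; [f_equal; lia|].
  apply csum_ext; intros i Hi. f_equal; lia.
Qed.

Lemma cprod_rev (f : nat -> C) n : cprod f n = cprod (fun i => f (n - 1 - i)%nat) n.
Proof.
  induction n as [|n IH]; [reflexivity|].
  rewrite cprod_S, cprod_S_l, IH, Cmult_comm. f_equal; [f_equal; lia|].
  apply cprod_ext; intros i Hi. f_equal; lia.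
Qed.

Lemma sumC_plus {A} (f g : A -> C) l :
  sumC (map (fun x => f x + g x) l) = sumC (map f l) + sumC (map g l).
Proof. induction l as [|a l IH]; cbn; [ring|]. unfold sumC in IH. rewrite IH. ring. Qed.

Lemma sumC_scal {A} (c : C) (f : A -> C) l :
  sumC (map (fun x => c * f x) l) = c * sumC (map f l).
Proof. induction l as [|a l IH]; cbn; [ring|]. unfold sumC in IH. rewrite IH. ring. Qed.

Lemma sumC_minus {A} (f g : A -> C) l :
  sumC (map (fun x => f x - g x) l) = sumC (map f l) - sumC (map g l).
Proof. induction l as [|a l IH]; cbn; [ring|]. unfold sumC in IH. rewrite IH. ring. Qed.

Lemma prodC_mult {A} (f g : A -> C) l :
  prodC (map (fun x => f x * g x) l) = prodC (map f l) * prodC (map g l).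
Proof. induction l as [|a l IH]; cbn; [ring|]. unfold prodC in IH. rewrite IH. ring. Qed.

Lemma prodC_scal {A} (c : C) (f : A -> C) l :
  prodC (map (fun x => c * f x) l) = c ^ (length l) * prodC (map f l).
Proof. induction l as [|a l IH]; cbn; [ring|]. unfold prodC in IH. rewrite IH. ring. Qed.

Lemma csum_plus (f g : nat -> C) n : csum (fun k => f k + g k) n = csum f n + csum g n.
Proof. apply sumC_plus. Qed.
Lemma csum_minus (f g : nat -> C) n : csum (fun k => f k - g k) n = csum f n - csum g n.
Proof. apply sumC_minus. Qed.
Lemma csum_scal (c : C) (f : nat -> C) n : csum (fun k => c * f k) n = c * csum f n.
Proof. apply sumC_scal. Qed.

Lemma prodC_neq0 {A} (f : A -> C) l : (forall x, In x l -> f x <> 0) -> prodC (map f l) <> 0.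
Proof.
  induction l as [|a l IH]; intros H; cbn; [apply C1_nz|].
  apply Cmult_neq_0; [apply H; now left|]. apply IH. intros x Hx; apply H; now right.
Qed.

Lemma Cinv_mult (a b : C) : a <> 0 -> b <> 0 -> / (a * b) = / a * / b.
Proof. intros; field; auto. Qed.

Lemma Cinv_neq0 (a : C) : a <> 0 -> / a <> 0.
Proof. intros H E. apply C1_nz. rewrite <- (Cinv_r a H), E. ring. Qed.

Lemma prodC_inv {A} (f : A -> C) l : (forall x, In x l -> f x <> 0) ->
  prodC (map (fun x => / f x) l) = / prodC (map f l).
Proof.
  induction l as [|a l IH]; intros H; cbn.
  - field. 
  - unfold prodC in *. rewrite IH by (intros x Hx; apply H; now right).
    rewrite Cinv_mult; auto; [apply H; now left|].
    apply (prodC_neq0 f l). intros x Hx; apply H; now right.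
Qed.

Lemma cprod_neq0 (f : nat -> C) n : (forall i, (i < n)%nat -> f i <> 0) -> cprod f n <> 0.
Proof. intros H. apply prodC_neq0. intros x Hx. apply in_seq in Hx. apply H; lia. Qed.

Lemma cvgC_sumC {A} (u : nat -> A -> C) (l : A -> C) (L : list A) :
  (forall x, In x L -> cvgC (fun n => u n x) (l x)) ->
  cvgC (fun n => sumC (map (u n) L)) (sumC (map l L)).
Proof.
  induction L as [|a L IH]; intros H; cbn; [apply cvgC_const|].
  apply cvgC_plus; [apply H; now left|]. apply IH; intros x Hx; apply H; now right.
Qed.

Lemma cvgC_prodC {A} (u : nat -> A -> C) (l : A -> C) (L : list A) :
  (forall x, In x L -> cvgC (fun n => u n x) (l x)) ->
  cvgC (fun n => prodC (map (u n) L)) (prodC (map l L)).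
Proof.
  induction L as [|a L IH]; intros H; cbn; [apply cvgC_const|].
  apply cvgC_mult; [apply H; now left|]. apply IH; intros x Hx; apply H; now right.
Qed.

Lemma cvgC_csum (u : nat -> nat -> C) (l : nat -> C) k :
  (forall i, (i < k)%nat -> cvgC (fun n => u n i) (l i)) -> cvgC (fun n => csum (u n) k) (csum l k).
Proof. intros H. apply cvgC_sumC. intros x Hx. apply in_seq in Hx. apply H; lia. Qed.

Lemma cvgC_cprod (u : nat -> nat -> C) (l : nat -> C) k :
  (forall i, (i < k)%nat -> cvgC (fun n => u n i) (l i)) -> cvgC (fun n => cprod (u n) k) (cprod l k).
Proof. intros H. apply cvgC_prodC. intros x Hx. apply in_seq in Hx. apply H; lia. Qed.

Lemma cvgC_CSeries (a : nat -> C) (l : C) : cvgC (csum a) l -> CSeries a = l.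
Proof.
  intros H.
  (* [sum_n] includes the index [n] while [csum] stops before it; hence the shift by one. *)
  assert (E : forall n, sum_n (fun k => Re (a k)) n = Re (csum a (S n)) /\
                        sum_n (fun k => Im (a k)) n = Im (csum a (S n))).
  { induction n as [|n [IH1 IH2]].
    - rewrite 2!sum_O. unfold csum; simpl. destruct (a 0%nat); unfold Re, Im; simpl; split; ring.
    - rewrite 2!sum_Sn, IH1, IH2, (csum_S a (S n)). unfold plus; simpl. split; reflexivity. }
  assert (H1 : cvgC (fun n => csum a (S n)) l).
  { apply (cvgC_comp _ _ S); auto. intros K; exists K; intros; lia. }
  unfold CSeries, Series.
  rewrite (is_lim_seq_unique _ (Re l)).
  2:{ eapply is_lim_seq_ext; [|apply (cvgC_Re _ _ H1)]. intros n; symmetry; apply E. }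
  rewrite (is_lim_seq_unique _ (Im l)).
  2:{ eapply is_lim_seq_ext; [|apply (cvgC_Im _ _ H1)]. intros n; symmetry; apply E. }
  simpl. now destruct l.
Qed.

(** * Tannery's theorem *)

Fixpoint rsum (b : nat -> R) (n : nat) : R :=
  match n with O => 0%R | S n' => (rsum b n' + b n')%R end.

(** Bounded partial sums are what a comparison delivers, and for nonnegative terms monotonicity
    turns them into convergence. *)
Definition summable (b : nat -> R) : Prop :=
  (forall k, (0 <= b k)%R) /\ exists M, forall n, (rsum b n <= M)%R.

Lemma rsum_le a b n : (forall k, (a k <= b k)%R) -> (rsum a n <= rsum b n)%R.
Proof. intros H; induction n as [|n IH]; simpl; [lra|]. specialize (H n); lra. Qed.

Lemma rsum_scal c b n : rsum (fun k => c * b k)%R n = (c * rsum b n)%R.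
Proof. induction n as [|n IH]; simpl; [ring|]. rewrite IH; ring. Qed.

Lemma rsum_plus a b n : rsum (fun k => a k + b k)%R n = (rsum a n + rsum b n)%R.
Proof. induction n as [|n IH]; simpl; [ring|]. rewrite IH; ring. Qed.

Lemma summable_scal c b : (0 <= c)%R -> summable b -> summable (fun k => c * b k)%R.
Proof.
  intros Hc [H1 [M H2]]. split.
  - intros k; specialize (H1 k); nra.
  - exists (c * M)%R. intros n. rewrite rsum_scal. apply Rmult_le_compat_l; auto.
Qed.

Lemma summable_tail b : summable b -> forall eps : R, (0 < eps)%R ->
  exists K, forall n, (K <= n)%nat -> (rsum b n - rsum b K < eps)%R.
Proof.
  intros [H1 [M H2]] eps He.
  assert (Hl : ex_finite_lim_seq (rsum b)).
  { apply (ex_finite_lim_seq_incr _ M); auto. intros n; simpl. specialize (H1 n); lra. }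
  apply ex_lim_seq_cauchy_corr in Hl. destruct (Hl (mkposreal _ He)) as [K HK]. simpl in HK.
  exists K; intros n Hn. specialize (HK n K Hn (Nat.le_refl _)).
  eapply Rle_lt_trans; [apply Rle_abs | exact HK].
Qed.

Lemma csum_Cmod (f : nat -> C) b n m : (n <= m)%nat -> (forall k, (n <= k < m)%nat -> (Cmod (f k) <= b k)%R) ->
  (Cmod (csum f m - csum f n) <= rsum b m - rsum b n)%R.
Proof.
  intros Hnm. induction Hnm as [|m Hm IH]; intros H.
  - replace (csum f n - csum f n) with (RtoC 0) by ring. rewrite Cmod_0; lra.
  - rewrite csum_S. simpl.
    replace (csum f m + f m - csum f n) with ((csum f m - csum f n) + f m) by ring.
    eapply Rle_trans; [apply Cmod_triangle|].
    specialize (H m ltac:(lia)) as Hm'. specialize (IH ltac:(intros; apply H; lia)). lra.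
Qed.

Lemma csum_Cmod0 (f : nat -> C) b m : (forall k, (k < m)%nat -> (Cmod (f k) <= b k)%R) ->
  (Cmod (csum f m) <= rsum b m)%R.
Proof.
  intros H. assert (T := csum_Cmod f b 0 m ltac:(lia) ltac:(intros; apply H; lia)).
  unfold csum at 2 in T; simpl in T. replace (csum f m - 0) with (csum f m) in T by ring. lra.
Qed.

Lemma summable_cvgC (a : nat -> C) (b : nat -> R) : summable b ->
  (forall k, (Cmod (a k) <= b k)%R) -> exists l, cvgC (csum a) l.
Proof.
  intros Hb H. apply cvgC_cauchy. intros eps He.
  destruct (summable_tail b Hb (eps / 2)%R ltac:(lra)) as [K HK].
  exists K; intros n m Hn Hm.
  assert (A := csum_Cmod a b K n Hn ltac:(intros; apply H)).
  assert (B := csum_Cmod a b K m Hm ltac:(intros; apply H)).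
  specialize (HK n Hn) as HA; specialize (HK m Hm) as HB.
  replace (csum a n - csum a m) with ((csum a n - csum a K) + - (csum a m - csum a K)) by ring.
  eapply Rle_lt_trans; [apply Cmod_triangle|]. rewrite Cmod_opp. lra.
Qed.

(** Cut at [K] where the tail of [b] is below eps/4. The two tails, the difference of the heads and
    the remainder of the limit series each cost eps/4. The number of terms [M N] varies with [N],
    because the truncated integrand has finitely many poles in each progression. *)
Lemma tannery_gen (a : nat -> nat -> C) (al : nat -> C) (b : nat -> R) (M : nat -> nat) (N0 : nat) :
  summable b -> to_inf M ->
  (forall N k, (N0 <= N)%nat -> (k < M N)%nat -> (Cmod (a N k) <= b k)%R) ->
  (forall k, cvgC (fun N => a N k) (al k)) ->
  (forall k, (Cmod (al k) <= b k)%R) /\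
  exists l, cvgC (csum al) l /\ cvgC (fun N => csum (a N) (M N)) l.
Proof.
  intros Hb HM Hab Hlim.
  assert (Hal : forall k, (Cmod (al k) <= b k)%R).
  { intros k. destruct (HM (S k)) as [N1 HN1].
    apply (cvgC_le (fun N => a N k) (al k) (b k) (Nat.max N0 N1)); auto.
    intros n Hn. apply Hab; [lia|]. specialize (HN1 n ltac:(lia)). lia. }
  split; auto.
  destruct (summable_cvgC al b Hb Hal) as [l Hl]. exists l; split; auto.
  intros eps He.
  destruct (summable_tail b Hb (eps / 4)%R ltac:(lra)) as [K HK].
  destruct (Hl (eps / 4)%R ltac:(lra)) as [K2 HK2].
  assert (Hfin := cvgC_csum a al K ltac:(intros; apply Hlim)).
  destruct (Hfin (eps / 4)%R ltac:(lra)) as [N1 HN1].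
  destruct (HM (Nat.max K K2)) as [N2 HN2].
  exists (Nat.max N0 (Nat.max N1 N2)). intros n Hn.
  specialize (HN2 n ltac:(lia)). specialize (HN1 n ltac:(lia)).
  assert (A := csum_Cmod (a n) b K (M n) ltac:(lia) ltac:(intros; apply Hab; lia)).
  assert (B := csum_Cmod al b K (M n) ltac:(lia) ltac:(intros; apply Hal)).
  specialize (HK (M n) ltac:(lia)). specialize (HK2 (M n) ltac:(lia)).
  replace (csum (a n) (M n) - l) with
    ((csum (a n) (M n) - csum (a n) K) + (csum (a n) K - csum al K)
      + (- (csum al (M n) - csum al K) + (csum al (M n) - l))) by ring.
  eapply Rle_lt_trans; [apply Cmod_triangle|].
  assert (T1 := Cmod_triangle (csum (a n) (M n) - csum (a n) K) (csum (a n) K - csum al K)).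
  assert (T2 := Cmod_triangle (- (csum al (M n) - csum al K)) (csum al (M n) - l)).
  rewrite Cmod_opp in T2. lra.
Qed.

(** * Complex exponentials and powers *)

Lemma Cexp_add (a b : C) : Cexp (a + b) = Cexp a * Cexp b.
Proof.
  destruct a as [a1 a2], b as [b1 b2]. unfold Cexp, Cmult, Cplus, Re, Im; simpl.
  rewrite exp_plus, cos_plus, sin_plus. f_equal; ring.
Qed.

Lemma Cexp_0 : Cexp 0 = 1.
Proof. unfold Cexp, Re, Im; simpl. rewrite exp_0, cos_0, sin_0. unfold RtoC. f_equal; ring. Qed.

Lemma Cexp_opp_mult (a : C) : Cexp (- a) * Cexp a = 1.
Proof. rewrite <- Cexp_add. replace (- a + a) with (RtoC 0) by ring. apply Cexp_0. Qed.

Lemma Cexp_neq0 (a : C) : Cexp a <> 0.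
Proof. intros E. apply C1_nz. rewrite <- (Cexp_opp_mult a), E. ring. Qed.

Lemma Cexp_opp (a : C) : Cexp (- a) = / Cexp a.
Proof.
  assert (H := Cexp_neq0 a). rewrite <- (Cmult_1_l (/ Cexp a)), <- (Cexp_opp_mult a). field; auto.
Qed.

Lemma Cmod_Cexp (a : C) : Cmod (Cexp a) = exp (Re a).
Proof.
  unfold Cexp, Cmod; simpl.
  replace (_ + _)%R with ((exp (Re a)) * (exp (Re a)) * ((sin (Im a))² + (cos (Im a))²))%R
    by (unfold Rsqr; ring).
  rewrite sin2_cos2, Rmult_1_r. apply sqrt_square. left; apply exp_pos.
Qed.

Lemma Cmod_le_parts (z : C) : (Cmod z <= Rabs (Re z) + Rabs (Im z))%R.
Proof.
  replace z with (RtoC (Re z) + Ci * RtoC (Im z)) at 1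
    by (destruct z; unfold Ci, RtoC, Cplus, Cmult, Re, Im; simpl; f_equal; ring).
  eapply Rle_trans; [apply Cmod_triangle|].
  rewrite Cmod_mult, Cmod_Ci, 2!Cmod_R. lra.
Qed.

Lemma Im_le_Cmod (z : C) : (Rabs (Im z) <= Cmod z)%R.
Proof. eapply Rle_trans; [|apply Rmax_Cmod]. apply Rmax_r. Qed.

(** No power series is involved: [1 - x <= exp (- x)] means [(1 - x) * exp x <= 1], which gives the
    upper bounds on the interval. *)
Lemma exp_sub_1_sub_bound (x : R) : (Rabs x <= 1 / 2)%R ->
  (0 <= exp x - 1 - x <= 2 * (x * x))%R /\ (exp x <= 2)%R.
Proof.
  intros Hx. apply Rabs_le_between in Hx.
  assert (H1 := exp_ineq1_le x). assert (H2 := exp_ineq1_le (- x)).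
  assert (H3 : (exp (- x) * exp x = 1)%R).
  { rewrite <- exp_plus. replace (- x + x)%R with 0%R by ring. apply exp_0. }
  assert (H4 := exp_pos x).
  assert (H5 : ((1 - x) * exp x <= 1)%R) by nra.
  split; [split|]; nra.
Qed.

Lemma sin_abs_le (y : R) : (Rabs (sin y) <= Rabs y)%R.
Proof.
  destruct (Rtotal_order y 0) as [H|[H|H]].
  - destruct (Rle_dec (-1) y) as [H1|H1].
    + assert (A := sin_lt_x (- y) ltac:(lra)). rewrite sin_neg in A.
      assert (B : (0 <= sin (- y))%R) by (apply sin_ge_0; assert (T := PI2_1); lra).
      rewrite sin_neg in B.
      rewrite 2!Rabs_left1; lra.
    + assert (A := SIN_bound y). rewrite (Rabs_left y) by lra. apply Rabs_le; lra.
  - subst. rewrite sin_0; lra.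
  - destruct (Rle_dec y 1) as [H1|H1].
    + assert (A := sin_lt_x y H).
      assert (B : (0 <= sin y)%R) by (apply sin_ge_0; assert (T := PI2_1); lra).
      rewrite 2!Rabs_pos_eq; lra.
    + assert (A := SIN_bound y). rewrite (Rabs_pos_eq y) by lra. apply Rabs_le; lra.
Qed.

Lemma sin_cubic_lower (y : R) : (0 <= y <= PI)%R -> (y - y * y * y / 6 <= sin y)%R.
Proof.
  (* At order 0 the lower Taylor approximant is y - y^3/6. *)
  intros Hy. destruct (sin_bound y 0 ltac:(lra) ltac:(lra)) as [A _].
  unfold sin_approx, sin_term in A. simpl in A. eapply Rle_trans; [|exact A]. right. field.
Qed.

Lemma sin_sub_bound (y : R) : (Rabs y <= 1 / 2)%R -> (Rabs (sin y - y) <= y * y)%R.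
Proof.
  assert (P : forall y, (0 <= y <= 1 / 2)%R -> (Rabs (sin y - y) <= y * y)%R).
  { intros t Ht. assert (A := sin_cubic_lower t ltac:(assert (T := PI2_1); lra)).
    assert (B := sin_abs_le t). rewrite (Rabs_pos_eq t) in B by lra.
    apply Rabs_le_between in B. apply Rabs_le. nra. }
  intros Hy. destruct (Rle_dec 0 y).
  - apply P. rewrite Rabs_pos_eq in Hy; lra.
  - specialize (P (- y)%R). rewrite sin_neg in P.
    replace (- sin y - - y)%R with (- (sin y - y))%R in P by ring. rewrite Rabs_Ropp in P.
    rewrite Rabs_left in Hy by lra. specialize (P ltac:(lra)). nra.
Qed.

(** With w = x + iy, the real part of the remainder is at most 2x^2 + y^2 and the imaginary part at
    most x^2 + 4y^2; the constant 8 is a rounded bound for their sum. *)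
Lemma Cexp_bound2 (w : C) : (Cmod w <= 1 / 2)%R ->
  (Cmod (Cexp w - 1 - w) <= 8 * (Cmod w * Cmod w))%R.
Proof.
  intros Hw.
  assert (Hx : (Rabs (Re w) <= 1 / 2)%R) by (eapply Rle_trans; [apply re_le_Cmod | auto]).
  assert (Hy : (Rabs (Im w) <= 1 / 2)%R) by (eapply Rle_trans; [apply Im_le_Cmod | auto]).
  assert (E : (Cmod w * Cmod w = Re w * Re w + Im w * Im w)%R).
  { generalize (Cmod2_alt w). simpl. lra. }
  rewrite E. destruct w as [x y]. unfold Re, Im in *; simpl in *.
  eapply Rle_trans; [apply Cmod_le_parts|]. unfold Cexp, Re, Im; simpl.
  destruct (exp_sub_1_sub_bound x Hx) as [[A1 A2] A3]. assert (A4 := exp_pos x).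
  assert (B := sin_sub_bound y Hy). assert (D := sin_abs_le y).
  assert (F : (0 <= 1 - cos y <= y * y / 2)%R).
  { assert (G := COS_bound y). split; [lra|].
    replace y with (2 * (y / 2))%R at 1 by field. rewrite cos_2a_sin.
    assert (I := sin_abs_le (y / 2)). apply Rsqr_le_abs_1 in I. unfold Rsqr in I. lra. }
  assert (P1 : (Rabs (exp x * cos y + - (1) + - x) <= 2 * (x * x) + y * y)%R).
  { replace (exp x * cos y + - (1) + - x)%R with ((exp x - 1 - x) - exp x * (1 - cos y))%R by ring.
    apply Rabs_le. split; nra. }
  assert (P2 : (Rabs (exp x * sin y + -0 + - y) <= x * x + 4 * (y * y))%R).
  { replace (exp x * sin y + -0 + - y)%R with ((exp x - 1) * sin y + (sin y - y))%R by ring.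
    eapply Rle_trans; [apply Rabs_triang|]. rewrite Rabs_mult.
    assert (Q : (Rabs (exp x - 1) <= 2 * Rabs x)%R).
    { replace (exp x - 1)%R with ((exp x - 1 - x) + x)%R by ring.
      eapply Rle_trans; [apply Rabs_triang|]. rewrite (Rabs_pos_eq (exp x - 1 - x)) by lra.
      assert (x * x = Rabs x * Rabs x)%R by (rewrite <- Rabs_mult; symmetry; apply Rabs_pos_eq; nra).
      assert (S := Rabs_pos x). nra. }
    assert (Q2 : (Rabs (exp x - 1) * Rabs (sin y) <= 2 * Rabs x * Rabs y)%R).
    { apply Rmult_le_compat; auto using Rabs_pos. }
    assert (x * x = Rabs x * Rabs x)%R by (rewrite <- Rabs_mult; symmetry; apply Rabs_pos_eq; nra).
    assert (y * y = Rabs y * Rabs y)%R by (rewrite <- Rabs_mult; symmetry; apply Rabs_pos_eq; nra).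
    assert (S := Rabs_pos x). assert (S' := Rabs_pos y). nra. }
  lra.
Qed.

Lemma Cexp_bound1 (w : C) : (Cmod w <= 1 / 2)%R -> (Cmod (Cexp w - 1) <= 5 * Cmod w)%R.
Proof.
  intros Hw. replace (Cexp w - 1) with ((Cexp w - 1 - w) + w) by ring.
  eapply Rle_trans; [apply Cmod_triangle|]. assert (A := Cexp_bound2 w Hw).
  assert (B := Cmod_ge_0 w). nra.
Qed.

Lemma cvgC_Cexp_0 (u : nat -> C) : cvgC u 0 -> cvgC (fun n => Cexp (u n)) 1.
Proof.
  intros H. destruct (H (1 / 2)%R ltac:(lra)) as [N HN].
  apply (cvgC_squeeze _ _ (fun n => 5 * Cmod (u n))%R N).
  - intros n Hn. apply Cexp_bound1. specialize (HN n Hn).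
    replace (u n - 0) with (u n) in HN by ring. lra.
  - assert (T := cvgC_Cmod _ _ H). rewrite Cmod_0 in T.
    apply (is_lim_seq_scal_l _ 5 0) in T. simpl in T. rewrite Rmult_0_r in T. exact T.
Qed.

Lemma ln_1p_bounds (h : R) : (0 <= h)%R -> (h / (1 + h) <= ln (1 + h) <= h)%R.
Proof.
  intros Hh. split.
  - assert (A := exp_ineq1_le (- ln (1 + h))). rewrite exp_Ropp, exp_ln in A by lra.
    apply Rle_trans with (1 - / (1 + h))%R; [right; field; lra | lra].
  - rewrite <- (ln_exp h) at 2. apply ln_le; [lra | apply exp_ineq1_le].
Qed.

(** Extends [npow] to real bases, which the ratios (n+c)/(n+d) require; at [INR n] the two are
    convertible. *)
Definition cpow (t : R) (z : C) : C := Cexp (z * RtoC (ln t)).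

Lemma cpow_add t a b : cpow t (a + b) = cpow t a * cpow t b.
Proof. unfold cpow. rewrite <- Cexp_add. f_equal. ring. Qed.

Lemma cpow_neq0 t z : cpow t z <> 0. Proof. apply Cexp_neq0. Qed.

Lemma cpow_0 t : cpow t 0 = 1.
Proof. unfold cpow. rewrite Cmult_0_l. apply Cexp_0. Qed.

Lemma cpow_opp t z : cpow t (- z) = / cpow t z.
Proof. unfold cpow. rewrite <- Cexp_opp. f_equal. ring. Qed.

Lemma cpow_1 t : (0 < t)%R -> cpow t 1 = RtoC t.
Proof.
  intros H. unfold cpow. rewrite Cmult_1_l. unfold Cexp, Re, Im; simpl.
  rewrite cos_0, sin_0, exp_ln by auto. unfold RtoC; f_equal; ring.
Qed.

Lemma cpow_div s t z : (0 < s)%R -> (0 < t)%R -> cpow (s / t) z = cpow s z / cpow t z.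
Proof.
  intros Hs Ht. unfold cpow, Cdiv. rewrite <- Cexp_opp, <- Cexp_add. f_equal.
  unfold Rdiv. rewrite ln_mult, ln_Rinv by (auto using Rinv_0_lt_compat). rewrite RtoC_plus, RtoC_opp.
  ring.
Qed.

Lemma Cmod_cpow t z : Cmod (cpow t z) = Rpower t (Re z).
Proof.
  unfold cpow, Rpower. rewrite Cmod_Cexp. f_equal. unfold Re, Im; simpl. ring.
Qed.

Lemma cvgC_cpow (t : nat -> R) z : is_lim_seq t 1 -> cvgC (fun n => cpow (t n) z) 1.
Proof.
  intros H. apply cvgC_Cexp_0.
  replace (RtoC 0) with (z * RtoC 0) by ring. apply cvgC_mult; [apply cvgC_const|].
  apply cvgC_RtoC. rewrite <- ln_1.
  apply (is_lim_seq_continuous ln t 1); auto.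
  apply derivable_continuous_pt. exists (/ 1)%R. apply derivable_pt_lim_ln. lra.
Qed.

Lemma cvgC_cpow_ratio (a b : nat -> R) z N0 : (forall n, (N0 <= n)%nat -> (0 < a n)%R /\ (0 < b n)%R) ->
  is_lim_seq (fun n => a n / b n)%R 1 -> cvgC (fun n => cpow (a n) z / cpow (b n) z) 1.
Proof.
  intros H Hl. apply (cvgC_ext_loc (fun n => cpow (a n / b n) z) _ _ N0).
  - intros n Hn. destruct (H n Hn). now apply cpow_div.
  - now apply cvgC_cpow.
Qed.

Lemma is_lim_seq_inv_S : is_lim_seq (fun n => / INR (S n))%R 0.
Proof.
  apply (is_lim_seq_incr_1 (fun n => / INR n)%R).
  replace (Finite 0) with (Rbar_inv p_infty) by reflexivity.
  apply is_lim_seq_inv; [apply is_lim_seq_INR | discriminate].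
Qed.

Lemma is_lim_seq_div_INR (c : R) : is_lim_seq (fun n => c / INR n)%R 0.
Proof.
  replace (Finite 0) with (Rbar_mult (Finite c) (Finite 0)) by (simpl; f_equal; ring).
  apply is_lim_seq_scal_l. apply is_lim_seq_incr_1. apply is_lim_seq_inv_S.
Qed.

Lemma is_lim_seq_affine_ratio (c : R) : is_lim_seq (fun n => (INR n + c) / INR n)%R 1.
Proof.
  apply (is_lim_seq_ext_loc (fun n => 1 + c / INR n)%R).
  - exists 1%nat. intros n Hn. assert (0 < INR n)%R by (apply lt_0_INR; lia). field. lra.
  - replace (Finite 1) with (Rbar_plus (Finite 1) (Finite 0)) by (simpl; f_equal; ring).
    apply is_lim_seq_plus'; [apply is_lim_seq_const | apply is_lim_seq_div_INR].
Qed.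

Lemma cvgC_cpow_shift (c d : R) z :
  cvgC (fun n => cpow (INR n + c) z / cpow (INR n + d) z) 1.
Proof.
  destruct (INR_unbounded (Rabs c + Rabs d)) as [N HN].
  assert (Hp : forall n, (N <= n)%nat -> (0 < INR n + c)%R /\ (0 < INR n + d)%R /\ (0 < INR n)%R).
  { intros n Hn. apply le_INR in Hn. assert (A := Rabs_pos c). assert (B := Rabs_pos d).
    assert (X := Rle_abs (- c)). assert (Y := Rle_abs (- d)). rewrite Rabs_Ropp in X, Y. lra. }
  apply (cvgC_cpow_ratio _ _ z N); [intros n Hn; destruct (Hp n Hn) as [? [? ?]]; auto|].
  apply (is_lim_seq_ext_loc (fun n => (INR n + c) / INR n / ((INR n + d) / INR n))%R).
  - exists N. intros n Hn. destruct (Hp n Hn) as [? [? ?]]. field; lra.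
  - replace (Finite 1) with (Rbar_div (Finite 1) (Finite 1)) by (simpl; f_equal; field).
    apply is_lim_seq_div'; [apply is_lim_seq_affine_ratio | apply is_lim_seq_affine_ratio | lra].
Qed.

(** * Comparison series and infinite products *)

(** The base is n+1 so that the comparison sequences start with the value 1 at index 0. *)
Definition succ_pow (n : nat) (a : R) : R := Rpower (INR (S n)) a.

Lemma succ_pow_pos n a : (0 < succ_pow n a)%R. Proof. apply exp_pos. Qed.

Lemma succ_pow_0 n : succ_pow n 0 = 1%R.
Proof. unfold succ_pow. apply Rpower_O. apply lt_0_INR; lia. Qed.

Lemma succ_pow_plus n a b : succ_pow n (a + b) = (succ_pow n a * succ_pow n b)%R.
Proof. unfold succ_pow. apply Rpower_plus. Qed.

(** A discrete integral test: for x = n+1, [ln (x + 1) - ln x >= / (x + 1)] gives (x+1)^(-1-s) <=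
    (x^(-s) - (x+1)^(-s)) / s, and the right side telescopes. *)
Lemma summable_succ_pow (s : R) : (0 < s)%R -> summable (fun k => succ_pow k (- 1 - s)).
Proof.
  intros Hs. split; [intros k; left; apply succ_pow_pos|].
  exists (1 + / s)%R.
  assert (Hinv : (0 < / s)%R) by now apply Rinv_0_lt_compat.
  assert (St : forall n, (succ_pow (S n) (- 1 - s) <= / s * (succ_pow n (- s) - succ_pow (S n) (- s)))%R).
  { intros n. set (x := INR (S n)). assert (Hx : (0 < x)%R) by (apply lt_0_INR; lia).
    assert (Hx1 : INR (S (S n)) = (x + 1)%R) by (rewrite S_INR; reflexivity).
    unfold succ_pow. rewrite Hx1. fold x.
    assert (L : (ln (x + 1) - ln x >= / (x + 1))%R).
    { destruct (ln_1p_bounds (/ x)) as [B _]; [left; now apply Rinv_0_lt_compat|].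
      replace (/ x / (1 + / x))%R with (/ (x + 1))%R in B by (field; lra).
      replace (1 + / x)%R with ((x + 1) * / x)%R in B by (field; lra).
      rewrite ln_mult, ln_Rinv in B; auto using Rinv_0_lt_compat; lra. }
    replace (- 1 - s)%R with (- s + - (1))%R by ring. rewrite Rpower_plus, (Rpower_Ropp (x + 1) 1), Rpower_1 by lra.
    assert (E : Rpower x (- s) = (Rpower (x + 1) (- s) * exp (s * (ln (x + 1) - ln x)))%R).
    { unfold Rpower. rewrite <- exp_plus. f_equal. ring. }
    rewrite E. assert (P := exp_pos (- s * ln (x + 1))).
    assert (Q := exp_ineq1_le (s * (ln (x + 1) - ln x))).
    replace (/ s * (Rpower (x + 1) (- s) * exp (s * (ln (x + 1) - ln x)) - Rpower (x + 1) (- s)))%R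
      with (Rpower (x + 1) (- s) * (/ s * (exp (s * (ln (x + 1) - ln x)) - 1)))%R by ring.
    apply Rmult_le_compat_l; [left; exact P|].
    apply Rle_trans with (/ s * (s * (ln (x + 1) - ln x)))%R.
    - rewrite <- Rmult_assoc, Rinv_l by lra. lra.
    - apply Rmult_le_compat_l; lra. }
  assert (B : forall n, (rsum (fun k => succ_pow k (- 1 - s)) (S n) <= 1 + / s * (1 - succ_pow n (- s)))%R).
  { induction n as [|n IH].
    - simpl. unfold succ_pow, Rpower. simpl. rewrite ln_1, 2!Rmult_0_r, exp_0. lra.
    - change (rsum (fun k => succ_pow k (-1 - s)) (S n) + succ_pow (S n) (- 1 - s) <= 1 + / s * (1 - succ_pow (S n) (- s)))%R.
      specialize (St n). lra. }
  intros [|n]; [simpl; lra|]. eapply Rle_trans; [apply B|].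
  assert (T := succ_pow_pos n (- s)). nra.
Qed.

Lemma succ_pow_m2 n : succ_pow n (-2) = (/ (INR (S n) * INR (S n)))%R.
Proof.
  unfold succ_pow. assert (0 < INR (S n))%R by (apply lt_0_INR; lia).
  replace (-2)%R with (- (1 + 1))%R by ring. rewrite Rpower_Ropp, Rpower_plus, Rpower_1; auto.
Qed.

Lemma summable_inv_sq : summable (fun k => / (INR (S k) * INR (S k)))%R.
Proof.
  destruct (summable_succ_pow 1 ltac:(lra)) as [A [M B]]. split.
  - intros k. rewrite <- succ_pow_m2. left; apply succ_pow_pos.
  - exists M. intros n. eapply Rle_trans; [|apply B]. apply rsum_le. intros k. rewrite <- succ_pow_m2.
    right. f_equal. lra.
Qed.

Lemma cprod_bound (u : nat -> C) b n : (forall k, (k < n)%nat -> (Cmod (u k) <= b k)%R) ->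
  (forall k, (0 <= b k)%R) ->
  (Cmod (cprod (fun k => 1 + u k)%C n) <= exp (rsum b n))%R.
Proof.
  intros H Hb. induction n as [|n IH]; [unfold cprod; simpl; rewrite Cmod_1, exp_0; lra|].
  rewrite cprod_S, Cmod_mult. simpl. rewrite exp_plus.
  apply Rmult_le_compat; auto using Cmod_ge_0.
  eapply Rle_trans; [apply Cmod_triangle|]. rewrite Cmod_1.
  assert (A := exp_ineq1_le (b n)). specialize (H n ltac:(lia)). lra.
Qed.

Lemma cprod_sub_1_bound (u : nat -> C) b n : (forall k, (k < n)%nat -> (Cmod (u k) <= b k)%R) ->
  (forall k, (0 <= b k)%R) ->
  (Cmod (cprod (fun k => 1 + u k)%C n - 1) <= exp (rsum b n) - 1)%R.
Proof.
  intros H Hb. induction n as [|n IH].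
  - unfold cprod; simpl. replace (1 - 1) with (RtoC 0) by ring. rewrite Cmod_0, exp_0. lra.
  - rewrite cprod_S.
    replace (cprod (fun k => 1 + u k)%C n * (1 + u n) - 1) with
      ((cprod (fun k => 1 + u k)%C n - 1) + cprod (fun k => 1 + u k)%C n * u n) by ring.
    eapply Rle_trans; [apply Cmod_triangle|]. rewrite Cmod_mult. simpl. rewrite exp_plus.
    specialize (IH ltac:(intros; apply H; lia)).
    assert (B := cprod_bound u b n ltac:(intros; apply H; lia) Hb).
    specialize (H n ltac:(lia)). assert (A := exp_ineq1_le (b n)).
    assert (P := exp_pos (rsum b n)). assert (Q := Cmod_ge_0 (u n)).
    assert (Cmod (cprod (fun k => 1 + u k)%C n) * Cmod (u n) <= exp (rsum b n) * b n)%R.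
    { apply Rmult_le_compat; auto using Cmod_ge_0. }
    nra.
Qed.

Lemma cprod_telescope (u : nat -> C) n :
  cprod (fun k => 1 + u k)%C n = 1 + csum (fun k => u k * cprod (fun i => 1 + u i)%C k) n.
Proof.
  induction n as [|n IH]; [unfold cprod, csum; simpl; ring|].
  rewrite cprod_S, csum_S, Cplus_assoc, <- IH. ring.
Qed.

(* The telescoped product is a series, so that [tannery_gen] also handles products. *)
Lemma tannery_prod (u : nat -> nat -> C) (ul : nat -> C) (b : nat -> R) (M : nat -> nat) (N0 : nat) :
  summable b -> to_inf M ->
  (forall N k, (N0 <= N)%nat -> (k < M N)%nat -> (Cmod (u N k) <= b k)%R) ->
  (forall k, cvgC (fun N => u N k) (ul k)) ->
  exists l, cvgC (cprod (fun k => 1 + ul k)) l /\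
            cvgC (fun N => cprod (fun k => 1 + u N k) (M N)) l.
Proof.
  intros Hb HM Hub Hlim. destruct Hb as [Hb0 [B HB]].
  destruct (tannery_gen (fun N k => u N k * cprod (fun i => 1 + u N i) k)
              (fun k => ul k * cprod (fun i => 1 + ul i) k)
              (fun k => exp B * b k)%R M N0) as [_ [l [H1 H2]]]; auto.
  - apply summable_scal; [left; apply exp_pos|]. split; eauto.
  - intros N k HN Hk. rewrite Cmod_mult, Rmult_comm.
    apply Rmult_le_compat; auto using Cmod_ge_0.
    eapply Rle_trans; [apply (cprod_bound _ b); auto; intros; apply Hub; lia|].
    destruct (Rle_lt_or_eq_dec _ _ (HB k)) as [E|E]; [left; now apply exp_increasing | rewrite E; lra].
  - intros k. apply cvgC_mult; auto.
    apply cvgC_cprod. intros i _. apply cvgC_plus; auto. apply cvgC_const.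
  - exists (1 + l). split.
    + eapply cvgC_ext; [intros n; symmetry; apply cprod_telescope|].
      apply cvgC_plus; auto. apply cvgC_const.
    + eapply cvgC_ext; [intros n; symmetry; apply cprod_telescope|].
      apply cvgC_plus; auto. apply cvgC_const.
Qed.

Lemma exp_half_lt_2 : (exp (1 / 2) < 2)%R.
Proof.
  assert (A := exp_le_3). assert (B : (exp (1/2) * exp (1/2) = exp 1)%R).
  { rewrite <- exp_plus. f_equal. lra. }
  assert (P := exp_pos (1 / 2)). nra.
Qed.

(** Choose [K] with the tail of [b] below 1/2. Every later partial product differs from the nonzero
    head [P] by a factor within exp(1/2) - 1 < 1 of 1, so its modulus stays above |P| (2 -
    exp(1/2)). *)
Lemma prod_limit_neq0 (u : nat -> C) b l : summable b ->
  (forall k, (Cmod (u k) <= b k)%R) -> (forall k, 1 + u k <> 0) ->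
  cvgC (cprod (fun k => 1 + u k)%C) l -> l <> 0.
Proof.
  intros Hb Hu Hn Hl. destruct (summable_tail b Hb (1/2)%R ltac:(lra)) as [K HK].
  destruct Hb as [Hb0 _].
  assert (HP : cprod (fun k => 1 + u k)%C K <> 0) by (apply cprod_neq0; auto).
  assert (Hm := proj1 (Cmod_gt_0 _) HP). set (P := cprod (fun k => 1 + u k)%C K) in *.
  assert (Low : forall n, (Cmod P * (2 - exp (1/2)) <= Cmod (cprod (fun k => 1 + u k)%C (K + n)))%R).
  { intros n. rewrite cprod_add, Cmod_mult. fold P. apply Rmult_le_compat_l; [apply Cmod_ge_0|].
    assert (E : (Cmod (cprod (fun k => 1 + u (K + k)%nat)%C n - 1) <= exp (1/2) - 1)%R).
    { eapply Rle_trans; [apply (cprod_sub_1_bound _ (fun k => b (K + k)%nat)); auto|].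
      assert (S : forall m, rsum (fun k => b (K + k)%nat) m = (rsum b (K + m) - rsum b K)%R).
      { induction m as [|m IH]; [simpl; rewrite Nat.add_0_r; ring|].
        rewrite Nat.add_succ_r. simpl. rewrite IH. ring. }
      specialize (HK (K + n)%nat ltac:(lia)). rewrite <- S in HK.
      apply Rplus_le_compat_r. left. now apply exp_increasing. }
    assert (T := Cmod_triangle_sub 1 (1 - cprod (fun k => 1 + u (K + k)%nat)%C n)).
    rewrite Cmod_1 in T.
    replace (1 - (1 - cprod (fun k => 1 + u (K + k)%nat)%C n)) with
      (cprod (fun k => 1 + u (K + k)%nat)%C n) in T by ring.
    rewrite Cmod_sub_sym in E. lra. }
  intros E. subst l. assert (Ex := exp_half_lt_2).
  destruct (Hl (Cmod P * (2 - exp (1/2)))%R) as [N HN]; [apply Rmult_lt_0_compat; lra|].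
  specialize (HN (K + N)%nat ltac:(lia)). specialize (Low N).
  replace (cprod (fun k => 1 + u k)%C (K + N) - 0) with (cprod (fun k => 1 + u k)%C (K + N)) in HN by ring.
  lra.
Qed.

(** * Gauss' product for the Gamma function *)

Definition nonpole (z : C) : Prop := forall n : nat, z + nC n <> 0.

Lemma nC_S n : nC (S n) = nC n + 1.
Proof. unfold nC. now rewrite S_INR, RtoC_plus. Qed.
Lemma nC_0 : nC 0 = 0. Proof. reflexivity. Qed.
Lemma nC_add n m : nC (n + m) = nC n + nC m.
Proof. unfold nC. now rewrite plus_INR, RtoC_plus. Qed.
Lemma nC_mul n m : nC (n * m) = nC n * nC m.
Proof. unfold nC. now rewrite mult_INR, RtoC_mult. Qed.
Lemma nC_sub n m : (m <= n)%nat -> nC (n - m) = nC n - nC m.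
Proof. intros H. unfold nC. now rewrite minus_INR, RtoC_minus. Qed.
Lemma RtoC_neq0 (x : R) : (x <> 0)%R -> RtoC x <> 0.
Proof. intros H E. apply H. now injection E. Qed.
Lemma nC_neq0 n : (0 < n)%nat -> nC n <> 0.
Proof. intros H. apply RtoC_neq0. apply not_0_INR; lia. Qed.
Lemma nC_S_neq0 n : nC (S n) <> 0. Proof. apply nC_neq0; lia. Qed.
Lemma nC_fact_neq0 n : nC (fact n) <> 0. Proof. apply nC_neq0, lt_O_fact. Qed.
Lemma nC_fact_S n : nC (fact (S n)) = nC (S n) * nC (fact n).
Proof. rewrite <- nC_mul. reflexivity. Qed.
Lemma Cmod_nC n : Cmod (nC n) = INR n.
Proof. unfold nC. rewrite Cmod_R. apply Rabs_pos_eq, pos_INR. Qed.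
Lemma INR_S_pos n : (0 < INR (S n))%R. Proof. apply lt_0_INR; lia. Qed.

Lemma Csub_neq0 (a b : C) : a <> b -> a - b <> 0.
Proof. intros H E. apply H. replace a with (a - b + b) by ring. rewrite E; ring. Qed.

Lemma notInt_add_nat z n : notInt z -> notInt (z + nC n).
Proof.
  intros H k E. apply (H (k - Z.of_nat n)%Z). rewrite minus_IZR, <- INR_IZR_INZ, RtoC_minus.
  change (RtoC (INR n)) with (nC n). rewrite <- E. ring.
Qed.
Lemma notInt_opp z : notInt z -> notInt (- z).
Proof.
  intros H k E. apply (H (- k)%Z). rewrite opp_IZR, RtoC_opp, <- E. ring.
Qed.
Lemma notInt_sub_nat z n : notInt z -> notInt (z - nC n).
Proof.
  intros H. replace (z - nC n) with (- (- z + nC n)) by ring.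
  apply notInt_opp, notInt_add_nat, notInt_opp, H.
Qed.
Lemma notInt_nat_sub z n : notInt z -> notInt (nC n - z).
Proof. intros H. replace (nC n - z) with (- z + nC n) by ring. apply notInt_add_nat, notInt_opp, H. Qed.
Lemma notInt_1_sub z : notInt z -> notInt (1 - z).
Proof. apply (notInt_nat_sub z 1). Qed.
Lemma notInt_neq0 z : notInt z -> z <> 0.
Proof. intros H. apply (H 0%Z). Qed.
Lemma notInt_nonpole z : notInt z -> nonpole z.
Proof. intros H n. apply notInt_neq0, notInt_add_nat, H. Qed.
Lemma nonpole_nC_S n : nonpole (nC (S n)).
Proof. intros k. rewrite <- nC_add. apply nC_neq0; lia. Qed.
Lemma nonpole_add z n : nonpole z -> nonpole (z + nC n).
Proof. intros H k. rewrite <- Cplus_assoc, <- nC_add. apply H. Qed.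

Lemma poch_cprod x k : poch x k = cprod (fun i => x + nC i) k.
Proof. reflexivity. Qed.
Lemma poch_0 x : poch x 0 = 1. Proof. reflexivity. Qed.
Lemma poch_S x k : poch x (S k) = poch x k * (x + nC k).
Proof. rewrite 2!poch_cprod. apply cprod_S. Qed.
Lemma poch_add x n k : poch x (n + k) = poch x n * poch (x + nC n) k.
Proof.
  rewrite 3!poch_cprod, cprod_add. f_equal. apply cprod_ext. intros i _. rewrite nC_add. ring.
Qed.
Lemma poch_S_l x k : poch x (S k) = x * poch (x + 1) k.
Proof.
  change (S k) with (1 + k)%nat. rewrite poch_add, poch_S, poch_0.
  replace (x + nC 0) with x by (rewrite nC_0; ring). change (nC 1) with (RtoC 1). ring.
Qed.
Lemma poch_neq0 x k : nonpole x -> poch x k <> 0.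
Proof. intros H. apply cprod_neq0. intros i _. apply H. Qed.
Lemma poch_nC_S m k : poch (nC (S m)) k * nC (fact m) = nC (fact (m + k)).
Proof.
  induction k as [|k IH]; [rewrite poch_0, Nat.add_0_r; ring|].
  rewrite poch_S, Nat.add_succ_r, nC_fact_S, <- IH, 2!nC_S, nC_add. ring.
Qed.
Lemma poch_1 k : poch 1 k = nC (fact k).
Proof. generalize (poch_nC_S 0 k). simpl. unfold nC at 2. simpl. intros <-. 
  replace (nC 1) with (RtoC 1) by reflexivity. ring. Qed.

(** Gauss' quotient with base n+1 and exponent w-1 instead of n and w. It has the same limit as the
    sequence in [RGamma], but it is defined from n = 0 with value 1, hence a pure product of the
    ratios [1 + gauss_incr w k]. *)
Definition gauss_quot (w : C) (n : nat) : C := poch w n / (nC (fact n) * cpow (INR (S n)) (w - 1)).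

Definition gauss_incr (w : C) (n : nat) : C :=
  (w + nC n) / nC (S n) * (cpow (INR (S n)) (w - 1) / cpow (INR (S (S n))) (w - 1)) - 1.

Lemma gauss_quot_prod w n : gauss_quot w n = cprod (fun k => 1 + gauss_incr w k) n.
Proof.
  induction n as [|n IH].
  - unfold gauss_quot, cpow. change (INR 1) with 1%R. rewrite poch_0, ln_1, Cmult_0_r, Cexp_0.
    change (nC (fact 0)) with (RtoC 1). change (cprod (fun k => 1 + gauss_incr w k) 0) with (RtoC 1). field.
  - rewrite cprod_S, <- IH. unfold gauss_quot, gauss_incr. rewrite poch_S, nC_fact_S.
    field. repeat split; auto using cpow_neq0, nC_fact_neq0, nC_S_neq0.
Qed.

(** With h = 1/(n+1) and a = w-1 the ratio of consecutive quotients is (1 + ah) exp(-a ln(1+h)). The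
    terms of first order in h cancel, and what remains is O(h^2). *)
Lemma gauss_incr_bound w : exists K, (0 < K)%R /\
  forall n, (Cmod (gauss_incr w n) <= K * / (INR (S n) * INR (S n)))%R.
Proof.
  set (a := w - 1).
  assert (Ha := Cmod_ge_0 a). set (A := Cmod a) in *.
  (* The three summands bound, for h <= 1, the three terms of the expansion [E3] below. *)
  set (K := (A + A * A + 8 * (A * A) * (1 + A))%R).
  (* From [N] on, |a| ln(1+h) <= 1/2, the range of [Cexp_bound2]; the finitely many earlier indices
     only enlarge the constant. *)
  destruct (INR_unbounded (2 * A)) as [N HN].
  destruct (eventually_bounded (fun n => Cmod (gauss_incr w n) * (INR (S n) * INR (S n)))%R K N) as [K' [HK0 HK]].
  - intros n Hn. set (x := INR (S n)). assert (Hx : (1 <= x)%R).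
    { unfold x. rewrite S_INR. assert (T := pos_INR n); lra. }
    assert (HxA : (2 * A < x)%R).
    { unfold x. rewrite S_INR. apply le_INR in Hn. lra. }
    set (h := (/ x)%R). assert (Hh : (0 < h <= 1)%R).
    { unfold h; split; [apply Rinv_0_lt_compat; lra|]. rewrite <- Rinv_1. apply Rinv_le_contravar; lra. }
    assert (Hxh : (x * h = 1)%R) by (unfold h; field; lra).
    set (l := ln (1 + h)). destruct (ln_1p_bounds h ltac:(lra)) as [L1 L2]. fold l in L1, L2.
    assert (L3 : (h - l <= h * h)%R).
    { assert (h - h / (1 + h) = h * h / (1 + h))%R by (field; lra).
      assert (h * h / (1 + h) <= h * h)%R. { apply Rle_div_l; nra. } lra. }
    assert (L0 : (0 <= l)%R).
    { eapply Rle_trans; [|exact L1]. apply Rle_mult_inv_pos; lra. }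
    assert (E1 : (w + nC n) / nC (S n) = 1 + a * RtoC h).
    { unfold a. rewrite nC_S. unfold h, x.
      rewrite RtoC_inv by (apply not_0_INR; lia). change (RtoC (INR (S n))) with (nC (S n)).
      rewrite nC_S. field. rewrite <- nC_S. apply nC_S_neq0. }
    assert (E2 : cpow (INR (S n)) a / cpow (INR (S (S n))) a = Cexp (- (a * RtoC l))).
    { unfold cpow, Cdiv. rewrite <- Cexp_opp, <- Cexp_add. f_equal.
      replace l with (ln (INR (S (S n))) - ln (INR (S n)))%R.
      - rewrite RtoC_minus. ring.
      - unfold l. replace (1 + h)%R with (INR (S (S n)) / INR (S n))%R.
        + unfold Rdiv. rewrite ln_mult, ln_Rinv; auto using INR_S_pos, Rinv_0_lt_compat.
        + rewrite (S_INR (S n)). fold x. unfold h. field. lra. }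
    set (rho := Cexp (- (a * RtoC l)) - 1 - (- (a * RtoC l))).
    assert (Ml : Cmod (- (a * RtoC l)) = (A * l)%R).
    { rewrite Cmod_opp, Cmod_mult, Cmod_R, Rabs_pos_eq by auto. reflexivity. }
    assert (HAl : (A * l <= A * h)%R) by (apply Rmult_le_compat_l; lra).
    assert (HAh : (A * h <= 1 / 2)%R) by nra.
    assert (Hr : (Cmod rho <= 8 * (A * A) * (h * h))%R).
    { unfold rho. eapply Rle_trans; [apply Cexp_bound2; rewrite Ml; lra|]. rewrite Ml.
      assert (0 <= A * l)%R by (apply Rmult_le_pos; auto).
      assert ((A * l) * (A * l) <= (A * h) * (A * h))%R by (apply Rmult_le_compat; auto).
      lra. }
    assert (E3 : gauss_incr w n = a * RtoC (h - l) - a * a * RtoC (h * l) + rho * (1 + a * RtoC h)).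
    { unfold gauss_incr. fold a. rewrite E1, E2. unfold rho. rewrite RtoC_minus, RtoC_mult. ring. }
    rewrite E3.
    assert (B : (Cmod (a * RtoC (h - l) - a * a * RtoC (h * l) + rho * (1 + a * RtoC h)) <= K * (h * h))%R).
    { eapply Rle_trans; [apply Cmod_triangle|].
      assert (T1 := Cmod_triangle (a * RtoC (h - l)) (- (a * a * RtoC (h * l)))).
      rewrite Cmod_opp in T1. rewrite !Cmod_mult, !Cmod_R in T1.
      rewrite (Rabs_pos_eq (h - l)) in T1 by lra.
      rewrite (Rabs_pos_eq (h * l)) in T1 by nra. fold A in T1.
      rewrite Cmod_mult.
      assert (T2 := Cmod_triangle 1 (a * RtoC h)).
      rewrite Cmod_1, Cmod_mult, Cmod_R, (Rabs_pos_eq h) in T2 by lra. fold A in T2.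
      assert (T3 : (Cmod rho * Cmod (1 + a * RtoC h) <= 8 * (A * A) * (h * h) * (1 + A))%R).
      { apply Rmult_le_compat; auto using Cmod_ge_0. nra. }
      assert (T4 : (A * (h - l) <= A * (h * h))%R) by (apply Rmult_le_compat_l; lra).
      assert (T5 : (A * A * (h * l) <= A * A * (h * h))%R) by (apply Rmult_le_compat_l; nra).
      unfold K. unfold Cminus. lra. }
    apply Rle_trans with (K * (h * h) * (x * x))%R.
    + apply Rmult_le_compat_r; [nra|exact B].
    + right. replace (K * (h * h) * (x * x))%R with (K * ((x * h) * (x * h)))%R by ring.
      rewrite Hxh. ring.
  - exists K'. split; auto. intros n. specialize (HK n).
    assert (P := INR_S_pos n). apply Rle_div_r; [nra | exact HK].
Qed.

Lemma gauss_incr_summable K : (0 < K)%R -> summable (fun n => K * / (INR (S n) * INR (S n)))%R.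
Proof. intros HK. apply summable_scal; [lra | apply summable_inv_sq]. Qed.

Lemma gauss_quot_cvg_ex w : exists l, cvgC (gauss_quot w) l.
Proof.
  destruct (gauss_incr_bound w) as [K [HK0 HK]].
  destruct (tannery_prod (fun _ => gauss_incr w) (gauss_incr w) _ (fun n => n) 0 (gauss_incr_summable K HK0) to_inf_id) as [l [H1 _]].
  - intros; apply HK.
  - intros; apply cvgC_const.
  - exists l. eapply cvgC_ext; [|exact H1]. intros n; symmetry; apply gauss_quot_prod.
Qed.

Lemma cpow_sub_1 t z : (0 < t)%R -> cpow t z = cpow t (z - 1) * RtoC t.
Proof. intros H. rewrite <- (cpow_1 t H). rewrite <- cpow_add. f_equal. ring. Qed.

Lemma cvgC_cpow_nat (i j : nat) z :
  cvgC (fun n => cpow (INR (n + i)) z / cpow (INR (n + j)) z) 1.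
Proof.
  eapply cvgC_ext; [|apply (cvgC_cpow_shift (INR i) (INR j) z)].
  intros n; simpl. now rewrite 2!plus_INR.
Qed.

Lemma to_inf_S : to_inf S. Proof. intros K; exists K; intros; lia. Qed.

Lemma gauss_quot_cvg w : cvgC (gauss_quot w) (RGamma w).
Proof.
  destruct (gauss_quot_cvg_ex w) as [l Hl]. replace (RGamma w) with l; auto. symmetry.
  unfold RGamma. apply cvgC_Clim.
  (* The sequence defining [RGamma] at n is [gauss_quot] at n+1 times (n+1)/(n+2) and ((n+2)/n)^w,
     both of which tend to 1. *)
  assert (H2 : cvgC (fun n => gauss_quot w (S n) * (nC (S n) / nC (S (S n)) * (cpow (INR (n + 2)) w / cpow (INR (n + 0)) w)))
     (l * (1 * 1))).
  { apply cvgC_mult; [apply (cvgC_comp _ _ S to_inf_S Hl)|]. apply cvgC_mult; [|apply cvgC_cpow_nat].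
    apply (cvgC_ext (fun n => cpow (INR (n + 1)) 1 / cpow (INR (n + 2)) 1)); [|apply cvgC_cpow_nat].
    intros n. rewrite 2!cpow_1 by (apply lt_0_INR; lia). unfold nC.
    do 2 f_equal; f_equal; f_equal; lia. }
  replace (l * (1 * 1)) with l in H2 by ring.
  eapply (cvgC_ext_loc _ _ _ 1); [|exact H2]. intros n Hn. simpl.
  unfold gauss_quot. rewrite nC_fact_S. replace (n + 2)%nat with (S (S n)) by lia.
  rewrite Nat.add_0_r. rewrite (cpow_sub_1 (INR (S (S n))) w) by apply INR_S_pos.
  change (RtoC (INR (S (S n)))) with (nC (S (S n))). change (npow n w) with (cpow (INR n) w).
  field. repeat split; auto using cpow_neq0, nC_fact_neq0, nC_S_neq0.
Qed.

Lemma RGamma_neq0 w : nonpole w -> RGamma w <> 0.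
Proof.
  intros H. destruct (gauss_incr_bound w) as [K [HK0 HK]].
  apply (prod_limit_neq0 (gauss_incr w) _ _ (gauss_incr_summable K HK0) HK).
  - intros k. unfold gauss_incr.
    replace (1 + (_ - 1)) with ((w + nC k) / nC (S k) * (cpow (INR (S k)) (w - 1) / cpow (INR (S (S k))) (w - 1))) by ring.
    repeat apply Cmult_neq_0; auto using cpow_neq0, Cinv_neq0, nC_S_neq0.
  - eapply cvgC_ext; [|apply gauss_quot_cvg]. intros; apply gauss_quot_prod.
Qed.

Lemma RGamma_S z : RGamma z = z * RGamma (z + 1).
Proof.
  apply (cvgC_unique (fun n => gauss_quot z (S n))).
  - apply (cvgC_comp _ _ S to_inf_S (gauss_quot_cvg z)).
  - replace (z * RGamma (z + 1)) with (z * RGamma (z + 1) * 1) by ring.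
    eapply cvgC_ext; [|apply cvgC_mult; [apply cvgC_mult; [apply cvgC_const | apply gauss_quot_cvg] | apply (cvgC_cpow_nat 1 2 (z - 1))]].
    intros n. cbv beta. unfold gauss_quot. rewrite poch_S_l, nC_fact_S.
    replace (z + 1 - 1) with z by ring. rewrite (cpow_sub_1 (INR (S n)) z) by apply INR_S_pos.
    replace (n + 1)%nat with (S n) by lia. replace (n + 2)%nat with (S (S n)) by lia.
    change (RtoC (INR (S n))) with (nC (S n)).
    field. repeat split; auto using cpow_neq0, nC_fact_neq0, nC_S_neq0.
Qed.

Lemma RGamma_poch z m : RGamma z = poch z m * RGamma (z + nC m).
Proof.
  induction m as [|m IH]; [rewrite poch_0, nC_0, Cplus_0_r; ring|].
  rewrite poch_S, nC_S, IH, (RGamma_S (z + nC m)), Cplus_assoc. ring.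
Qed.

(** Convergent sequences are bounded: for [gauss_quot] this is the growth n! (n+1)^(Re w - 1) of
    (w)_n, from which the domination of the residues is built. *)
Lemma gauss_quot_upper w : exists M, (0 < M)%R /\
  forall n, (Cmod (poch w n) <= M * (INR (fact n) * succ_pow n (Re w - 1)))%R.
Proof.
  destruct (cvgC_bounded _ _ (gauss_quot_cvg w)) as [M [HM0 HM]]. exists M; split; auto. intros n.
  specialize (HM n). unfold gauss_quot in HM.
  rewrite Cmod_div, Cmod_mult, Cmod_cpow, Cmod_nC in HM
    by (apply Cmult_neq_0; auto using cpow_neq0, nC_fact_neq0).
  replace (Re (w - 1)) with (Re w - 1)%R in HM by (unfold Re; simpl; ring).
  apply Rle_div_l in HM; [exact HM|].
  apply Rmult_lt_0_compat; [apply INR_fact_lt_0 | apply exp_pos].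
Qed.

(** Away from the poles of Gamma the limit is nonzero, so the inverse quotients are bounded as
    well. *)
Lemma gauss_quot_lower w : nonpole w -> exists M, (0 < M)%R /\
  forall n, (INR (fact n) * succ_pow n (Re w - 1) <= M * Cmod (poch w n))%R.
Proof.
  intros Hw. destruct (cvgC_bounded _ _ (cvgC_inv _ _ (RGamma_neq0 w Hw) (gauss_quot_cvg w))) as [M [HM0 HM]].
  exists M; split; auto. intros n. specialize (HM n). unfold gauss_quot in HM.
  assert (Hp := poch_neq0 w n Hw).
  rewrite Cmod_inv, Cmod_div, Cmod_mult, Cmod_cpow, Cmod_nC in HM;
    try (apply Cmult_neq_0; auto using cpow_neq0, nC_fact_neq0);
    try (apply Cinv_neq0, Cmult_neq_0; auto using cpow_neq0, nC_fact_neq0).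
  replace (Re (w - 1)) with (Re w - 1)%R in HM by (unfold Re; simpl; ring).
  unfold Rdiv in HM. rewrite Rinv_mult, Rinv_inv in HM.
  assert (P := proj1 (Cmod_gt_0 _) Hp).
  rewrite Rmult_comm in HM. apply Rle_div_l in HM; auto.
Qed.

(** The quotients (n+1)/(z+n) tend to 1 and no denominator vanishes, so they are bounded. *)
Lemma nonpole_lower z : nonpole z -> exists c, (0 < c)%R /\
  forall n, (INR (S n) <= c * Cmod (z + nC n))%R.
Proof.
  intros H.
  assert (L : cvgC (fun n => nC (S n) / (z + nC n)) 1).
  { apply (cvgC_ext (fun n => / (1 + (z - 1) * RtoC (/ INR (S n))))).
    - intros n. rewrite RtoC_inv by (apply not_0_INR; lia). change (RtoC (INR (S n))) with (nC (S n)).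
      assert (A := nC_S_neq0 n). specialize (H n). rewrite nC_S in *. field. repeat split; auto.
    - assert (E : / (1 + (z - 1) * 0) = 1) by (replace (1 + (z - 1) * 0) with (RtoC 1) by ring; field).
      refine (eq_ind _ (cvgC _) _ _ E). apply cvgC_inv; [replace (1 + (z - 1) * 0) with (RtoC 1) by ring; apply C1_nz|].
      apply cvgC_plus; [apply cvgC_const|]. apply cvgC_mult; [apply cvgC_const|].
      apply cvgC_RtoC, is_lim_seq_inv_S. }
  destruct (cvgC_bounded _ _ L) as [M [HM0 HM]]. exists M; split; auto. intros n.
  specialize (HM n). rewrite Cmod_div, Cmod_nC in HM by auto.
  apply Rle_div_l in HM; auto. apply Cmod_gt_0; auto.
Qed.

(** * The sine product and the cotangent series *)

Lemma Ci2 : Ci * Ci = - (1).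
Proof. unfold Ci, Cmult, Copp, RtoC; simpl. f_equal; ring. Qed.

Lemma Ci_neq0 : Ci <> 0.
Proof. intros E. injection E. lra. Qed.

Lemma C2_neq0 : RtoC 2 <> 0.
Proof. apply RtoC_neq0; lra. Qed.

Lemma Csin_add a b : Csin (a + b) = Csin a * Ccos b + Ccos a * Csin b.
Proof.
  unfold Csin, Ccos. rewrite !Cexp_opp.
  replace (Ci * (a + b)) with (Ci * a + Ci * b) by ring. rewrite Cexp_add.
  field. repeat split; auto using Cexp_neq0, C2_neq0, Ci_neq0.
Qed.

Lemma Ccos_add a b : Ccos (a + b) = Ccos a * Ccos b - Csin a * Csin b.
Proof.
  unfold Csin, Ccos. rewrite !Cexp_opp.
  replace (Ci * (a + b)) with (Ci * a + Ci * b) by ring. rewrite Cexp_add.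
  assert (E1 := Cexp_neq0 (Ci * a)). assert (E2 := Cexp_neq0 (Ci * b)).
  set (p := Cexp (Ci * a)) in *. set (q := Cexp (Ci * b)) in *.
  replace ((p - / p) / (2 * Ci) * ((q - / q) / (2 * Ci))) with
    ((p - / p) * (q - / q) / (2 * 2 * (Ci * Ci))).
  - rewrite Ci2. field. repeat split; auto using C2_neq0.
  - field. repeat split; auto using Ci_neq0.
Qed.

Lemma Csin_opp a : Csin (- a) = - Csin a.
Proof. unfold Csin. replace (Ci * - a) with (- (Ci * a)) by ring. rewrite !Cexp_opp.
  field. repeat split; auto using Cexp_neq0, Cinv_neq0, C2_neq0, Ci_neq0. Qed.

Lemma Ccos_opp a : Ccos (- a) = Ccos a.
Proof. unfold Ccos. replace (Ci * - a) with (- (Ci * a)) by ring. rewrite !Cexp_opp.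
  field. repeat split; auto using Cexp_neq0, Cinv_neq0, C2_neq0, Ci_neq0. Qed.

Lemma Cexp_Ci_R (x : R) : Cexp (Ci * RtoC x) = (cos x, sin x).
Proof.
  unfold Cexp, Ci, RtoC, Cmult, Re, Im; simpl.
  replace (0 * x - 1 * 0)%R with 0%R by ring. replace (0 * 0 + 1 * x)%R with x by ring.
  rewrite exp_0. f_equal; ring.
Qed.

Lemma Cexp_mCi_R (x : R) : Cexp (- (Ci * RtoC x)) = (cos x, (- sin x)%R).
Proof.
  replace (- (Ci * RtoC x)) with (Ci * RtoC (- x)) by (rewrite RtoC_opp; ring).
  rewrite Cexp_Ci_R, cos_neg, sin_neg. reflexivity.
Qed.

Lemma Csin_R (x : R) : Csin (RtoC x) = RtoC (sin x).
Proof.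
  unfold Csin. rewrite Cexp_Ci_R, Cexp_mCi_R.
  replace ((cos x, sin x) - (cos x, (- sin x)%R)) with (2 * Ci * RtoC (sin x)).
  - field. repeat split; auto using Ci_neq0, C2_neq0.
  - unfold Ci, RtoC, Cmult, Cminus, Cplus, Copp; simpl. f_equal; ring.
Qed.

Lemma Ccos_R (x : R) : Ccos (RtoC x) = RtoC (cos x).
Proof.
  unfold Ccos. rewrite Cexp_Ci_R, Cexp_mCi_R.
  replace ((cos x, sin x) + (cos x, (- sin x)%R)) with (2 * RtoC (cos x)).
  - field; repeat split; auto using C2_neq0.
  - unfold RtoC, Cmult, Cplus; simpl. f_equal; ring.
Qed.

Lemma Csin_cos2 a : Csin a * Csin a + Ccos a * Ccos a = 1.
Proof.
  assert (E := Ccos_add a (- a)). rewrite Ccos_opp, Csin_opp in E.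
  replace (a + - a) with (RtoC 0) in E by ring. rewrite Ccos_R, cos_0 in E. rewrite E. ring.
Qed.

Lemma Csin_add_half a : Csin (a + RtoC (PI / 2)) = Ccos a.
Proof. rewrite Csin_add, Ccos_R, Csin_R, cos_PI2, sin_PI2. ring. Qed.

Lemma Ccos_add_half a : Ccos (a + RtoC (PI / 2)) = - Csin a.
Proof. rewrite Ccos_add, Ccos_R, Csin_R, cos_PI2, sin_PI2. ring. Qed.

Lemma Csin_add_PI a : Csin (a + RtoC PI) = - Csin a.
Proof. rewrite Csin_add, Ccos_R, Csin_R, cos_PI, sin_PI. ring. Qed.

Lemma Csin_double a : Csin (2 * a) = 2 * (Csin a * Ccos a).
Proof. replace (2 * a) with (a + a) by ring. rewrite Csin_add. ring. Qed.

Lemma Csin_mul_sub a b : Csin (a + b) * Csin (a - b) = Csin a * Csin a - Csin b * Csin b.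
Proof.
  unfold Cminus at 1. rewrite 2!Csin_add, Csin_opp, Ccos_opp.
  assert (A := Csin_cos2 a). assert (B := Csin_cos2 b).
  replace (Csin a * Csin a - Csin b * Csin b) with
    (Csin a * Csin a * (Csin b * Csin b + Ccos b * Ccos b) - (Csin a * Csin a + Ccos a * Ccos a) * (Csin b * Csin b))
    by (rewrite A, B; ring).
  ring.
Qed.

Definition two_pow (r : nat) : nat := Nat.pow 2 r.
Definition ang (n k : nat) : R := (PI * INR k / INR n)%R.

Lemma two_pow_pos r : (0 < two_pow r)%nat.
Proof. unfold two_pow. assert (H := Nat.pow_nonzero 2 r ltac:(lia)). lia. Qed.
Lemma two_pow_S r : two_pow (S r) = (two_pow r + two_pow r)%nat.
Proof. unfold two_pow. simpl. lia. Qed.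

Lemma ang_double n k : (0 < n)%nat -> ang n k = (2 * ang (n + n) k)%R.
Proof. intros H. unfold ang. rewrite plus_INR. apply lt_0_INR in H. field. lra. Qed.
Lemma ang_half n k : (0 < n)%nat -> ang (n + n) (n + k) = (ang (n + n) k + PI / 2)%R.
Proof. intros H. unfold ang. rewrite !plus_INR. apply lt_0_INR in H. field. lra. Qed.
Lemma ang_refl n k : (0 < n)%nat -> (k <= n)%nat -> ang n (n - k) = (PI - ang n k)%R.
Proof. intros H Hk. unfold ang. rewrite minus_INR by lia. apply lt_0_INR in H. field. lra. Qed.
Lemma ang_0 n : ang n 0 = 0%R.
Proof. unfold ang. simpl. unfold Rdiv. ring. Qed.

Lemma nC_double_two_pow r a : nC (two_pow (S r)) * a = nC (two_pow r) * (2 * a).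
Proof. rewrite two_pow_S, nC_add. ring. Qed.

(** Restricting n to powers of two makes angle doubling sufficient: the factors k and k + n/2 merge
    through 2 sin b cos b = sin 2b. A subsequence of n is enough for the limits taken below. *)
Lemma sin_multiple r a :
  2 * Csin (nC (two_pow r) * a) = cprod (fun k => 2 * Csin (a + RtoC (ang (two_pow r) k))) (two_pow r).
Proof.
  revert a. induction r as [|r IH]; intros a.
  - change (two_pow 0) with 1%nat. rewrite cprod_S. change (cprod _ 0) with (RtoC 1).
    rewrite ang_0, Cplus_0_r. replace (nC 1 * a) with a by (change (nC 1) with (RtoC 1); ring). ring.
  - assert (Hp := two_pow_pos r). rewrite nC_double_two_pow, IH, two_pow_S, cprod_add.
    unfold cprod at 2 3. rewrite <- prodC_mult. apply cprod_ext. intros k Hk.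
    rewrite (ang_double (two_pow r) k Hp), ang_half, RtoC_mult, RtoC_plus, Cplus_assoc by auto.
    rewrite Csin_add_half, <- Cmult_plus_distr_l, Csin_double. ring.
Qed.

(** The product of [sin_multiple] at a = 0 without its vanishing factor. The same doubling applies,
    and the middle factor 2 sin(pi/2) supplies the extra 2. *)
Lemma sin_multiple_const r :
  cprod (fun k => 2 * Csin (RtoC (ang (two_pow r) (S k)))) (two_pow r - 1) = nC (two_pow r).
Proof.
  induction r as [|r IH]; [reflexivity|].
  assert (Hp := two_pow_pos r). rewrite two_pow_S.
  replace (two_pow r + two_pow r - 1)%nat with (two_pow r - 1 + 1 + (two_pow r - 1))%nat by lia.
  rewrite 2!cprod_add. rewrite (cprod_S _ 0). change (cprod _ 0) with (RtoC 1) at 1.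
  replace (S (two_pow r - 1 + 0)) with (two_pow r + 0)%nat by lia.
  rewrite ang_half, ang_0, Rplus_0_l, Csin_R, sin_PI2 by auto.
  rewrite nC_add, <- IH. rewrite Cmult_1_l.
  replace (cprod (fun k => 2 * Csin (RtoC (ang (two_pow r) (S k)))) (two_pow r - 1)) with
   (cprod (fun k => 2 * Csin (RtoC (ang (two_pow r + two_pow r) (S k)))) (two_pow r - 1) *
    cprod (fun i => 2 * Csin (RtoC (ang (two_pow r + two_pow r) (S (two_pow r - 1 + 1 + i))))) (two_pow r - 1)).
  - change (cprod (fun _ : nat => ?x)) with (cprod (fun _ : nat => x)). ring.
  - unfold cprod. rewrite <- prodC_mult. apply cprod_ext. intros k Hk.
    replace (S (two_pow r - 1 + 1 + k)) with (two_pow r + S k)%nat by lia.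
    rewrite (ang_double (two_pow r) (S k) Hp), ang_half, RtoC_mult, RtoC_plus by auto.
    rewrite Csin_add_half, Csin_double. ring.
Qed.

Lemma cprod_zero (f : nat -> C) n k : (k < n)%nat -> f k = 0 -> cprod f n = 0.
Proof.
  intros H E. replace n with (k + (1 + (n - k - 1)))%nat by lia.
  rewrite 2!cprod_add, (cprod_S _ 0), Nat.add_0_r, E. ring.
Qed.

(** Pairs the index i with 2(j+1) - i; the indices 0 and j+1 are their own partners and stay
    outside. *)
Lemma cprod_pair (f : nat -> C) j :
  cprod f (S j + S j) = f 0%nat * f (S j) * cprod (fun i => f (S i) * f (S j + S j - S i)%nat) j.
Proof.
  replace (S j + S j)%nat with (S (j + 1 + j)) at 1 by lia.
  rewrite cprod_S_l, 2!cprod_add, (cprod_S _ 0). change (cprod _ 0) with (RtoC 1).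
  rewrite (cprod_rev (fun i => f (S (j + 1 + i)))).
  unfold cprod at 3. rewrite prodC_mult. fold (cprod (fun i => f (S i)) j).
  replace (prodC (map (fun x => f (S j + S j - S x)%nat) (seq 0 j))) with
    (cprod (fun i => f (S (j + 1 + (j - 1 - i)))) j).
  - replace (S (j + 0)) with (S j) by lia. ring.
  - apply cprod_ext. intros i Hi. f_equal. lia.
Qed.

Lemma csum_pair (f : nat -> C) j :
  csum f (S j + S j) = f 0%nat + f (S j) + csum (fun i => f (S i) + f (S j + S j - S i)%nat) j.
Proof.
  replace (S j + S j)%nat with (S (j + 1 + j)) at 1 by lia.
  rewrite csum_S_l, 2!csum_add, (csum_S _ 0). change (csum _ 0) with (RtoC 0).
  rewrite (csum_rev (fun i => f (S (j + 1 + i)))).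
  rewrite csum_plus.
  replace (csum (fun x => f (S j + S j - S x)%nat) j) with
    (csum (fun i => f (S (j + 1 + (j - 1 - i)))) j).
  - replace (S (j + 0)) with (S j) by lia. ring.
  - apply csum_ext. intros i Hi. f_equal. lia.
Qed.

Lemma ang_range j i : (i < j)%nat ->
  (0 < ang (S j + S j) (S i) < PI / 2)%R.
Proof.
  intros H. unfold ang. assert (P := PI_RGT_0). rewrite plus_INR.
  assert (A := INR_S_pos i). assert (B := INR_S_pos j).
  assert (D : (INR (S i) < INR (S j))%R) by (apply lt_INR; lia).
  split; [apply Rdiv_lt_0_compat; nra|].
  apply Rlt_div_l; [lra|]. nra.
Qed.

Lemma sin_lower_third x : (0 <= x <= PI / 2)%R -> (x / 3 <= sin x)%R.
Proof.
  intros H. assert (P := PI_4). assert (A := sin_cubic_lower x ltac:(lra)).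
  assert (x * x <= 4)%R by nra. nra.
Qed.

Lemma sin_ang_neq0 j i : (i < j)%nat -> Csin (RtoC (ang (S j + S j) (S i))) <> 0.
Proof.
  intros H. rewrite Csin_R. apply RtoC_neq0. apply Rgt_not_eq, sin_gt_0.
  - apply (ang_range j i H).
  - assert (A := ang_range j i H). assert (P := PI_RGT_0). lra.
Qed.

Lemma sin_pair n k a : (0 < n)%nat -> (k <= n)%nat ->
  Csin (a + RtoC (ang n k)) * Csin (a + RtoC (ang n (n - k))) =
  Csin (RtoC (ang n k)) * Csin (RtoC (ang n k)) - Csin a * Csin a.
Proof.
  intros Hn Hk. rewrite ang_refl, RtoC_minus by auto.
  replace (a + (RtoC PI - RtoC (ang n k))) with ((a - RtoC (ang n k)) + RtoC PI) by ring.
  rewrite Csin_add_PI, <- Csin_mul_sub.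
  replace (a - RtoC (ang n k)) with (- (RtoC (ang n k) - a)) by ring.
  rewrite Csin_opp, (Cplus_comm a). ring.
Qed.

(** Divide [sin_multiple] by [sin_multiple_const]: the factors k and n-k combine by [sin_pair],
    while k = 0 and k = n/2 give sin a and cos a. At a = w/n this is a finite form of Euler's
    product. *)
Lemma sin_product_finite r j a : two_pow r = S j ->
  let n := (S j + S j)%nat in
  Csin (nC n * a) = nC n * Csin a * Ccos a *
    cprod (fun i => 1 + - (Csin a * Csin a / (Csin (RtoC (ang n (S i))) * Csin (RtoC (ang n (S i)))))) j.
Proof.
  intros Hr n.
  assert (Hn : two_pow (S r) = n) by (rewrite two_pow_S, Hr; reflexivity).
  assert (A := sin_multiple (S r) a). rewrite Hn in A. unfold n in A at 3. rewrite cprod_pair in A. fold n in A.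
  assert (B := sin_multiple_const (S r)). rewrite Hn in B.
  replace (n - 1)%nat with (j + 1 + j)%nat in B by (unfold n; lia).
  rewrite 2!cprod_add, (cprod_S _ 0) in B. change (cprod _ 0) with (RtoC 1) in B.
  rewrite (cprod_rev (fun i => 2 * Csin (RtoC (ang n (S (j + 1 + i)))))) in B.
  replace (S (j + 0)) with (S j + 0)%nat in B by lia.
  unfold n in B at 2. rewrite ang_half, ang_0, Rplus_0_l, Csin_R, sin_PI2 in B by lia.
  assert (B' : nC n = 2 * cprod (fun i => 4 * (Csin (RtoC (ang n (S i))) * Csin (RtoC (ang n (S i))))) j).
  { rewrite <- B.
    replace (cprod (fun i => 4 * (Csin (RtoC (ang n (S i))) * Csin (RtoC (ang n (S i))))) j) with
     (cprod (fun k => 2 * Csin (RtoC (ang n (S k)))) j *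
      cprod (fun i => 2 * Csin (RtoC (ang n (S (j + 1 + (j - 1 - i)))))) j).
    - ring.
    - unfold cprod. rewrite <- prodC_mult. apply cprod_ext. intros i Hi.
      replace (S (j + 1 + (j - 1 - i))) with (n - S i)%nat by (unfold n; lia).
      rewrite ang_refl by (unfold n; lia). rewrite !Csin_R, sin_PI_x. ring. }
  rewrite ang_0, Cplus_0_r in A.
  replace (ang n (S j)) with (PI / 2)%R in A.
  2:{ replace (S j) with (S j + 0)%nat by lia. unfold n. rewrite ang_half, ang_0 by lia. ring. }
  rewrite Csin_add_half in A.
  assert (A' : 2 * Csin (nC n * a) = 2 * (nC n * Csin a * Ccos a *
    cprod (fun i => 1 + - (Csin a * Csin a / (Csin (RtoC (ang n (S i))) * Csin (RtoC (ang n (S i)))))) j)).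
  { rewrite A, B'.
    replace (cprod (fun i => 2 * Csin (a + RtoC (ang n (S i))) * (2 * Csin (a + RtoC (ang n (n - S i))))) j)
     with (cprod (fun i => 4 * (Csin (RtoC (ang n (S i))) * Csin (RtoC (ang n (S i))))) j *
     cprod (fun i => 1 + - (Csin a * Csin a / (Csin (RtoC (ang n (S i))) * Csin (RtoC (ang n (S i)))))) j).
    - ring.
    - unfold cprod. rewrite <- prodC_mult. apply cprod_ext. intros i Hi.
      fold n. assert (Q := sin_pair n (S i) a ltac:(unfold n; lia) ltac:(unfold n; lia)).
      assert (Z := sin_ang_neq0 j i Hi). fold n in Z.
      replace (2 * Csin (a + RtoC (ang n (S i))) * (2 * Csin (a + RtoC (ang n (n - S i)))))
        with (4 * (Csin (a + RtoC (ang n (S i))) * Csin (a + RtoC (ang n (n - S i))))) by ring.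
      rewrite Q. field. auto. }
  assert (F : forall x y : C, 2 * x = 2 * y -> x = y).
  { intros x y E. replace x with (/ 2 * (2 * x)) by (field; apply C2_neq0). rewrite E. field; apply C2_neq0. }
  apply F, A'.
Qed.

(** The logarithmic derivative of [sin_multiple], obtained without differentiating: the doubling
    step is cot b + cot(b + pi/2) = 2 cot 2b. *)
Lemma cot_multiple r a : Csin (nC (two_pow r) * a) <> 0 ->
  (forall k, (k < two_pow r)%nat -> Csin (a + RtoC (ang (two_pow r) k)) <> 0) /\
  nC (two_pow r) * Ccot (nC (two_pow r) * a) = csum (fun k => Ccot (a + RtoC (ang (two_pow r) k))) (two_pow r).
Proof.
  intros H0. split.
  { intros k Hk E. apply H0.
    assert (S := sin_multiple r a).
    replace (Csin (nC (two_pow r) * a)) with (/ 2 * (2 * Csin (nC (two_pow r) * a))) by (field; apply C2_neq0).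
    rewrite S, (cprod_zero _ (two_pow r) k Hk) by (rewrite E; ring). ring. }
  revert a H0. induction r as [|r IH]; intros a H0.
  - change (two_pow 0) with 1%nat. rewrite csum_S. change (csum _ 0) with (RtoC 0).
    rewrite ang_0, Cplus_0_r. replace (nC 1 * a) with a by (change (nC 1) with (RtoC 1); ring).
    change (nC 1) with (RtoC 1). ring.
  - assert (Hp := two_pow_pos r). rewrite nC_double_two_pow in H0.
    assert (Hs : forall k, (k < two_pow r)%nat -> Csin (2 * a + RtoC (ang (two_pow r) k)) <> 0).
    { intros k Hk E. apply H0.
      assert (S := sin_multiple r (2 * a)).
      replace (Csin (nC (two_pow r) * (2 * a))) with (/ 2 * (2 * Csin (nC (two_pow r) * (2 * a)))) by (field; apply C2_neq0).
      rewrite S, (cprod_zero _ (two_pow r) k Hk) by (rewrite E; ring). ring. }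
    rewrite (nC_double_two_pow r a). rewrite (two_pow_S r), nC_add, csum_add.
    rewrite <- csum_plus. rewrite Cmult_plus_distr_r, IH by auto. rewrite <- csum_plus.
    apply csum_ext. intros k Hk. specialize (Hs k Hk).
    rewrite (ang_double (two_pow r) k Hp), RtoC_mult, <- Cmult_plus_distr_l in Hs |- *.
    rewrite ang_half, RtoC_plus, Cplus_assoc by auto.
    set (b := a + RtoC (ang (two_pow r + two_pow r) k)) in *.
    unfold Ccot. rewrite Csin_add_half, Ccos_add_half. rewrite Csin_double in Hs |- *.
    replace (2 * b) with (b + b) by ring. rewrite Ccos_add.
    assert (Csin b <> 0) by (intros E; apply Hs; rewrite E; ring).
    assert (Ccos b <> 0) by (intros E; apply Hs; rewrite E; ring).
    field. repeat split; auto using C2_neq0.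
Qed.

Lemma cot_finite r j a : two_pow r = S j ->
  let n := (S j + S j)%nat in Csin (nC n * a) <> 0 ->
  nC n * Ccot (nC n * a) = Ccos a / Csin a - Csin a / Ccos a -
    csum (fun i => 2 * (Csin a * Ccos a) /
       (Csin (RtoC (ang n (S i))) * Csin (RtoC (ang n (S i))) - Csin a * Csin a)) j
  /\ Csin a <> 0 /\ Ccos a <> 0 /\ forall i, (i < j)%nat ->
     Csin (RtoC (ang n (S i))) * Csin (RtoC (ang n (S i))) - Csin a * Csin a <> 0.
Proof.
  intros Hr n Hs.
  assert (Hn : two_pow (S r) = n) by (rewrite two_pow_S, Hr; reflexivity).
  rewrite <- Hn in Hs. destruct (cot_multiple (S r) a Hs) as [Hz A]. rewrite Hn in Hz, A.
  assert (Hh : ang n (S j) = (PI / 2)%R).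
  { replace (S j) with (S j + 0)%nat by lia. unfold n. rewrite ang_half, ang_0 by lia. ring. }
  assert (Z1 : Csin a <> 0).
  { specialize (Hz 0%nat ltac:(unfold n; lia)). now rewrite ang_0, Cplus_0_r in Hz. }
  assert (Z2 : Ccos a <> 0).
  { specialize (Hz (S j) ltac:(unfold n; lia)). now rewrite Hh, Csin_add_half in Hz. }
  assert (Z3 : forall i, (i < j)%nat ->
     Csin (RtoC (ang n (S i))) * Csin (RtoC (ang n (S i))) - Csin a * Csin a <> 0).
  { intros i Hi. rewrite <- (sin_pair n (S i) a) by (unfold n; lia).
    apply Cmult_neq_0; apply Hz; unfold n; lia. }
  split; [|auto].
  rewrite A. unfold n at 2. rewrite csum_pair. fold n.
  rewrite ang_0, Cplus_0_r, Hh. unfold Ccot at 1 2. rewrite Csin_add_half, Ccos_add_half.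
  transitivity (Ccos a / Csin a - Csin a / Ccos a + csum (fun i => - (1) * (2 * (Csin a * Ccos a) /
       (Csin (RtoC (ang n (S i))) * Csin (RtoC (ang n (S i))) - Csin a * Csin a))) j);
    [|rewrite csum_scal; ring].
  f_equal; [field; auto|].
  apply csum_ext. intros i Hi.
  assert (Y1 := Hz (S i) ltac:(unfold n; lia)). assert (Y2 := Hz (n - S i)%nat ltac:(unfold n; lia)).
  rewrite <- (sin_pair n (S i) a) by (unfold n; lia).
  unfold Ccot.
  replace (2 * (Csin a * Ccos a)) with
    (- (Ccos (a + RtoC (ang n (S i))) * Csin (a + RtoC (ang n (n - S i))) +
      Ccos (a + RtoC (ang n (n - S i))) * Csin (a + RtoC (ang n (S i))))).
  - field. auto.
  - transitivity (- Csin ((a + RtoC (ang n (S i))) + (a + RtoC (ang n (n - S i))))).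
    + rewrite (Csin_add (a + RtoC (ang n (S i))) (a + RtoC (ang n (n - S i)))). ring.
    + rewrite ang_refl, RtoC_minus by (unfold n; lia).
      replace (a + RtoC (ang n (S i)) + (a + (RtoC PI - RtoC (ang n (S i))))) with (2 * a + RtoC PI) by ring.
      rewrite Csin_add_PI, Csin_double. ring.
Qed.

Lemma eventually_bounded_finite (a : nat -> nat -> C) (al : nat -> C) k0 :
  (forall k, cvgC (fun N => a N k) (al k)) ->
  exists N0 M, (0 <= M)%R /\ forall N k, (N0 <= N)%nat -> (k < k0)%nat -> (Cmod (a N k) <= M)%R.
Proof.
  intros H. induction k0 as [|k0 [N0 [M [HM0 HM]]]].
  - exists 0%nat, 0%R. split; [lra|]. intros; lia.
  - destruct (cvgC_bounded_loc _ _ (H k0)) as [N1 H1].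
    exists (Nat.max N0 N1), (Rmax M (Cmod (al k0) + 1)). split.
    + eapply Rle_trans; [exact HM0 | apply Rmax_l].
    + intros N k HN Hk. destruct (Nat.eq_dec k k0) as [->|].
      * eapply Rle_trans; [apply H1; lia | apply Rmax_r].
      * eapply Rle_trans; [apply HM; lia | apply Rmax_l].
Qed.

(** The first [k0] terms converge and are therefore eventually bounded by a common constant, which
    is added to the majorant. The cotangent series needs this, since its terms are controlled only
    beyond a certain index. *)
Lemma tannery_from (a : nat -> nat -> C) (al : nat -> C) (b : nat -> R) (M : nat -> nat) (N0 k0 : nat) :
  summable b -> to_inf M ->
  (forall N k, (N0 <= N)%nat -> (k0 <= k < M N)%nat -> (Cmod (a N k) <= b k)%R) ->
  (forall k, cvgC (fun N => a N k) (al k)) ->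
  exists l, cvgC (csum al) l /\ cvgC (fun N => csum (a N) (M N)) l.
Proof.
  intros [Hb [B HB]] HM Hab Hlim.
  destruct (eventually_bounded_finite a al k0 Hlim) as [N1 [A [HA0 HA]]].
  destruct (tannery_gen a al (fun k => (if Nat.ltb k k0 then A else 0) + b k)%R M (Nat.max N0 N1)) as [_ H]; auto.
  - split.
    + intros k. specialize (Hb k). destruct (Nat.ltb k k0); lra.
    + exists (INR k0 * A + B)%R. intros n. rewrite rsum_plus.
      assert (T : (rsum (fun k => if Nat.ltb k k0 then A else 0) n <= INR (Nat.min n k0) * A)%R).
      { induction n as [|n IH]; [simpl; lra|]. simpl rsum. destruct (Nat.ltb_spec n k0) as [L|L].
        - replace (Nat.min (S n) k0) with (S (Nat.min n k0)) by lia. rewrite S_INR. lra.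
        - replace (Nat.min (S n) k0) with (Nat.min n k0) by lia. lra. }
      assert (T2 : (INR (Nat.min n k0) <= INR k0)%R) by (apply le_INR; lia).
      specialize (HB n). nra.
  - intros N k HN Hk. specialize (Hb k) as Hbk. destruct (Nat.ltb_spec k k0) as [L|L].
    + specialize (HA N k ltac:(lia) L). lra.
    + rewrite Rplus_0_l. apply Hab; lia.
Qed.

Lemma Csin_bound2 (b : C) : (Cmod b <= 1 / 2)%R -> (Cmod (Csin b - b) <= 8 * (Cmod b * Cmod b))%R.
Proof.
  intros Hb.
  assert (M1 : Cmod (Ci * b) = Cmod b) by (rewrite Cmod_mult, Cmod_Ci; ring).
  assert (A := Cexp_bound2 (Ci * b)). assert (B := Cexp_bound2 (- (Ci * b))).
  rewrite Cmod_opp in B. rewrite M1 in A, B. specialize (A Hb). specialize (B Hb).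
  replace (Csin b - b) with
    (((Cexp (Ci * b) - 1 - Ci * b) + - (Cexp (- (Ci * b)) - 1 - - (Ci * b))) / (2 * Ci)).
  - rewrite Cmod_div by (apply Cmult_neq_0; auto using C2_neq0, Ci_neq0).
    rewrite Cmod_mult, Cmod_Ci, Cmod_R, (Rabs_pos_eq 2) by lra.
    assert (T := Cmod_triangle (Cexp (Ci * b) - 1 - Ci * b) (- (Cexp (- (Ci * b)) - 1 - - (Ci * b)))).
    rewrite Cmod_opp in T. apply Rle_div_l; lra.
  - unfold Csin. field. repeat split; auto using Ci_neq0, C2_neq0.
Qed.

Lemma cvgC_inv_nC (t : nat -> nat) : to_inf t -> cvgC (fun r => / nC (t r)) 0.
Proof.
  intros Ht. destruct (Ht 1%nat) as [N HN].
  apply (cvgC_ext_loc (fun r => RtoC (1 / INR (t r))) _ _ N).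
  - intros n Hn. specialize (HN n Hn). unfold Rdiv. rewrite Rmult_1_l. 
    rewrite RtoC_inv; [reflexivity|]. apply not_0_INR; lia.
  - apply (cvgC_comp (fun n => RtoC (1 / INR n)) 0 t Ht). apply cvgC_RtoC, is_lim_seq_div_INR.
Qed.

Lemma cvgC_scal0 (c : C) u : cvgC u 0 -> cvgC (fun n => c * u n) 0.
Proof. intros H. replace (RtoC 0) with (c * 0) by ring. apply cvgC_mult; auto using cvgC_const. Qed.

Lemma cvgC_n_sin (t : nat -> nat) w : to_inf t -> cvgC (fun r => nC (t r) * Csin (w / nC (t r))) w.
Proof.
  intros Ht. assert (L := cvgC_scal0 w _ (cvgC_inv_nC t Ht)).
  destruct (L (1/2)%R ltac:(lra)) as [N HN]. destruct (Ht 1%nat) as [N1 HN1].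
  apply (cvgC_squeeze _ _ (fun r => Cmod (8 * (Cmod w * Cmod w) * / nC (t r)))%R (Nat.max N N1)).
  - intros n Hn. specialize (HN n ltac:(lia)). specialize (HN1 n ltac:(lia)).
    replace (w * / nC (t n) - 0) with (w / nC (t n)) in HN by (unfold Cdiv; ring).
    assert (Hz : nC (t n) <> 0) by (apply nC_neq0; lia).
    replace (nC (t n) * Csin (w / nC (t n)) - w) with (nC (t n) * (Csin (w / nC (t n)) - w / nC (t n))) by (field; auto).
    rewrite !Cmod_mult, !Cmod_inv, !Cmod_nC, !Cmod_R by auto.
    assert (B := Csin_bound2 (w / nC (t n)) ltac:(lra)).
    rewrite Cmod_div, Cmod_nC in B by auto.
    assert (P : (0 < INR (t n))%R) by (apply lt_0_INR; lia).
    rewrite 2!Rabs_pos_eq by (try apply Rmult_le_pos; try apply Cmod_ge_0; lra).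
    eapply Rle_trans; [apply Rmult_le_compat_l; [lra | exact B]|]. right. field. lra.
  - rewrite <- Cmod_0. apply cvgC_Cmod.
    replace (RtoC 0) with (8 * (Cmod w * Cmod w) * 0) by ring.
    apply cvgC_mult; [apply cvgC_const | now apply cvgC_inv_nC].
Qed.

Lemma cvgC_cos (t : nat -> nat) w : to_inf t -> cvgC (fun r => Ccos (w / nC (t r))) 1.
Proof.
  intros Ht.
  assert (L1 := cvgC_scal0 (Ci * w) _ (cvgC_inv_nC t Ht)).
  assert (L2 := cvgC_scal0 (- (Ci * w)) _ (cvgC_inv_nC t Ht)).
  apply cvgC_Cexp_0 in L1. apply cvgC_Cexp_0 in L2.
  assert (L := cvgC_mult _ _ _ _ (cvgC_plus _ _ _ _ L1 L2) (cvgC_const (/ 2))).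
  replace ((1 + 1) * / 2) with (RtoC 1) in L by field.
  eapply cvgC_ext; [|exact L]. intros n. unfold Ccos, Cdiv.
  replace (Ci * (w * / nC (t n))) with (Ci * w * / nC (t n)) by ring.
  replace (- (Ci * w * / nC (t n))) with (- (Ci * w) * / nC (t n)) by ring. reflexivity.
Qed.

(** This is 2^(r+1), written in the shape [S j + S j] of the pairing lemmas with j = 2^r - 1. *)
Definition dyadic (r : nat) : nat := (S (two_pow r - 1) + S (two_pow r - 1))%nat.

Lemma two_pow_ge r : (r < two_pow r)%nat.
Proof. unfold two_pow. apply Nat.pow_gt_lin_r; lia. Qed.
Lemma to_inf_pw1 : to_inf (fun r => two_pow r - 1)%nat.
Proof. intros K; exists K; intros n Hn. assert (A := two_pow_ge n). lia. Qed.
Lemma to_inf_dyadic : to_inf dyadic.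
Proof. intros K; exists K; intros n Hn. assert (A := two_pow_ge n). unfold dyadic. lia. Qed.
Lemma two_pow_S_pred r : two_pow r = S (two_pow r - 1).
Proof. assert (A := two_pow_ge r). lia. Qed.
Lemma dyadic_pos r : nC (dyadic r) <> 0.
Proof. apply nC_neq0. unfold dyadic; lia. Qed.
Lemma nC_dyadic_mul r w : nC (dyadic r) * (w / nC (dyadic r)) = w.
Proof. field. apply dyadic_pos. Qed.

Lemma ang_C n k : (0 < n)%nat -> RtoC (ang n k) = RtoC PI * nC k / nC n.
Proof.
  intros H. unfold ang, nC, Rdiv. rewrite !RtoC_mult, RtoC_inv; [reflexivity|]. apply not_0_INR; lia.
Qed.

Lemma cvgC_n_sin_ang i : cvgC (fun r => nC (dyadic r) * Csin (RtoC (ang (dyadic r) (S i)))) (RtoC PI * nC (S i)).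
Proof.
  eapply cvgC_ext; [|apply (cvgC_n_sin dyadic (RtoC PI * nC (S i)) to_inf_dyadic)].
  intros r. cbv beta. rewrite ang_C by (unfold dyadic; lia). reflexivity.
Qed.

(** Since sin x >= x/3 on [0, pi/2] and pi >= 3, the constant is 1. The bound is uniform in r and
    supplies the majorant 1/(i+1)^2 of both limits. *)
Lemma n_sin_ang_lower r i : (i < two_pow r - 1)%nat ->
  (INR (S i) <= Cmod (nC (dyadic r) * Csin (RtoC (ang (dyadic r) (S i)))))%R.
Proof.
  intros H. rewrite Csin_R, Cmod_mult, Cmod_nC, Cmod_R.
  assert (A := ang_range (two_pow r - 1) i H). fold (dyadic r) in A.
  assert (B := sin_lower_third (ang (dyadic r) (S i)) ltac:(lra)).
  rewrite Rabs_pos_eq by lra.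
  assert (P : (0 < INR (dyadic r))%R) by (apply lt_0_INR; unfold dyadic; lia).
  assert (E : (INR (dyadic r) * ang (dyadic r) (S i) = PI * INR (S i))%R) by (unfold ang; field; lra).
  assert (P3 := PI2_3_2). assert (P4 := INR_S_pos i). nra.
Qed.

(** Tannery's theorem for products, applied to the finite sine product at a = pi z / n along n =
    2^(r+1). *)
Lemma sin_product (z : C) : exists l, cvgC (cprod (fun i => 1 + - (z * z / (nC (S i) * nC (S i))))) l /\
  Csin (RtoC PI * z) = RtoC PI * z * l.
Proof.
  set (w := RtoC PI * z).
  assert (L1 := cvgC_n_sin dyadic w to_inf_dyadic). assert (L2 := cvgC_cos dyadic w to_inf_dyadic).
  destruct (cvgC_bounded _ _ L1) as [M [HM0 HM]].
  assert (Hpi : RtoC PI <> 0) by (apply RtoC_neq0, PI_neq0).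
  set (sa := fun r => nC (dyadic r) * Csin (w / nC (dyadic r))) in *.
  set (sb := fun r i => nC (dyadic r) * Csin (RtoC (ang (dyadic r) (S i)))).
  destruct (tannery_prod (fun r i => - (sa r * sa r / (sb r i * sb r i)))
     (fun i => - (z * z / (nC (S i) * nC (S i)))) (fun i => (M * M) * / (INR (S i) * INR (S i)))%R
     (fun r => two_pow r - 1)%nat 0) as [l [T1 T2]].
  - apply summable_scal; [nra | apply summable_inv_sq].
  - apply to_inf_pw1.
  - intros r i _ Hi. assert (Q := n_sin_ang_lower r i Hi). fold (sb r i) in Q.
    assert (P := INR_S_pos i).
    rewrite Cmod_opp, Cmod_div by (apply Cmult_neq_0; apply Cmod_gt_0; lra).
    rewrite !Cmod_mult. specialize (HM r). fold (sa r) in HM.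
    apply Rmult_le_compat.
    + apply Rmult_le_pos; apply Cmod_ge_0.
    + left. apply Rinv_0_lt_compat. nra.
    + apply Rmult_le_compat; auto using Cmod_ge_0.
    + apply Rinv_le_contravar; nra.
  - intros i. apply cvgC_opp.
    replace (z * z / (nC (S i) * nC (S i))) with (w * w / ((RtoC PI * nC (S i)) * (RtoC PI * nC (S i))))
      by (unfold w; field; auto using nC_S_neq0).
    apply cvgC_div.
    + repeat apply Cmult_neq_0; auto using nC_S_neq0.
    + apply cvgC_mult; exact L1.
    + apply cvgC_mult; apply cvgC_n_sin_ang.
  - exists l; split; auto. fold w.
    assert (L := cvgC_mult _ _ _ _ (cvgC_mult _ _ _ _ L1 L2) T2). rewrite Cmult_1_r in L.
    apply (cvgC_unique (fun _ => Csin w)); [apply cvgC_const|].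
    eapply cvgC_ext; [|exact L]. intros r. cbv beta.
    assert (F := sin_product_finite r (two_pow r - 1) (w / nC (dyadic r)) (two_pow_S_pred r)).
    cbv zeta in F. fold (dyadic r) in F. rewrite nC_dyadic_mul in F. rewrite F.
    unfold sa, sb. f_equal. apply cprod_ext. intros i Hi.
    assert (Z := sin_ang_neq0 (two_pow r - 1) i Hi). fold (dyadic r) in Z. assert (Z' := dyadic_pos r).
    field. auto.
Qed.

Lemma poch_pair z n : poch (z + 1) n * poch (1 - z) n =
  nC (fact n) * nC (fact n) * cprod (fun i => 1 + - (z * z / (nC (S i) * nC (S i)))) n.
Proof.
  induction n as [|n IH].
  - rewrite !poch_0. change (nC (fact 0)) with (RtoC 1). change (cprod _ 0) with (RtoC 1). ring.
  - rewrite !poch_S, cprod_S, !nC_fact_S.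
    replace (poch (z + 1) n * (z + 1 + nC n) * (poch (1 - z) n * (1 - z + nC n))) with
      (poch (z + 1) n * poch (1 - z) n * ((z + 1 + nC n) * (1 - z + nC n))) by ring.
    rewrite IH. assert (A := nC_S_neq0 n). rewrite nC_S in *. field. auto.
Qed.

(** By [poch_pair] the Gauss quotients at z and 1-z multiply to z times the partial sine product, up
    to a power ratio tending to 1. The reciprocal form holds at integers too. *)
Lemma RGamma_reflection z : RtoC PI * (RGamma z * RGamma (1 - z)) = Csin (RtoC PI * z).
Proof.
  destruct (sin_product z) as [l [H1 H2]]. rewrite H2, <- Cmult_assoc. f_equal.
  apply (cvgC_unique (fun n => gauss_quot z (S n) * gauss_quot (1 - z) n)).
  - apply cvgC_mult; [apply (cvgC_comp _ _ S to_inf_S (gauss_quot_cvg z)) | apply gauss_quot_cvg].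
  - replace (z * l) with (z * l * 1) by ring.
    eapply cvgC_ext; [|apply cvgC_mult; [apply cvgC_mult; [apply cvgC_const | exact H1] | apply (cvgC_cpow_nat 1 2 (z - 1))]].
    intros n. cbv beta. replace (n + 1)%nat with (S n) by lia. replace (n + 2)%nat with (S (S n)) by lia.
    unfold gauss_quot. rewrite poch_S_l.
    replace (z * poch (z + 1) n / (nC (fact (S n)) * cpow (INR (S (S n))) (z - 1)) *
      (poch (1 - z) n / (nC (fact n) * cpow (INR (S n)) (1 - z - 1)))) with
      (z * (poch (z + 1) n * poch (1 - z) n) / (nC (fact (S n)) * cpow (INR (S (S n))) (z - 1) * (nC (fact n) * cpow (INR (S n)) (1 - z - 1)))).
    + rewrite poch_pair. replace (1 - z - 1) with (- z) by ring.
      rewrite cpow_opp, (cpow_sub_1 (INR (S n)) z) by apply INR_S_pos. rewrite nC_fact_S.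
      change (RtoC (INR (S n))) with (nC (S n)).
      field. repeat split; auto using cpow_neq0, nC_fact_neq0, nC_S_neq0.
    + field. repeat split; auto using cpow_neq0, nC_fact_neq0, nC_S_neq0.
Qed.

(** The reflection formula reduces the zeros of the sine to those of 1/Gamma. *)
Lemma Csin_PI_neq0 z : notInt z -> Csin (RtoC PI * z) <> 0.
Proof.
  intros H. rewrite <- RGamma_reflection. repeat apply Cmult_neq_0.
  - apply RtoC_neq0, PI_neq0.
  - now apply RGamma_neq0, notInt_nonpole.
  - now apply RGamma_neq0, notInt_nonpole, notInt_1_sub.
Qed.

Lemma sq_sub_neq0 z i : notInt z -> nC (S i) * nC (S i) - z * z <> 0.
Proof.
  intros H. replace (nC (S i) * nC (S i) - z * z) with ((nC (S i) - z) * (z + nC (S i))) by ring.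
  apply Cmult_neq_0; apply notInt_neq0; [now apply notInt_nat_sub | now apply notInt_add_nat].
Qed.

Lemma cot_series z : notInt z -> exists l,
  cvgC (csum (fun i => 2 * z / (nC (S i) * nC (S i) - z * z))) l /\
  RtoC PI * Ccot (RtoC PI * z) = / z - l.
Proof.
  intros Hz. assert (Hs := Csin_PI_neq0 z Hz). assert (Hz0 := notInt_neq0 z Hz).
  set (w := RtoC PI * z) in *.
  assert (L1 := cvgC_n_sin dyadic w to_inf_dyadic). assert (L2 := cvgC_cos dyadic w to_inf_dyadic).
  destruct (cvgC_bounded _ _ L1) as [M [HM0 HM]]. destruct (cvgC_bounded _ _ L2) as [M2 [HM20 HM2]].
  assert (Hpi : RtoC PI <> 0) by (apply RtoC_neq0, PI_neq0).
  assert (Ppi := PI_RGT_0).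
  set (sa := fun r => nC (dyadic r) * Csin (w / nC (dyadic r))) in *.
  set (ca := fun r => Ccos (w / nC (dyadic r))) in *.
  set (sb := fun r i => nC (dyadic r) * Csin (RtoC (ang (dyadic r) (S i)))).
  (* For i >= k0 the square of [sb r i], at least (i+1)^2, is at least twice the bound M^2 for the
     square of [sa r]; the denominator then keeps half of (i+1)^2. *)
  destruct (INR_unbounded (2 * (M * M))) as [k0 Hk0].
  destruct (tannery_from (fun r i => RtoC PI * (2 * (sa r * ca r)) / (sb r i * sb r i - sa r * sa r))
     (fun i => 2 * z / (nC (S i) * nC (S i) - z * z))
     (fun i => (4 * PI * M * M2) * / (INR (S i) * INR (S i)))%R
     (fun r => two_pow r - 1)%nat 0 k0) as [l [T1 T2]].
  - apply summable_scal; [|apply summable_inv_sq].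
    assert (0 < PI * M * M2)%R by (apply Rmult_lt_0_compat; [apply Rmult_lt_0_compat; lra | lra]). lra.
  - apply to_inf_pw1.
  - intros r i _ [Hi1 Hi2]. assert (Q := n_sin_ang_lower r i Hi2). fold (sb r i) in Q.
    assert (P : (1 <= INR (S i))%R) by (rewrite S_INR; assert (T := pos_INR i); lra).
    specialize (HM r). specialize (HM2 r). fold (sa r) in HM. fold (ca r) in HM2.
    assert (K : (2 * (M * M) <= INR (S i))%R).
    { apply le_INR in Hi1. rewrite S_INR. lra. }
    assert (D : (INR (S i) * INR (S i) / 2 <= Cmod (sb r i * sb r i - sa r * sa r))%R).
    { assert (T := Cmod_triangle_sub (sb r i * sb r i) (sa r * sa r)). rewrite !Cmod_mult in T.
      assert (T1 : (Cmod (sa r) * Cmod (sa r) <= M * M)%R) by (apply Rmult_le_compat; auto using Cmod_ge_0).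
      assert (T2 : (INR (S i) * INR (S i) <= Cmod (sb r i) * Cmod (sb r i))%R) by (apply Rmult_le_compat; lra).
      nra. }
    rewrite Cmod_div by (apply Cmod_gt_0; nra). rewrite !Cmod_mult, !Cmod_R.
    rewrite (Rabs_pos_eq PI), (Rabs_pos_eq 2) by lra.
    apply Rle_trans with (PI * (2 * (M * M2)) / (INR (S i) * INR (S i) / 2))%R.
    + apply Rmult_le_compat.
      * apply Rmult_le_pos; [lra|]. apply Rmult_le_pos; [lra|]. apply Rmult_le_pos; apply Cmod_ge_0.
      * left. apply Rinv_0_lt_compat. nra.
      * apply Rmult_le_compat_l; [lra|]. apply Rmult_le_compat_l; [lra|].
        apply Rmult_le_compat; auto using Cmod_ge_0.
      * apply Rinv_le_contravar; nra.
    + right. field. lra.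
  - intros i. assert (Hq := sq_sub_neq0 z i Hz).
    assert (Hq2 : RtoC PI * nC (S i) * (RtoC PI * nC (S i)) - w * w <> 0).
    { replace (RtoC PI * nC (S i) * (RtoC PI * nC (S i)) - w * w) with
        (RtoC PI * RtoC PI * (nC (S i) * nC (S i) - z * z)) by (unfold w; ring).
      repeat apply Cmult_neq_0; auto. }
    replace (2 * z / (nC (S i) * nC (S i) - z * z)) with
      (RtoC PI * (2 * (w * 1)) / ((RtoC PI * nC (S i)) * (RtoC PI * nC (S i)) - w * w)).
    2:{ unfold w in *. field. split; auto. }
    apply cvgC_div; auto.
    + apply cvgC_mult; [apply cvgC_const|]. apply cvgC_mult; [apply cvgC_const|]. apply cvgC_mult; auto.
    + apply cvgC_minus; apply cvgC_mult; auto; apply cvgC_n_sin_ang.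
  - exists l; split; auto.
    assert (Hw : w <> 0) by (unfold w; apply Cmult_neq_0; auto).
    (* The tangent from the middle index carries a factor 1/n^2 in these rescaled quantities and
       disappears. *)
    assert (L : cvgC (fun r => RtoC PI * (ca r / sa r) - RtoC PI * (sa r / ca r) * (/ nC (dyadic r) * / nC (dyadic r))
       - csum (fun i => RtoC PI * (2 * (sa r * ca r)) / (sb r i * sb r i - sa r * sa r)) (two_pow r - 1))
       (RtoC PI * (1 / w) - RtoC PI * (w / 1) * (0 * 0) - l)).
    { apply cvgC_minus; auto. apply cvgC_minus.
      - apply cvgC_mult; [apply cvgC_const | apply cvgC_div; auto].
      - apply cvgC_mult.
        + apply cvgC_mult; [apply cvgC_const | apply cvgC_div; auto using C1_nz].
        + apply cvgC_mult; apply cvgC_inv_nC, to_inf_dyadic. }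
    replace (RtoC PI * (1 / w) - RtoC PI * (w / 1) * (0 * 0) - l) with (/ z - l) in L
      by (unfold w; field; auto).
    apply (cvgC_unique (fun _ => RtoC PI * Ccot w)); [apply cvgC_const|].
    eapply cvgC_ext; [|exact L]. intros r. cbv beta.
    assert (F := cot_finite r (two_pow r - 1) (w / nC (dyadic r)) (two_pow_S_pred r)).
    cbv zeta in F. fold (dyadic r) in F. rewrite nC_dyadic_mul in F. specialize (F Hs).
    destruct F as [F [Z1 [Z2 Z3]]]. assert (Z' := dyadic_pos r). fold (ca r) in *.
    replace (RtoC PI * Ccot w) with (RtoC PI / nC (dyadic r) * (nC (dyadic r) * Ccot w)) by (field; auto).
    rewrite F.
    replace (csum (fun i => RtoC PI * (2 * (sa r * ca r)) / (sb r i * sb r i - sa r * sa r)) (two_pow r - 1)) with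
      (RtoC PI / nC (dyadic r) * csum (fun i => 2 * (Csin (w / nC (dyadic r)) * ca r) /
       (Csin (RtoC (ang (dyadic r) (S i))) * Csin (RtoC (ang (dyadic r) (S i))) - Csin (w / nC (dyadic r)) * Csin (w / nC (dyadic r)))) (two_pow r - 1)).
    + unfold sa. field. auto.
    + rewrite <- csum_scal. apply csum_ext. intros i Hi. specialize (Z3 i Hi).
      unfold sa, sb. field. split; auto.
      replace (nC (dyadic r) * Csin (ang (dyadic r) (S i)) * (nC (dyadic r) * Csin (ang (dyadic r) (S i))) -
        nC (dyadic r) * Csin (w / nC (dyadic r)) * (nC (dyadic r) * Csin (w / nC (dyadic r)))) with
        (nC (dyadic r) * nC (dyadic r) * (Csin (RtoC (ang (dyadic r) (S i))) * Csin (RtoC (ang (dyadic r) (S i))) - Csin (w / nC (dyadic r)) * Csin (w / nC (dyadic r)))) by ring.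
      repeat apply Cmult_neq_0; auto.
Qed.

(** * The digamma function *)

(* The digamma function up to the additive constant [- EulerGamma]. *)
Definition psi0 (z : C) : C := CSeries (fun n => / nC (S n) - / (nC n + z)).

Lemma psi0_cvg z : nonpole z -> cvgC (csum (fun n => / nC (S n) - / (nC n + z))) (psi0 z).
Proof.
  intros H. destruct (nonpole_lower z H) as [c [Hc0 Hc]].
  destruct (summable_cvgC (fun n => / nC (S n) - / (nC n + z))
     (fun n => (Cmod (z - 1) * c) * / (INR (S n) * INR (S n)))%R) as [l Hl].
  - apply summable_scal; [|apply summable_inv_sq]. apply Rmult_le_pos; [apply Cmod_ge_0|lra].
  - intros k. specialize (H k). specialize (Hc k). assert (A := nC_S_neq0 k).
    assert (P := INR_S_pos k). rewrite Cplus_comm in H, Hc.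
    replace (/ nC (S k) - / (nC k + z)) with ((z - 1) / (nC (S k) * (nC k + z)))
      by (rewrite nC_S in *; field; auto).
    rewrite Cmod_div by (apply Cmult_neq_0; auto). rewrite Cmod_mult, Cmod_nC.
    unfold Rdiv. rewrite Rmult_assoc. apply Rmult_le_compat_l; [apply Cmod_ge_0|].
    assert (Q : (0 < Cmod (nC k + z))%R) by now apply Cmod_gt_0.
    rewrite 2!Rinv_mult. rewrite (Rmult_comm c), Rmult_assoc.
    apply Rmult_le_compat_l; [left; now apply Rinv_0_lt_compat|].
    apply Rmult_le_reg_l with (Cmod (nC k + z)); auto. rewrite Rinv_r by lra.
    apply Rmult_le_reg_r with (INR (S k)); auto.
    replace (Cmod (nC k + z) * (/ INR (S k) * c) * INR (S k))%R with (c * Cmod (nC k + z))%R by (field; lra).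
    lra.
  - replace (psi0 z) with l; auto. symmetry. now apply cvgC_CSeries.
Qed.

Lemma psi0_S z : nonpole z -> psi0 (z + 1) = psi0 z + / z.
Proof.
  intros H. assert (H1 : nonpole (z + 1)) by (apply (nonpole_add z 1 H)).
  apply (cvgC_unique _ _ _ (psi0_cvg _ H1)).
  replace (psi0 z + / z) with (psi0 z + / z - 0) by ring.
  apply (cvgC_ext (fun n => csum (fun n => / nC (S n) - / (nC n + z)) n + / z - / (nC n + z))).
  - induction n as [|n IH].
    + rewrite 2!csum_0, nC_0, 2!Cplus_0_l. ring.
    + rewrite 2!csum_S, <- IH. rewrite (nC_S n). replace (nC n + 1 + z) with (nC n + (z + 1)) by ring. ring.
  - apply cvgC_minus; [apply cvgC_plus; [now apply psi0_cvg | apply cvgC_const]|].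
    destruct (nonpole_lower z H) as [c [Hc0 Hc]].
    apply (cvgC_squeeze _ _ (fun n => c * / INR (S n))%R 0).
    + intros n _. replace (/ (nC n + z) - 0) with (/ (z + nC n)) by (rewrite Cplus_comm; ring).
      rewrite Cmod_inv by auto. specialize (Hc n). assert (P := INR_S_pos n).
      assert (Q := proj1 (Cmod_gt_0 _) (H n)).
      apply Rmult_le_reg_l with (Cmod (z + nC n)); auto. rewrite Rinv_r by lra.
      apply Rmult_le_reg_r with (INR (S n)); auto.
      replace (Cmod (z + nC n) * (c * / INR (S n)) * INR (S n))%R with (c * Cmod (z + nC n))%R by (field; lra).
      lra.
    + replace (Finite 0) with (Rbar_mult c 0) by (simpl; f_equal; ring).
      apply is_lim_seq_scal_l, is_lim_seq_inv_S.
Qed.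

Lemma psi0_add z m : nonpole z -> psi0 (z + nC m) = psi0 z + csum (fun i => / (z + nC i)) m.
Proof.
  intros H. induction m as [|m IH]; [rewrite nC_0, Cplus_0_r, csum_0; ring|].
  rewrite csum_S, nC_S, Cplus_assoc, psi0_S, IH by (now apply nonpole_add). ring.
Qed.

Lemma psi0_1 : psi0 1 = 0.
Proof.
  apply cvgC_CSeries. apply (cvgC_ext (fun _ => RtoC 0)); [|apply cvgC_const].
  induction n as [|n IH]; [reflexivity|]. rewrite csum_S, <- IH, nC_S. ring.
Qed.

(** Term by term, 2z/(n^2 - z^2) = 1/(n-z) - 1/(n+z), so the partial sums of the two psi series and
    of the cotangent series differ by the single boundary term 1/(n+1-z). *)
Lemma psi0_reflection z : notInt z -> psi0 (1 - z) = psi0 z + RtoC PI * Ccot (RtoC PI * z).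
Proof.
  intros Hz. destruct (cot_series z Hz) as [l [H1 H2]]. rewrite H2.
  assert (Hz1 := notInt_nonpole z Hz). assert (Hz2 := notInt_nonpole _ (notInt_1_sub z Hz)).
  apply (cvgC_unique _ _ _ (cvgC_comp _ _ S to_inf_S (psi0_cvg _ Hz2))).
  replace (psi0 z + (/ z - l)) with (psi0 z + (/ z - l) - 0) by ring.
  assert (Hl : cvgC (fun n => / (nC n + (1 - z))) 0).
  { destruct (nonpole_lower _ Hz2) as [c [Hc0 Hc]].
    apply (cvgC_squeeze _ _ (fun n => c * / INR (S n))%R 0).
    + intros n _. replace (/ (nC n + (1 - z)) - 0) with (/ (1 - z + nC n)) by (rewrite (Cplus_comm (nC n)); ring).
      rewrite Cmod_inv by auto. specialize (Hc n). assert (P := INR_S_pos n).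
      assert (Q := proj1 (Cmod_gt_0 _) (Hz2 n)).
      apply Rmult_le_reg_l with (Cmod (1 - z + nC n)); auto. rewrite Rinv_r by lra.
      apply Rmult_le_reg_r with (INR (S n)); auto.
      replace (Cmod (1 - z + nC n) * (c * / INR (S n)) * INR (S n))%R with (c * Cmod (1 - z + nC n))%R by (field; lra).
      lra.
    + replace (Finite 0) with (Rbar_mult c 0) by (simpl; f_equal; ring).
      apply is_lim_seq_scal_l, is_lim_seq_inv_S. }
  eapply cvgC_ext; [|apply cvgC_minus; [apply cvgC_plus; [apply (cvgC_comp _ _ S to_inf_S (psi0_cvg _ Hz1)) |
     apply cvgC_minus; [apply cvgC_const | exact H1]] | exact Hl]].
  intros n. cbv beta. induction n as [|n IH].
  - rewrite 2!csum_S, !csum_0, nC_0, 3!Cplus_0_l. ring.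
  - rewrite (csum_S _ n), (csum_S _ (S n)), (csum_S _ (S n)), <- IH.
    assert (E : 2 * z / (nC (S n) * nC (S n) - z * z) = / (nC n + (1 - z)) - / (nC (S n) + z)).
    { assert (X1 := sq_sub_neq0 z n Hz). assert (X2 := Hz1 (S n)). assert (X3 := Hz2 n).
      rewrite Cplus_comm in X2, X3. rewrite nC_S in *. field. auto. }
    rewrite E. ring.
Qed.

(** * Residues of rational functions *)

(** Monic polynomials are represented by lists of roots: the degree is a length, and cancelling a
    common factor deletes an entry. *)
Definition root_prod (l : list C) (s : C) : C := prodC (map (fun r => s - r) l).

(* [root_prod1 l] and [root_prod2 l] are the first and second derivatives of [root_prod l]. *)
Fixpoint root_prod1 (l : list C) (s : C) : C :=
  match l with [] => 0 | r :: l' => root_prod l' s + (s - r) * root_prod1 l' s end.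

Fixpoint root_prod2 (l : list C) (s : C) : C :=
  match l with [] => 0 | r :: l' => 2 * root_prod1 l' s + (s - r) * root_prod2 l' s end.

Lemma root_prod_cons r l s : root_prod (r :: l) s = (s - r) * root_prod l s. Proof. reflexivity. Qed.

Lemma root_prod_app l k s : root_prod (l ++ k) s = root_prod l s * root_prod k s.
Proof. unfold root_prod. now rewrite map_app, prodC_app. Qed.

Lemma root_prod1_app l k s : root_prod1 (l ++ k) s = root_prod1 l s * root_prod k s + root_prod l s * root_prod1 k s.
Proof.
  induction l as [|r l IH]; simpl; [unfold root_prod at 2; simpl; ring|].
  rewrite IH, root_prod_app, root_prod_cons. ring.
Qed.

Lemma root_prod2_app l k s :
  root_prod2 (l ++ k) s = root_prod2 l s * root_prod k s + 2 * root_prod1 l s * root_prod1 k s + root_prod l s * root_prod2 k s.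
Proof.
  induction l as [|r l IH]; simpl; [unfold root_prod at 2; simpl; ring|].
  rewrite IH, root_prod1_app, root_prod_cons. ring.
Qed.

Lemma root_prod_in l s : In s l -> root_prod l s = 0.
Proof.
  induction l as [|r l IH]; intros H; [easy|]. rewrite root_prod_cons.
  destruct H as [->|H]; [ring | rewrite IH by auto; ring].
Qed.

Lemma root_prod_notin l s : ~ In s l -> root_prod l s <> 0.
Proof.
  intros H. apply prodC_neq0. intros x Hx. apply Csub_neq0. intros E; subst; auto.
Qed.

Lemma root_prod1_in_neq0 l s : NoDup l -> In s l -> root_prod1 l s <> 0.
Proof.
  induction l as [|r l IH]; intros Hn H; [easy|]. inversion Hn as [|? ? Hr Hl]; subst. simpl.
  destruct H as [->|H].
  - replace (root_prod l s + (s - s) * root_prod1 l s) with (root_prod l s) by ring. now apply root_prod_notin.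
  - rewrite root_prod_in, Cplus_0_l by auto. apply Cmult_neq_0; auto.
    apply Csub_neq0. intros E; subst; auto.
Qed.

Lemma root_prod1_mid l1 F l2 s : In s F -> root_prod1 (l1 ++ F ++ l2) s = root_prod l1 s * root_prod1 F s * root_prod l2 s.
Proof. intros H. rewrite 2!root_prod1_app, root_prod_app, (root_prod_in F s H). ring. Qed.

Lemma root_prod1_log l s : ~ In s l -> root_prod1 l s = root_prod l s * sumC (map (fun r => / (s - r)) l).
Proof.
  induction l as [|r l IH]; intros H; [unfold sumC; simpl; ring|].
  cbn [root_prod1 map]. rewrite sumC_cons, root_prod_cons, IH by (intros X; apply H; now right).
  assert (s - r <> 0) by (apply Csub_neq0; intros E; subst; apply H; now left). field; auto.
Qed.

(** Residue of [root_prod B / (root_prod A * root_prod D ^ 2)] at a simple zero [a] of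
    [root_prod A]. *)
Definition simple_residue (A D B : list C) (a : C) : C := root_prod B a / (root_prod1 A a * (root_prod D a * root_prod D a)).

(* Residue of [root_prod B / (root_prod A * root_prod D ^ 2)] at a double pole [x], free of
   divisions by [root_prod B x], which may vanish. *)
Definition double_residue (A D B : list C) (x : C) : C :=
  (root_prod1 B x * root_prod A x * root_prod1 D x - root_prod B x * root_prod1 A x * root_prod1 D x - root_prod B x * root_prod A x * root_prod2 D x)
  / (root_prod A x * root_prod A x * (root_prod1 D x * root_prod1 D x * root_prod1 D x)).

Definition residue_sum (A D B : list C) : C := sumC (map (simple_residue A D B) A) + sumC (map (double_residue A D B) D).

Lemma NoDup_app_inv {T} (l k : list T) : NoDup (l ++ k) ->
  NoDup l /\ NoDup k /\ forall x, In x l -> ~ In x k.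
Proof.
  induction l as [|a l IH]; simpl; intros H.
  - repeat split; auto using NoDup_nil.
  - inversion H as [|? ? Ha Hl]; subst. destruct (IH Hl) as [H1 [H2 H3]].
    rewrite in_app_iff in Ha. split; [|split; auto].
    + constructor; auto.
    + intros x [->|Hx]; auto.
Qed.

(** The common factor s - a0 cancels in the fraction: the formal residue at a0 becomes 0 and the
    others keep their values. *)
Lemma residue_sum_cancel_simple a0 A D B : NoDup ((a0 :: A) ++ D) ->
  residue_sum (a0 :: A) D (a0 :: B) = residue_sum A D B.
Proof.
  intros Hn. destruct (NoDup_app_inv _ _ Hn) as [HA [HD HAD]].
  inversion HA as [|? ? Ha0 HA']; subst.
  unfold residue_sum. cbn [map]. rewrite sumC_cons.
  replace (simple_residue (a0 :: A) D (a0 :: B) a0) with (RtoC 0).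
  2:{ unfold simple_residue. rewrite (root_prod_in (a0 :: B)) by now left. unfold Cdiv. ring. }
  rewrite Cplus_0_l. f_equal.
  - apply sumC_ext_in. intros a Ha. unfold simple_residue. cbn [root_prod1]. rewrite root_prod_cons, (root_prod_in A a Ha).
    assert (a - a0 <> 0) by (apply Csub_neq0; intros E; subst; auto).
    assert (root_prod1 A a <> 0) by now apply root_prod1_in_neq0.
    assert (root_prod D a <> 0) by (apply root_prod_notin, HAD; now right).
    rewrite Cplus_0_l. field. auto.
  - apply sumC_ext_in. intros x Hx. unfold double_residue. cbn [root_prod1]. rewrite 2!root_prod_cons.
    assert (x - a0 <> 0) by (apply Csub_neq0; intros E; subst; apply (HAD a0); auto; now left).
    assert (root_prod A x <> 0) by (apply root_prod_notin; intros X; apply (HAD x); auto; now right).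
    assert (root_prod1 D x <> 0) by now apply root_prod1_in_neq0.
    field. auto.
Qed.

(** Cancelling one of the two factors s - x0 demotes the double pole to a simple one. The numerator
    vanishes at x0, and only the term with its derivative survives in [double_residue]. *)
Lemma residue_sum_cancel_double x0 A D B : NoDup (A ++ x0 :: D) ->
  residue_sum A (x0 :: D) (x0 :: B) = residue_sum (x0 :: A) D B.
Proof.
  intros Hn. destruct (NoDup_app_inv _ _ Hn) as [HA [HD HAD]].
  inversion HD as [|? ? Hx0 HD']; subst.
  unfold residue_sum. cbn [map]. rewrite 2!sumC_cons.
  replace (double_residue A (x0 :: D) (x0 :: B) x0) with (simple_residue (x0 :: A) D B x0).
  2:{ unfold double_residue, simple_residue. cbn [root_prod1 root_prod2]. rewrite (root_prod_in (x0 :: B)) by now left.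
      assert (root_prod A x0 <> 0) by (apply root_prod_notin; intros X; apply (HAD x0); auto; now left).
      assert (root_prod D x0 <> 0) by now apply root_prod_notin.
      replace (x0 - x0) with (RtoC 0) by ring. rewrite !Cmult_0_l, !Cplus_0_r. field. auto. }
  replace (sumC (map (simple_residue A (x0 :: D) (x0 :: B)) A)) with (sumC (map (simple_residue (x0 :: A) D B) A)).
  2:{ apply sumC_ext_in. intros a Ha. unfold simple_residue. cbn [root_prod1]. rewrite 2!root_prod_cons, (root_prod_in A a Ha).
      assert (a - x0 <> 0) by (apply Csub_neq0; intros E; subst; apply (HAD x0); auto; now left).
      assert (root_prod1 A a <> 0) by now apply root_prod1_in_neq0.
      assert (root_prod D a <> 0) by (apply root_prod_notin; intros X; apply (HAD a); auto; now right).
      rewrite Cplus_0_l. field. auto. }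
  replace (sumC (map (double_residue A (x0 :: D) (x0 :: B)) D)) with (sumC (map (double_residue (x0 :: A) D B) D)).
  2:{ apply sumC_ext_in. intros x Hx. unfold double_residue. cbn [root_prod1 root_prod2]. rewrite 2!root_prod_cons, (root_prod_in D x Hx).
      assert (x - x0 <> 0) by (apply Csub_neq0; intros E; subst; auto).
      assert (root_prod A x <> 0) by (apply root_prod_notin; intros X; apply (HAD x); auto; now right).
      assert (root_prod1 D x <> 0) by now apply root_prod1_in_neq0.
      rewrite Cplus_0_l. field. auto. }
  ring.
Qed.

(** Residues are linear in the numerator, and s - b = (s - b') + (b' - b). This lets any zero be
    moved onto a pole, where it cancels. *)
Lemma residue_sum_shift A D B b b' :
  residue_sum A D (b :: B) = residue_sum A D (b' :: B) + (b' - b) * residue_sum A D B.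
Proof.
  unfold residue_sum.
  assert (E1 : sumC (map (simple_residue A D (b :: B)) A) =
    sumC (map (simple_residue A D (b' :: B)) A) + (b' - b) * sumC (map (simple_residue A D B) A)).
  { rewrite <- sumC_scal, <- sumC_plus. apply sumC_ext_in. intros a _.
    unfold simple_residue. rewrite 2!root_prod_cons. unfold Cdiv. ring. }
  assert (E2 : sumC (map (double_residue A D (b :: B)) D) =
    sumC (map (double_residue A D (b' :: B)) D) + (b' - b) * sumC (map (double_residue A D B) D)).
  { rewrite <- sumC_scal, <- sumC_plus. apply sumC_ext_in. intros a _.
    unfold double_residue. cbn [root_prod1]. rewrite 2!root_prod_cons. unfold Cdiv. ring. }
  rewrite E1, E2. ring.
Qed.

Lemma residue_sum_swapA a0 a1 A D B : residue_sum (a0 :: a1 :: A) D B = residue_sum (a1 :: a0 :: A) D B.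
Proof.
  assert (E1 : forall s, root_prod (a0 :: a1 :: A) s = root_prod (a1 :: a0 :: A) s) by (intros; rewrite !root_prod_cons; ring).
  assert (E2 : forall s, root_prod1 (a0 :: a1 :: A) s = root_prod1 (a1 :: a0 :: A) s)
    by (intros; cbn [root_prod1]; rewrite !root_prod_cons; ring).
  unfold residue_sum. f_equal.
  - rewrite (sumC_ext_in _ (simple_residue (a1 :: a0 :: A) D B)) by (intros; unfold simple_residue; now rewrite E2).
    cbn [map]. rewrite !sumC_cons. ring.
  - apply sumC_ext_in. intros. unfold double_residue. now rewrite E1, E2.
Qed.

Lemma residue_sum_swapD x0 x1 A D B : residue_sum A (x0 :: x1 :: D) B = residue_sum A (x1 :: x0 :: D) B.
Proof.
  assert (E1 : forall s, root_prod (x0 :: x1 :: D) s = root_prod (x1 :: x0 :: D) s) by (intros; rewrite !root_prod_cons; ring).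
  assert (E2 : forall s, root_prod1 (x0 :: x1 :: D) s = root_prod1 (x1 :: x0 :: D) s)
    by (intros; cbn [root_prod1]; rewrite !root_prod_cons; ring).
  assert (E3 : forall s, root_prod2 (x0 :: x1 :: D) s = root_prod2 (x1 :: x0 :: D) s)
    by (intros; cbn [root_prod1 root_prod2]; ring).
  unfold residue_sum. f_equal.
  - apply sumC_ext_in. intros. unfold simple_residue. now rewrite E1.
  - rewrite (sumC_ext_in _ (double_residue A (x1 :: x0 :: D) B)) by (intros; unfold double_residue; now rewrite E2, E3).
    cbn [map]. rewrite !sumC_cons. ring.
Qed.

Lemma residue_sum_two A D z0 z1 : z0 <> z1 ->
  residue_sum A D [z0] = residue_sum A D [z1] -> residue_sum A D [] = 0.
Proof.
  intros Hz E. assert (S := residue_sum_shift A D [] z0 z1). rewrite E in S.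
  assert (Hs := Csub_neq0 z1 z0 ltac:(auto)).
  replace (residue_sum A D []) with (/ (z1 - z0) * ((residue_sum A D [z1] + (z1 - z0) * residue_sum A D []) - residue_sum A D [z1]))
    by (field; auto).
  rewrite <- S. ring.
Qed.

(** Induction on the degree of the denominator. For two distinct poles z0 and z1, the numerators s -
    z0 and s - z1 cancel one factor each and have equal residue sums by induction; their difference
    is a nonzero constant times the sum in question. *)
Lemma residue_sum_nil t : forall A D : list C, (length A + 2 * length D)%nat = t -> (2 <= t)%nat ->
  NoDup (A ++ D) -> residue_sum A D [] = 0.
Proof.
  induction t as [|t IH]; intros A D Ht H2 Hn; [lia|].
  destruct A as [|a0 [|a1 A]].
  - destruct D as [|x0 [|x1 D]]; [simpl in Ht; lia| |].
    + unfold residue_sum, double_residue. cbn [map root_prod1 root_prod2]. unfold sumC, root_prod. simpl. unfold Cdiv. ring.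
    + simpl in Hn, Ht. apply (residue_sum_two _ _ x0 x1).
      * intros E; subst. inversion Hn as [|? ? X _]; apply X; now left.
      * assert (P : NoDup (x1 :: x0 :: D)).
        { eapply Permutation_NoDup; [apply perm_swap | exact Hn]. }
        rewrite (residue_sum_cancel_double x0 [] (x1 :: D) []) by exact Hn.
        rewrite residue_sum_swapD, (residue_sum_cancel_double x1 [] (x0 :: D) []) by exact P.
        rewrite (IH [x0] (x1 :: D)), (IH [x1] (x0 :: D)); auto; simpl; lia.
  - destruct D as [|x0 D]; [simpl in Ht; lia|]. simpl in Ht.
    apply (residue_sum_two _ _ a0 x0).
    + intros E; subst. simpl in Hn. inversion Hn as [|? ? X _]; apply X; now left.
    + rewrite (residue_sum_cancel_simple a0 [] (x0 :: D) []) by exact Hn.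
      assert (P : NoDup ((x0 :: [a0]) ++ D)).
      { eapply Permutation_NoDup; [apply perm_swap | exact Hn]. }
      rewrite (residue_sum_cancel_double x0 [a0] D []) by exact Hn.
      rewrite (IH [] (x0 :: D)), (IH [x0; a0] D); auto; simpl; try lia.
      simpl in Hn. now inversion Hn.
  - assert (P : NoDup ((a1 :: a0 :: A) ++ D)).
    { eapply Permutation_NoDup; [apply perm_swap | exact Hn]. }
    apply (residue_sum_two _ _ a0 a1).
    + intros E; subst. simpl in Hn. inversion Hn as [|? ? X _]; apply X; now left.
    + rewrite (residue_sum_cancel_simple a0 (a1 :: A) D []) by exact Hn.
      rewrite residue_sum_swapA, (residue_sum_cancel_simple a1 (a0 :: A) D []) by exact P.
      (* In degree 2 with two simple poles the induction hypothesis does not reach the quotients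
         1/(s-a); both have residue 1, so the two sides still agree. *)
      destruct (Nat.eq_dec (length A + 2 * length D) 0) as [E|E].
      * destruct A; [|simpl in E; lia]. destruct D; [|simpl in E; lia].
        unfold residue_sum, simple_residue, sumC, root_prod. simpl. unfold root_prod. simpl.
        replace (a1 - a1) with (RtoC 0) by ring. replace (a0 - a0) with (RtoC 0) by ring.
        rewrite !Cmult_0_l. reflexivity.
      * simpl in Hn, P, Ht. rewrite (IH (a1 :: A) D), (IH (a0 :: A) D); auto; simpl; try lia;
          [inversion P | inversion Hn]; auto.
Qed.

(** Induction on the numerator: a zero is shifted onto a pole, which leaves one term with a
    cancelled factor and one with a shorter numerator. Both keep the degree at most -2. *)
Theorem sum_of_residues : forall B A D, (length B + 2 <= length A + 2 * length D)%nat ->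
  NoDup (A ++ D) -> residue_sum A D B = 0.
Proof.
  induction B as [|b B IH]; intros A D Hl Hn.
  - apply (residue_sum_nil (length A + 2 * length D)); auto.
  - simpl in Hl. destruct A as [|a0 A].
    + destruct D as [|x0 D]; [simpl in Hl; lia|]. simpl in Hl.
      rewrite (residue_sum_shift _ _ _ b x0), (residue_sum_cancel_double x0 [] D B) by exact Hn.
      rewrite (IH [x0] D), (IH [] (x0 :: D)); auto; simpl; try lia. ring.
    + rewrite (residue_sum_shift _ _ _ b a0), (residue_sum_cancel_simple a0 A D B) by exact Hn.
      simpl in Hl, Hn. rewrite (IH A D), (IH (a0 :: A) D); auto; simpl; try lia; [ring|].
      now inversion Hn.
Qed.

(** * Asymptotics uniform in the index *)

Definition weight (N n : nat) (a b c : R) : R :=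
  (succ_pow n a * (Rpower (INR (N - n) / INR N) b * Rpower (INR N) c))%R.

(* [F N n] is equivalent to [f n * N ^ z] for fixed [n], and dominated by
   [(n + 1) ^ a * (1 - n / N) ^ b * N ^ Re z] uniformly in [n < N]. *)
Definition asymp (F : nat -> nat -> C) (z : C) (f : nat -> C) (a b : R) : Prop :=
  (forall n, cvgC (fun N => F N n / cpow (INR N) z) (f n)) /\
  exists M N0, (0 <= M)%R /\
    forall N n, (N0 <= N)%nat -> (n < N)%nat -> (Cmod (F N n) <= M * weight N n a b (Re z))%R.

Lemma weight_plus N n a b c a' b' c' :
  weight N n (a + a') (b + b') (c + c') = (weight N n a b c * weight N n a' b' c')%R.
Proof. unfold weight. rewrite succ_pow_plus, 2!Rpower_plus. ring. Qed.

Lemma Re_plus x y : Re (x + y) = (Re x + Re y)%R. Proof. reflexivity. Qed.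
Lemma Re_opp x : Re (- x) = (- Re x)%R. Proof. reflexivity. Qed.
Lemma Re_minus x y : Re (x - y) = (Re x - Re y)%R. Proof. reflexivity. Qed.
Lemma Re_1 : Re 1 = 1%R. Proof. reflexivity. Qed.
Lemma Re_0 : Re 0 = 0%R. Proof. reflexivity. Qed.
Lemma Re_RtoC x : Re (RtoC x) = x. Proof. reflexivity. Qed.
Lemma Re_nC n : Re (nC n) = INR n. Proof. reflexivity. Qed.

Lemma asymp_mult F z f a b G y g a' b' : asymp F z f a b -> asymp G y g a' b' ->
  asymp (fun N n => F N n * G N n) (z + y) (fun n => f n * g n) (a + a') (b + b').
Proof.
  intros [H1 [M [N0 [HM0 HM]]]] [K1 [M' [N0' [HM0' HM']]]]. split.
  - intros n. eapply cvgC_ext; [|apply (cvgC_mult _ _ _ _ (H1 n) (K1 n))].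
    intros N. cbv beta. rewrite cpow_add. field. split; apply cpow_neq0.
  - exists (M * M')%R, (Nat.max N0 N0'). split; [now apply Rmult_le_pos|].
    intros N n HN Hn. rewrite Cmod_mult, Re_plus, weight_plus.
    replace (M * M' * (weight N n a b (Re z) * weight N n a' b' (Re y)))%R with
      ((M * weight N n a b (Re z)) * (M' * weight N n a' b' (Re y)))%R by ring.
    apply Rmult_le_compat; auto using Cmod_ge_0; [apply HM | apply HM']; lia.
Qed.

Lemma asymp_ext (F G : nat -> nat -> C) z z' f f' a a' b b' : (forall N n, (n < N)%nat -> F N n = G N n) ->
  (forall n, f n = f' n) -> z = z' -> a = a' -> b = b' ->
  asymp F z f a b -> asymp G z' f' a' b'.
Proof.
  intros E Ef -> -> -> [H1 [M [N0 [HM0 HM]]]]. split.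
  - intros n. rewrite <- Ef. apply (cvgC_ext_loc (fun N => F N n / cpow (INR N) z') _ _ (S n)); auto.
    intros N HN. now rewrite E by lia.
  - exists M, N0. split; auto. intros N n HN Hn. rewrite <- E by auto. auto.
Qed.

Lemma weight_const N n a : (n < N)%nat -> weight N n a 0 0 = succ_pow n a.
Proof.
  intros H. unfold weight. rewrite 2!Rpower_O; [ring| |].
  - apply lt_0_INR; lia.
  - apply Rdiv_lt_0_compat; apply lt_0_INR; lia.
Qed.

Lemma asymp_const f a : (exists M, (0 <= M)%R /\ forall n, (Cmod (f n) <= M * succ_pow n a)%R) ->
  asymp (fun _ n => f n) 0 f a 0.
Proof.
  intros [M [HM0 HM]]. split.
  - intros n. apply (cvgC_ext (fun _ => f n)); [|apply cvgC_const].
    intros N. rewrite cpow_0. field.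
  - exists M, 0%nat. split; auto. intros N n _ Hn. rewrite Re_0, weight_const by auto. auto.
Qed.

Lemma asymp_one : asymp (fun _ _ => 1) 0 (fun _ => 1) 0 0.
Proof.
  apply asymp_const. exists 1%R. split; [lra|]. intros n. rewrite succ_pow_0, Cmod_1. lra.
Qed.

Lemma asymp_prod {T} (l : list T) (F : T -> nat -> nat -> C) z f a b :
  (forall x, In x l -> asymp (F x) (z x) (f x) (a x) (b x)) ->
  asymp (fun N n => prodC (map (fun x => F x N n) l)) (sumC (map z l))
    (fun n => prodC (map (fun x => f x n) l))
    (fold_right Rplus 0%R (map a l)) (fold_right Rplus 0%R (map b l)).
Proof.
  induction l as [|x l IH]; intros H; simpl.
  - apply asymp_one.
  - apply asymp_mult; [apply H; now left | apply IH; intros y Hy; apply H; now right].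
Qed.

Lemma Rpower_pos x y : (0 < Rpower x y)%R. Proof. apply exp_pos. Qed.

(** The exponents are real parts of arbitrary parameters and may have either sign; hence two-sided
    comparability and the absolute value of [r]. *)
Lemma Rpower_le_comparable x y c r : (0 < x)%R -> (0 < y)%R -> (1 <= c)%R ->
  (x <= c * y)%R -> (y <= c * x)%R -> (Rpower x r <= Rpower c (Rabs r) * Rpower y r)%R.
Proof.
  intros Hx Hy Hc H1 H2.
  replace (Rpower x r) with (Rpower (x / y) r * Rpower y r)%R.
  2:{ rewrite Rpower_mult_distr; [|apply Rdiv_lt_0_compat; auto|auto]. f_equal. field. lra. }
  apply Rmult_le_compat_r; [left; apply Rpower_pos|].
  unfold Rpower.
  assert (A : (r * ln (x / y) <= Rabs r * ln c)%R).
  { assert (U : (ln (x / y) <= ln c)%R).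
    { apply ln_le; [apply Rdiv_lt_0_compat; auto|]. apply Rle_div_l; auto. }
    assert (L : (- ln c <= ln (x / y))%R).
    { rewrite <- ln_Rinv by lra. apply ln_le; [apply Rinv_0_lt_compat; lra|].
      apply Rle_div_r; auto. apply Rmult_le_reg_l with c; [lra|].
      rewrite <- Rmult_assoc, Rinv_r by lra. lra. }
    assert (Z : (0 <= ln c)%R) by (rewrite <- ln_1; apply ln_le; lra).
    unfold Rabs. destruct (Rcase_abs r); nra. }
  destruct (Rle_lt_or_eq_dec _ _ A) as [B|B]; [left; now apply exp_increasing | rewrite B; lra].
Qed.

Lemma succ_pow_le_Rpower k r : (0 < k)%nat -> (succ_pow k r <= Rpower 2 (Rabs r) * Rpower (INR k) r)%R.
Proof.
  intros H. unfold succ_pow. assert (P : (1 <= INR k)%R) by (apply (le_INR 1); lia).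
  apply Rpower_le_comparable; rewrite ?S_INR; lra.
Qed.

(** For n < N the base N+n+1 stays between N and 3N, so far factors depend on n only through a
    bounded constant. *)
Lemma succ_pow_far_le N n r : (n < N)%nat -> (succ_pow (N + n) r <= Rpower 3 (Rabs r) * Rpower (INR N) r)%R.
Proof.
  intros H. unfold succ_pow. assert (P : (1 <= INR N)%R) by (apply (le_INR 1); lia).
  assert (Q : (INR n <= INR N)%R) by (apply le_INR; lia). assert (Q' := pos_INR n).
  rewrite S_INR, plus_INR.
  apply Rpower_le_comparable; lra.
Qed.

Lemma succ_pow_sub_le N n r : (n < N)%nat ->
  (succ_pow (N - n) r <= Rpower 2 (Rabs r) * (Rpower (INR (N - n) / INR N) r * Rpower (INR N) r))%R.
Proof.
  intros H. rewrite Rpower_mult_distr.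
  - replace (INR (N - n) / INR N * INR N)%R with (INR (N - n)).
    + apply succ_pow_le_Rpower; lia.
    + field. apply not_0_INR; lia.
  - apply Rdiv_lt_0_compat; apply lt_0_INR; lia.
  - apply lt_0_INR; lia.
Qed.

(** Normalised values of a progression of N roots seen from n steps away. For [near_poch] the
    evaluation point lies within the real span of the progression, which splits into n roots on one
    side and N-n on the other; for [far_poch] it has moved away from the progression. *)
Definition near_poch (w : C) (N n : nat) : C :=
  poch (1 - w) n / nC (fact n) * (poch w (N - n) / nC (fact (N - n))).
Definition far_poch (w : C) (N n : nat) : C := poch w (N + n) / nC (fact (N + n)).

Lemma gauss_quot_fact w k : poch w k / nC (fact k) = gauss_quot w k * cpow (INR (S k)) (w - 1).
Proof. unfold gauss_quot. field. split; auto using nC_fact_neq0, cpow_neq0. Qed.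

Lemma to_inf_sub n : to_inf (fun N => N - n)%nat.
Proof. intros K; exists (K + n)%nat; intros; lia. Qed.
Lemma to_inf_add n : to_inf (fun N => N + n)%nat.
Proof. intros K; exists K; intros; lia. Qed.

Lemma far_cvg w n : cvgC (fun N => far_poch w N n / cpow (INR N) (w - 1)) (RGamma w).
Proof.
  replace (RGamma w) with (RGamma w * 1) by ring.
  eapply cvgC_ext; [|apply cvgC_mult; [apply (cvgC_comp _ _ _ (to_inf_add n) (gauss_quot_cvg w)) |
    apply (cvgC_cpow_nat (S n) 0 (w - 1))]].
  intros N. cbv beta. unfold far_poch. rewrite gauss_quot_fact, Nat.add_0_r, Nat.add_succ_r. unfold Cdiv. ring.
Qed.

Lemma sub_cvg w n : cvgC (fun N => poch w (N - n) / nC (fact (N - n)) / cpow (INR N) (w - 1)) (RGamma w).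
Proof.
  replace (RGamma w) with (RGamma w * 1) by ring.
  eapply (cvgC_ext_loc _ _ _ n); [|apply cvgC_mult; [apply (cvgC_comp _ _ _ (to_inf_sub n) (gauss_quot_cvg w)) |
    apply (cvgC_cpow_shift (1 - INR n) 0 (w - 1))]].
  intros N HN. cbv beta. rewrite gauss_quot_fact, Rplus_0_r.
  replace (INR N + (1 - INR n))%R with (INR (S (N - n))) by (rewrite S_INR, minus_INR by lia; ring).
  unfold Cdiv. ring.
Qed.

Lemma poch_fact_upper w : exists M, (0 <= M)%R /\
  forall n, (Cmod (poch w n / nC (fact n)) <= M * succ_pow n (Re w - 1))%R.
Proof.
  destruct (gauss_quot_upper w) as [M [HM0 HM]]. exists M; split; [lra|]. intros n. specialize (HM n).
  rewrite Cmod_div, Cmod_nC by apply nC_fact_neq0.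
  apply Rle_div_l; [apply INR_fact_lt_0|]. lra.
Qed.

Lemma poch_fact_lower w : nonpole w -> exists M, (0 <= M)%R /\
  forall n, (Cmod (/ (poch w n / nC (fact n))) <= M * succ_pow n (1 - Re w))%R.
Proof.
  intros Hw. destruct (gauss_quot_lower w Hw) as [M [HM0 HM]]. exists M; split; [lra|]. intros n. specialize (HM n).
  assert (P := poch_neq0 w n Hw). assert (Q := nC_fact_neq0 n).
  replace (/ (poch w n / nC (fact n))) with (nC (fact n) / poch w n) by (field; auto).
  rewrite Cmod_div, Cmod_nC by auto. apply Rle_div_l; [now apply Cmod_gt_0|].
  apply Rmult_le_reg_r with (succ_pow n (Re w - 1)); [apply succ_pow_pos|].
  eapply Rle_trans; [exact HM|]. right.
  replace (M * succ_pow n (1 - Re w) * Cmod (poch w n) * succ_pow n (Re w - 1))%R with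
    (M * Cmod (poch w n) * (succ_pow n (1 - Re w) * succ_pow n (Re w - 1)))%R by ring.
  rewrite <- succ_pow_plus. replace (1 - Re w + (Re w - 1))%R with 0%R by ring. rewrite succ_pow_0. ring.
Qed.

Lemma asymp_sub w : asymp (fun N n => poch w (N - n) / nC (fact (N - n))) (w - 1) (fun _ => RGamma w) 0 (Re w - 1).
Proof.
  split; [intros n; apply sub_cvg|].
  destruct (poch_fact_upper w) as [M [HM0 HM]].
  exists (M * Rpower 2 (Rabs (Re w - 1)))%R, 0%nat. split.
  - apply Rmult_le_pos; auto. left; apply Rpower_pos.
  - intros N n _ Hn. eapply Rle_trans; [apply HM|]. rewrite Rmult_assoc.
    apply Rmult_le_compat_l; auto. unfold weight. rewrite succ_pow_0, Rmult_1_l.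
    rewrite Re_minus, Re_1. now apply succ_pow_sub_le.
Qed.

Lemma asymp_sub_inv w : nonpole w ->
  asymp (fun N n => / (poch w (N - n) / nC (fact (N - n)))) (1 - w) (fun _ => / RGamma w) 0 (1 - Re w).
Proof.
  intros Hw. split.
  - intros n. eapply cvgC_ext; [|apply (cvgC_inv _ _ (RGamma_neq0 w Hw) (sub_cvg w n))].
    intros N. cbv beta. replace (1 - w) with (- (w - 1)) by ring. rewrite cpow_opp.
    field. repeat split; auto using cpow_neq0, nC_fact_neq0, poch_neq0.
  - destruct (poch_fact_lower w Hw) as [M [HM0 HM]].
    exists (M * Rpower 2 (Rabs (1 - Re w)))%R, 0%nat. split.
    + apply Rmult_le_pos; auto. left; apply Rpower_pos.
    + intros N n _ Hn. eapply Rle_trans; [apply HM|]. rewrite Rmult_assoc.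
      apply Rmult_le_compat_l; auto. unfold weight. rewrite succ_pow_0, Rmult_1_l.
      rewrite Re_minus, Re_1. now apply succ_pow_sub_le.
Qed.

Lemma asymp_far w : asymp (far_poch w) (w - 1) (fun _ => RGamma w) 0 0.
Proof.
  split; [intros n; apply far_cvg|].
  destruct (poch_fact_upper w) as [M [HM0 HM]].
  exists (M * Rpower 3 (Rabs (Re w - 1)))%R, 0%nat. split.
  - apply Rmult_le_pos; auto. left; apply Rpower_pos.
  - intros N n _ Hn. eapply Rle_trans; [apply HM|]. rewrite Rmult_assoc.
    apply Rmult_le_compat_l; auto. unfold weight. rewrite succ_pow_0, Rmult_1_l.
    rewrite Rpower_O, Rmult_1_l by (apply Rdiv_lt_0_compat; apply lt_0_INR; lia).
    rewrite Re_minus, Re_1. now apply succ_pow_far_le.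
Qed.

Lemma asymp_far_inv w : nonpole w -> asymp (fun N n => / far_poch w N n) (1 - w) (fun _ => / RGamma w) 0 0.
Proof.
  intros Hw. split.
  - intros n. eapply cvgC_ext; [|apply (cvgC_inv _ _ (RGamma_neq0 w Hw) (far_cvg w n))].
    intros N. cbv beta. replace (1 - w) with (- (w - 1)) by ring. rewrite cpow_opp. unfold far_poch.
    field. repeat split; auto using cpow_neq0, nC_fact_neq0, poch_neq0.
  - destruct (poch_fact_lower w Hw) as [M [HM0 HM]].
    exists (M * Rpower 3 (Rabs (1 - Re w)))%R, 0%nat. split.
    + apply Rmult_le_pos; auto. left; apply Rpower_pos.
    + intros N n _ Hn. eapply Rle_trans; [apply HM|]. rewrite Rmult_assoc.
      apply Rmult_le_compat_l; auto. unfold weight. rewrite succ_pow_0, Rmult_1_l.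
      rewrite Rpower_O, Rmult_1_l by (apply Rdiv_lt_0_compat; apply lt_0_INR; lia).
      rewrite Re_minus, Re_1. now apply succ_pow_far_le.
Qed.

Lemma asymp_poch w : asymp (fun _ n => poch w n / nC (fact n)) 0 (fun n => poch w n / nC (fact n)) (Re w - 1) 0.
Proof. apply (asymp_const (fun n => poch w n / nC (fact n))), poch_fact_upper. Qed.

Lemma asymp_poch_inv w : nonpole w ->
  asymp (fun _ n => / (poch w n / nC (fact n))) 0 (fun n => / (poch w n / nC (fact n))) (1 - Re w) 0.
Proof. intros H. apply (asymp_const (fun n => / (poch w n / nC (fact n)))), poch_fact_lower, H. Qed.

(** The exponent Re w - 1 of 1 - n/N can be negative: this is the blow-up near n = N that the zeros
    of the cutoff compensate. *)
Lemma asymp_near w :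
  asymp (near_poch w) (w - 1) (fun n => poch (1 - w) n / nC (fact n) * RGamma w) (- Re w) (Re w - 1).
Proof.
  eapply asymp_ext; [| | | | |apply (asymp_mult _ _ _ _ _ _ _ _ _ _ (asymp_poch (1 - w)) (asymp_sub w))];
    try reflexivity; try ring; rewrite ?Re_minus, ?Re_1; ring.
Qed.

Lemma asymp_near_inv w : nonpole w -> nonpole (1 - w) ->
  asymp (fun N n => / near_poch w N n) (1 - w) (fun n => / (poch (1 - w) n / nC (fact n) * RGamma w)) (Re w) (1 - Re w).
Proof.
  intros H1 H2.
  eapply asymp_ext; [| | | | |apply (asymp_mult _ _ _ _ _ _ _ _ _ _ (asymp_poch_inv (1 - w) H2) (asymp_sub_inv w H1))].
  - intros N n _. unfold near_poch. field. repeat split; auto using nC_fact_neq0, poch_neq0.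
  - intros n. cbv beta. field. repeat split; auto using nC_fact_neq0, poch_neq0, RGamma_neq0.
  - ring.
  - rewrite Re_minus, Re_1; ring.
  - ring.
Qed.

(** At one of its own roots a progression contributes a derivative in which one factor is missing;
    relative to the full factorials this leaves N-n. *)
Lemma asymp_gap : asymp (fun N n => nC (N - n)) 1 (fun _ => 1) 0 1.
Proof.
  split.
  - intros n. apply (cvgC_ext_loc (fun N => cpow (INR N + - INR n) 1 / cpow (INR N + 0) 1) _ _ (S n)).
    + intros N HN. rewrite Rplus_0_r. f_equal. replace (INR N + - INR n)%R with (INR (N - n)) by (rewrite minus_INR by lia; ring).
      rewrite cpow_1; [reflexivity|]. apply lt_0_INR; lia.
    + apply cvgC_cpow_shift.
  - exists 1%R, 0%nat. split; [lra|]. intros N n _ Hn. rewrite Cmod_nC, Re_1. unfold weight.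
    rewrite succ_pow_0, 2!Rpower_1; [right; field; apply not_0_INR; lia| |].
    + apply lt_0_INR; lia.
    + apply Rdiv_lt_0_compat; apply lt_0_INR; lia.
Qed.

(** The condition [0 <= b] removes the factor (1-n/N)^b from the majorant, and [a < -1] makes
    (n+1)^a summable. *)
Lemma asymp_tannery F z f a b : asymp F z f a b -> (a < -1)%R -> (0 <= b)%R ->
  (exists M, forall k, (Cmod (f k) <= M * succ_pow k a)%R) /\
  exists l, cvgC (csum f) l /\ cvgC (fun N => csum (fun n => F N n / cpow (INR N) z) N) l.
Proof.
  intros [H1 [M [N0 [HM0 HM]]]] Ha Hb.
  assert (S : summable (fun k => M * succ_pow k a)%R).
  { apply summable_scal; auto. replace a with (- 1 - (- 1 - a))%R by ring.
    apply summable_succ_pow. lra. }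
  destruct (tannery_gen (fun N n => F N n / cpow (INR N) z) f (fun k => M * succ_pow k a)%R (fun N => N) N0)
    as [H2 H3]; auto using to_inf_id.
  - intros N n HN Hn. rewrite Cmod_div, Cmod_cpow by apply cpow_neq0.
    apply Rle_div_l; [apply Rpower_pos|]. eapply Rle_trans; [apply HM; auto|].
    unfold weight. rewrite Rmult_assoc. apply Rmult_le_compat_l; auto.
    apply Rmult_le_compat_l; [left; apply succ_pow_pos|].
    rewrite <- (Rmult_1_l (Rpower (INR N) (Re z))) at 2.
    apply Rmult_le_compat_r; [left; apply Rpower_pos|].
    assert (P : (0 < INR N)%R) by (apply lt_0_INR; lia).
    assert (Q : (0 < INR (N - n))%R) by (apply lt_0_INR; lia).
    assert (Q2 : (INR (N - n) <= INR N)%R) by (apply le_INR; lia).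
    unfold Rpower. rewrite <- exp_0.
    assert (L : (ln (INR (N - n) / INR N) <= 0)%R).
    { rewrite <- ln_1. apply ln_le; [apply Rdiv_lt_0_compat; auto|]. apply Rle_div_l; lra. }
    assert (B : (b * ln (INR (N - n) / INR N) <= 0)%R) by nra.
    destruct (Rle_lt_or_eq_dec _ _ B) as [X|X]; [left; now apply exp_increasing | rewrite X; lra].
  - split; eauto.
Qed.

Lemma asymp_bounded (F : nat -> nat -> C) f N0 M : (forall n, cvgC (fun N => F N n) (f n)) ->
  (forall N n, (N0 <= N)%nat -> (n < N)%nat -> (Cmod (F N n) <= M)%R) -> asymp F 0 f 0 0.
Proof.
  intros H1 H2. split.
  - intros n. eapply cvgC_ext; [|apply H1]. intros N. rewrite cpow_0. field.
  - exists (Rabs M), N0. split; [apply Rabs_pos|]. intros N n HN Hn.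
    rewrite Re_0, weight_const, succ_pow_0, Rmult_1_r by auto. eapply Rle_trans; [apply H2; auto | apply Rle_abs].
Qed.

Lemma asymp_pow F z f a b e : asymp F z f a b ->
  asymp (fun N n => F N n ^ e) (nC e * z) (fun n => f n ^ e) (INR e * a) (INR e * b).
Proof.
  intros H. induction e as [|e IH].
  - eapply asymp_ext; [| | | | |apply asymp_one]; try reflexivity; simpl; try ring. rewrite nC_0; ring.
  - eapply asymp_ext; [| | | | |apply (asymp_mult _ _ _ _ _ _ _ _ _ _ H IH)]; try reflexivity;
      rewrite ?S_INR, ?nC_S; ring.
Qed.

(** * Polynomials with roots in arithmetic progression *)

Definition sgn1 (n : nat) : C := RtoC ((-1) ^ n).

Lemma sgn1_0 : sgn1 0 = 1. Proof. reflexivity. Qed.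
Lemma sgn1_S n : sgn1 (S n) = - sgn1 n.
Proof. unfold sgn1. simpl. rewrite <- RtoC_opp. f_equal. ring. Qed.
Lemma sgn1_add n k : sgn1 (n + k) = sgn1 n * sgn1 k.
Proof. unfold sgn1. now rewrite pow_add, RtoC_mult. Qed.
Lemma sgn1_sq n : sgn1 n * sgn1 n = 1.
Proof.
  induction n as [|n IH]; [rewrite sgn1_0; ring|]. rewrite sgn1_S.
  replace (- sgn1 n * - sgn1 n) with (sgn1 n * sgn1 n) by ring. exact IH.
Qed.
Lemma sgn1_neq0 n : sgn1 n <> 0.
Proof. intros E. apply C1_nz. rewrite <- (sgn1_sq n), E. ring. Qed.
Lemma sgn1_sub n k : (k <= n)%nat -> sgn1 (n - k) = sgn1 (n + k).
Proof.
  intros H. replace (n + k)%nat with ((n - k) + (k + k))%nat by lia.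
  rewrite !sgn1_add, sgn1_sq. ring.
Qed.

(** Truncated reciprocal Gamma functions up to sign and normalisation: [roots_up (1 - x) N] stands
    for 1/Gamma(1-x-s), and [roots_down (- v) N] for 1/Gamma(v+s). *)
Definition roots_up (x : C) (N : nat) : list C := map (fun i => x + nC i) (seq 0 N).
Definition roots_down (w : C) (N : nat) : list C := map (fun i => w - nC i) (seq 0 N).

Lemma cprod_scal (c : C) (f : nat -> C) n : cprod (fun i => c * f i) n = c ^ n * cprod f n.
Proof. unfold cprod. now rewrite prodC_scal, length_seq. Qed.

Lemma Cpow_m1 n : (- (1)) ^ n = sgn1 n.
Proof. unfold sgn1. rewrite RtoC_pow. f_equal. rewrite <- RtoC_opp. reflexivity. Qed.

Lemma root_prod_roots_up x N s : root_prod (roots_up x N) s = sgn1 N * poch (x - s) N.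
Proof.
  unfold root_prod, roots_up. rewrite map_map. rewrite poch_cprod, <- Cpow_m1, <- cprod_scal.
  apply cprod_ext. intros i _. ring.
Qed.

Lemma root_prod_roots_down w N s : root_prod (roots_down w N) s = poch (s - w) N.
Proof. unfold root_prod, roots_down. rewrite map_map. apply cprod_ext. intros i _. ring. Qed.

Lemma poch_neg w n : poch (w - nC n) n = sgn1 n * poch (1 - w) n.
Proof.
  induction n as [|n IH]; [rewrite !poch_0, sgn1_0; ring|].
  rewrite poch_S_l, nC_S. replace (w - (nC n + 1) + 1) with (w - nC n) by ring.
  rewrite IH, poch_S, sgn1_S. ring.
Qed.

Lemma poch_sub w n N : (n <= N)%nat ->
  poch (w - nC n) N = sgn1 n * poch (1 - w) n * poch w (N - n).
Proof.
  intros H. replace N with (n + (N - n))%nat at 1 by lia. rewrite poch_add, poch_neg.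
  replace (w - nC n + nC n) with w by ring. reflexivity.
Qed.

Lemma poch_refl z m : poch z m = sgn1 m * poch (1 - nC m - z) m.
Proof.
  assert (A := poch_neg (1 - z) m). replace (1 - (1 - z)) with z in A by ring.
  replace (1 - nC m - z) with (1 - z - nC m) by ring. rewrite A, Cmult_assoc, sgn1_sq. ring.
Qed.

(** The factorials split off from the near and far values. They occur equally often in numerator and
    denominator of the integrand, hence leave every residue. *)
Definition fact_near (N n : nat) : C := nC (fact n) * nC (fact (N - n)).
Definition fact_far (N n : nat) : C := nC (fact (N + n)).
Lemma fact_near_neq0 N n : fact_near N n <> 0.
Proof. apply Cmult_neq_0; apply nC_fact_neq0. Qed.
Lemma fact_far_neq0 N n : fact_far N n <> 0.
Proof. apply nC_fact_neq0. Qed.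

Definition poch_over_fact (w : C) (n : nat) : C := poch w n / nC (fact n).
Lemma poch_over_fact_neq0 w n : nonpole w -> poch_over_fact w n <> 0.
Proof. intros H. unfold poch_over_fact, Cdiv. apply Cmult_neq_0; auto using poch_neq0, Cinv_neq0, nC_fact_neq0. Qed.
Lemma near_neq0 w N n : nonpole w -> nonpole (1 - w) -> near_poch w N n <> 0.
Proof. intros H1 H2. unfold near_poch. apply Cmult_neq_0; now apply poch_over_fact_neq0. Qed.
Lemma far_neq0 w N n : nonpole w -> far_poch w N n <> 0.
Proof. intros H. now apply poch_over_fact_neq0. Qed.

Lemma near_fact_near w N n : (n <= N)%nat -> poch (w - nC n) N = sgn1 n * fact_near N n * near_poch w N n.
Proof.
  intros H. rewrite poch_sub by auto. unfold fact_near, near_poch. field. split; apply nC_fact_neq0.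
Qed.

Lemma far_fact_far w N n : nonpole w -> poch (w + nC n) N = fact_far N n * far_poch w N n * / (poch_over_fact w n * nC (fact n)).
Proof.
  intros H. assert (P := poch_neq0 w n H). assert (Q := nC_fact_neq0 n).
  unfold fact_far, far_poch, poch_over_fact. rewrite (Nat.add_comm N n), poch_add. field. auto using nC_fact_neq0.
Qed.

Lemma roots_up_right z s0 N n : (n <= N)%nat ->
  root_prod (roots_up z N) (s0 + nC n) = sgn1 (N + n) * fact_near N n * near_poch (z - s0) N n.
Proof.
  intros H. rewrite root_prod_roots_up. replace (z - (s0 + nC n)) with (z - s0 - nC n) by ring.
  rewrite near_fact_near, sgn1_add by auto. ring.
Qed.

Lemma roots_down_right w s0 N n : nonpole (s0 - w) ->
  root_prod (roots_down w N) (s0 + nC n) = fact_far N n * far_poch (s0 - w) N n * / (poch_over_fact (s0 - w) n * nC (fact n)).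
Proof.
  intros H. rewrite root_prod_roots_down. replace (s0 + nC n - w) with (s0 - w + nC n) by ring. now apply far_fact_far.
Qed.

Lemma roots_down_left w s0 N n : (n <= N)%nat ->
  root_prod (roots_down w N) (s0 - nC n) = sgn1 n * fact_near N n * near_poch (s0 - w) N n.
Proof.
  intros H. rewrite root_prod_roots_down. replace (s0 - nC n - w) with (s0 - w - nC n) by ring. now apply near_fact_near.
Qed.

Lemma roots_up_left z s0 N n : nonpole (z - s0) ->
  root_prod (roots_up z N) (s0 - nC n) = sgn1 N * fact_far N n * far_poch (z - s0) N n * / (poch_over_fact (z - s0) n * nC (fact n)).
Proof.
  intros H. rewrite root_prod_roots_up. replace (z - (s0 - nC n)) with (z - s0 + nC n) by ring.
  rewrite far_fact_far by auto. ring.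
Qed.

Lemma seq_map_add a k : seq a k = map (fun i => a + i)%nat (seq 0 k).
Proof.
  revert a. induction k as [|k IH]; intros a; [reflexivity|]. simpl. f_equal; [lia|].
  rewrite (IH (S a)), <- seq_shift, map_map. apply map_ext. intros; lia.
Qed.

Lemma roots_up_split x N n : (n < N)%nat ->
  roots_up x N = roots_up x n ++ (x + nC n) :: roots_up (x + nC (S n)) (N - n - 1).
Proof.
  intros H. unfold roots_up. replace N with (n + S (N - n - 1))%nat at 1 by lia.
  rewrite seq_app, map_app. f_equal. rewrite Nat.add_0_l. simpl. f_equal.
  rewrite (seq_map_add (S n)), map_map. apply map_ext. intros i. rewrite nC_add. ring.
Qed.

Lemma roots_down_split w N n : (n < N)%nat ->
  roots_down w N = roots_down w n ++ (w - nC n) :: roots_down (w - nC (S n)) (N - n - 1).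
Proof.
  intros H. unfold roots_down. replace N with (n + S (N - n - 1))%nat at 1 by lia.
  rewrite seq_app, map_app. f_equal. rewrite Nat.add_0_l. simpl. f_equal.
  rewrite (seq_map_add (S n)), map_map. apply map_ext. intros i. rewrite nC_add. ring.
Qed.

Lemma root_prod1_at_split l1 x l2 : root_prod1 (l1 ++ x :: l2) x = root_prod l1 x * root_prod l2 x.
Proof. rewrite root_prod1_app, root_prod_cons. cbn [root_prod1]. ring. Qed.

Lemma fact_near_own N n : (n < N)%nat -> nC (fact n) * nC (fact (N - n - 1)) = fact_near N n / nC (N - n).
Proof.
  intros H. unfold fact_near. assert (Hz : nC (N - n) <> 0) by (apply nC_neq0; lia).
  replace (fact (N - n)) with (fact (S (N - n - 1))) by (f_equal; lia). rewrite nC_fact_S.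
  replace (S (N - n - 1)) with (N - n)%nat by lia. field. auto.
Qed.

Lemma poch_neg_own n : poch (0 - nC n) n = sgn1 n * nC (fact n).
Proof. rewrite poch_neg. replace (1 - 0) with (RtoC 1) by ring. now rewrite poch_1. Qed.

Lemma root_prod1_roots_up_own x N n : (n < N)%nat ->
  root_prod1 (roots_up x N) (x + nC n) = - sgn1 (N + n) * (fact_near N n / nC (N - n)).
Proof.
  intros H. rewrite (roots_up_split x N n H), root_prod1_at_split, 2!root_prod_roots_up, <- fact_near_own by auto.
  replace (x - (x + nC n)) with (0 - nC n) by ring. rewrite poch_neg_own.
  replace (x + nC (S n) - (x + nC n)) with (RtoC 1) by (rewrite nC_S; ring). rewrite poch_1.
  replace (sgn1 n * (sgn1 n * nC (fact n))) with (sgn1 n * sgn1 n * nC (fact n)) by ring. rewrite sgn1_sq.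
  replace (sgn1 (N - n - 1)) with (- sgn1 (N + n)).
  - ring.
  - rewrite <- sgn1_sub by lia. replace (N - n)%nat with (S (N - n - 1)) at 1 by lia. rewrite sgn1_S. ring.
Qed.

Lemma root_prod1_roots_down_own w N n : (n < N)%nat ->
  root_prod1 (roots_down w N) (w - nC n) = sgn1 n * (fact_near N n / nC (N - n)).
Proof.
  intros H. rewrite (roots_down_split w N n H), root_prod1_at_split, 2!root_prod_roots_down, <- fact_near_own by auto.
  replace (w - nC n - w) with (0 - nC n) by ring. rewrite poch_neg_own.
  replace (w - nC n - (w - nC (S n))) with (RtoC 1) by (rewrite nC_S; ring). rewrite poch_1. ring.
Qed.

Lemma in_roots_up x N n : (n < N)%nat -> In (x + nC n) (roots_up x N).
Proof. intros H. unfold roots_up. apply (in_map (fun i => x + nC i)). apply in_seq. lia. Qed.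
Lemma in_roots_down x N n : (n < N)%nat -> In (x - nC n) (roots_down x N).
Proof. intros H. unfold roots_down. apply (in_map (fun i => x - nC i)). apply in_seq. lia. Qed.

Lemma root_prod_flat_map (g : C -> list C) Y s : root_prod (flat_map g Y) s = prodC (map (fun y => root_prod (g y) s) Y).
Proof.
  induction Y as [|y Y IH]; [reflexivity|]. simpl. rewrite root_prod_app, IH. reflexivity.
Qed.

(** * The truncated integrand *)

(* The far poles lie on the imaginary axis so that, for large [N], they avoid all other poles,
   whose imaginary parts do not depend on [N]. *)
Definition edge_zeros (N e : nat) : list C := repeat (nC N) e ++ repeat (- nC N) e.
Definition far_pole (N l : nat) : C := nC N * (Ci * nC (S l)).
Definition far_poles (N L : nat) : list C := map (far_pole N) (seq 0 L).

Lemma root_prod_repeat r e s : root_prod (repeat r e) s = (s - r) ^ e.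
Proof. induction e as [|e IH]; [reflexivity|]. simpl repeat. rewrite root_prod_cons, IH. reflexivity. Qed.

(** Normalised to the value 1 at s = 0, so that it tends to 1 at each fixed s and leaves the
    limiting residues unchanged. *)
Definition cutoff (e L N : nat) (s : C) : C :=
  root_prod (edge_zeros N e) s / root_prod (edge_zeros N e) 0 * (root_prod (far_poles N L) 0 / root_prod (far_poles N L) s).

Lemma Ci_nC_neq0 l : Ci * nC (S l) <> 0.
Proof. apply Cmult_neq_0; [|apply nC_S_neq0]. intros E. injection E. lra. Qed.

Lemma far_pole_neq0 N l : (0 < N)%nat -> far_pole N l <> 0.
Proof. intros H. apply Cmult_neq_0; [now apply nC_neq0 | apply Ci_nC_neq0]. Qed.

Lemma root_prod_edge_zeros N e s : root_prod (edge_zeros N e) s = ((s - nC N) * (s + nC N)) ^ e.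
Proof.
  unfold edge_zeros. rewrite root_prod_app, 2!root_prod_repeat, Cpow_mult_l. do 2 f_equal. ring.
Qed.

Lemma Cpow_div (a b : C) n : b <> 0 -> (a / b) ^ n = a ^ n / b ^ n.
Proof. intros H. unfold Cdiv. rewrite Cpow_mult_l, Cpow_inv; auto. Qed.

Lemma cutoff_eq e L N s : (0 < N)%nat -> (forall l, (l < L)%nat -> s <> far_pole N l) ->
  cutoff e L N s = (1 - s / nC N) ^ e * (1 + s / nC N) ^ e *
    prodC (map (fun l => / (1 - s / far_pole N l)) (seq 0 L)).
Proof.
  intros HN Hs. assert (HN' := nC_neq0 N HN). unfold cutoff. rewrite 2!root_prod_edge_zeros. f_equal.
  - rewrite <- Cpow_div, <- Cpow_mult_l.
    + f_equal. field. auto.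
    + replace ((0 - nC N) * (0 + nC N)) with (- (nC N * nC N)) by ring.
      intros E. apply (Cmult_neq_0 _ _ HN' HN'). replace (nC N * nC N) with (- - (nC N * nC N)) by ring.
      rewrite E. ring.
  - unfold root_prod, far_poles. rewrite !map_map.
    unfold Cdiv at 1. rewrite <- prodC_inv, <- prodC_mult.
    + apply prodC_ext_in. intros l Hl. apply in_seq in Hl.
      assert (A := far_pole_neq0 N l HN). assert (B := Csub_neq0 _ _ (Hs l ltac:(lia))).
      field. repeat split; auto.
      replace (far_pole N l - s) with (- (s - far_pole N l)) by ring. intros E. apply B.
      replace (s - far_pole N l) with (- - (s - far_pole N l)) by ring. rewrite E. ring.
    + intros l Hl. apply in_seq in Hl. apply Csub_neq0, Hs; lia.
Qed.

Lemma lin_cvg (t K : C) n : K <> 0 -> cvgC (fun N => 1 - (t + nC n) / (nC N * K)) 1.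
Proof.
  intros HK. apply (cvgC_lim_eq _ (1 - (t + nC n) / K * 0)); [|ring].
  apply (cvgC_ext_loc (fun N => 1 - (t + nC n) / K * RtoC (1 / INR N)) _ _ 1).
  - intros N HN. unfold Rdiv. rewrite Rmult_1_l, RtoC_inv by (apply not_0_INR; lia).
    change (RtoC (INR N)) with (nC N). assert (A := nC_neq0 N ltac:(lia)). field. auto.
  - apply cvgC_minus; [apply cvgC_const|]. apply cvgC_mult; [apply cvgC_const|].
    apply cvgC_RtoC, is_lim_seq_div_INR.
Qed.

(** Since N-n >= 1, the modulus of N-n-t is at most (1 + |t|)(N-n): each zero at the edge
    contributes exactly one power of 1 - n/N. *)
Lemma asymp_zero_near t : asymp (fun N n => 1 - (t + nC n) / nC N) 0 (fun _ => 1) 0 1.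
Proof.
  split.
  - intros n. eapply cvgC_ext; [|apply (lin_cvg t 1 n C1_nz)]. intros N. cbv beta.
    rewrite cpow_0, Cmult_1_r. generalize (1 - (t + nC n) / nC N). intros x. field.
  - exists (1 + Cmod t)%R, 1%nat. assert (Ht := Cmod_ge_0 t). split; [lra|].
    intros N n HN Hn. assert (A := nC_neq0 N ltac:(lia)).
    assert (P : (0 < INR N)%R) by (apply lt_0_INR; lia).
    assert (Q : (1 <= INR (N - n))%R) by (apply (le_INR 1); lia).
    replace (1 - (t + nC n) / nC N) with ((nC (N - n) - t) / nC N) by (rewrite nC_sub by lia; field; auto).
    rewrite Cmod_div, Cmod_nC by auto. unfold weight. rewrite succ_pow_0, Re_0, (Rpower_O (INR N)) by auto.
    rewrite Rpower_1 by (apply Rdiv_lt_0_compat; lra).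
    assert (T := Cmod_triangle (nC (N - n)) (- t)). rewrite Cmod_opp, Cmod_nC in T.
    replace ((1 + Cmod t) * (1 * (INR (N - n) / INR N * 1)))%R with ((1 + Cmod t) * INR (N - n) / INR N)%R by (field; lra).
    apply Rmult_le_compat_r; [left; now apply Rinv_0_lt_compat|]. unfold Cminus. nra.
Qed.

Lemma asymp_zero_far t : asymp (fun N n => 1 + (t + nC n) / nC N) 0 (fun _ => 1) 0 0.
Proof.
  apply asymp_bounded with (N0 := 1%nat) (M := (2 + Cmod t)%R).
  - intros n. apply (cvgC_ext_loc (fun N => 1 - (t + nC n) / (nC N * - (1))) _ _ 1).
    + intros N HN. assert (A := nC_neq0 N ltac:(lia)). field. auto.
    + apply lin_cvg. intros E. apply C1_nz. replace (RtoC 1) with (- - (1)) by ring. rewrite E. ring.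
  - intros N n HN Hn. assert (A := nC_neq0 N ltac:(lia)).
    assert (P : (1 <= INR N)%R) by (apply (le_INR 1); lia).
    assert (Q : (INR n <= INR N)%R) by (apply le_INR; lia).
    eapply Rle_trans; [apply Cmod_triangle|]. rewrite Cmod_1, Cmod_div, Cmod_nC by auto.
    assert (T := Cmod_triangle t (nC n)). rewrite Cmod_nC in T. assert (Ht := Cmod_ge_0 t).
    assert (U : (Cmod (t + nC n) / INR N <= 1 + Cmod t)%R) by (apply Rle_div_l; nra). lra.
Qed.

(** For purely imaginary K the quotient n/(N K) has real part 0, so the real part of the denominator
    is at least 1/2 for every n once N > 2|t| + 1. *)
Lemma asymp_farpole t K : Re K = 0%R -> (1 <= Cmod K)%R ->
  asymp (fun N n => / (1 - (t + nC n) / (nC N * K))) 0 (fun _ => 1) 0 0.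
Proof.
  intros HK0 HK1. assert (HK : K <> 0) by (apply Cmod_gt_0; lra).
  destruct (INR_unbounded (2 * Cmod t + 1)) as [N0 HN0].
  apply asymp_bounded with (N0 := N0) (M := 2%R).
  - intros n. apply (cvgC_lim_eq _ (/ 1)); [|field]. apply cvgC_inv; [apply C1_nz | now apply lin_cvg].
  - intros N n HN Hn. assert (A := nC_neq0 N ltac:(lia)).
    assert (Ht := Cmod_ge_0 t).
    assert (P : (2 * Cmod t + 1 < INR N)%R) by (apply le_INR in HN; lra).
    assert (R1 : Re (nC n / (nC N * K)) = 0%R).
    { replace (nC n / (nC N * K)) with (RtoC (INR n / INR N) * / K).
      - destruct K as [k1 k2]. unfold Re in *; simpl in *. subst. unfold Rdiv. ring.
      - unfold nC, Rdiv. rewrite RtoC_mult, RtoC_inv by (apply not_0_INR; lia).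
        change (RtoC (INR N)) with (nC N). field. auto. }
    assert (R2 : (Rabs (Re (t / (nC N * K))) <= 1 / 2)%R).
    { eapply Rle_trans; [apply re_le_Cmod|].
      rewrite Cmod_div, Cmod_mult, Cmod_nC by (apply Cmult_neq_0; auto).
      apply Rle_div_l; nra. }
    assert (R3 : (1 / 2 <= Cmod (1 - (t + nC n) / (nC N * K)))%R).
    { eapply Rle_trans; [|apply re_le_Cmod]. eapply Rle_trans; [|apply Rle_abs].
      replace (1 - (t + nC n) / (nC N * K)) with (1 - t / (nC N * K) - nC n / (nC N * K)) by (unfold Cdiv; ring).
      rewrite 2!Re_minus, R1, Re_1. apply Rabs_le_between in R2. lra. }
    rewrite Cmod_inv by (apply Cmod_gt_0; lra).
    replace 2%R with (/ (1 / 2))%R by field. apply Rinv_le_contravar; lra.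
Qed.

Lemma Re_sumC0 {T} (l : list T) : fold_right Rplus 0%R (map (fun _ => 0%R) l) = 0%R.
Proof. induction l as [|x l IH]; simpl; [ring | rewrite IH; ring]. Qed.

Lemma sumC_zero {T} (l : list T) : sumC (map (fun _ => RtoC 0) l) = 0.
Proof. induction l as [|x l IH]; [reflexivity|]. cbn [map]. rewrite sumC_cons, IH. ring. Qed.

Lemma prodC_one {T} (l : list T) : prodC (map (fun _ => RtoC 1) l) = 1.
Proof. induction l as [|x l IH]; [reflexivity|]. cbn [map]. rewrite prodC_cons, IH. ring. Qed.

Lemma Cpow_one n : (RtoC 1) ^ n = 1. Proof. apply Cpow_1_l. Qed.

Lemma far_pole_Im N l : Im (far_pole N l) = (INR N * INR (S l))%R.
Proof. unfold far_pole, nC, Ci, RtoC, Cmult, Im. cbn [fst snd]. ring. Qed.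

Definition im_below (N : nat) (s : C) : Prop := (Rabs (Im s) < INR N)%R.

Lemma im_below_neq N s l : (0 < N)%nat -> im_below N s -> s <> far_pole N l.
Proof.
  intros HN H E. unfold im_below in H. rewrite E, far_pole_Im in H.
  assert (P : (1 <= INR N)%R) by (apply (le_INR 1); lia).
  assert (Q : (1 <= INR (S l))%R) by (apply (le_INR 1); lia).
  rewrite Rabs_pos_eq in H by nra. nra.
Qed.

Lemma im_below_shift N s r : Im r = 0%R -> im_below N s -> im_below N (s + r).
Proof. intros H. unfold im_below. replace (Im (s + r)) with (Im s + Im r)%R by reflexivity. now rewrite H, Rplus_0_r. Qed.

Lemma im_below_ev s : exists N0, forall N, (N0 <= N)%nat -> im_below N s.
Proof.
  destruct (INR_unbounded (Rabs (Im s))) as [N0 H]. exists N0. intros N HN.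
  apply le_INR in HN. unfold im_below. lra.
Qed.

Lemma Im_nC n : Im (nC n) = 0%R. Proof. reflexivity. Qed.

Lemma asymp_ext_ev (F G : nat -> nat -> C) z f a b N1 :
  (forall N n, (N1 <= N)%nat -> (n < N)%nat -> F N n = G N n) -> asymp F z f a b -> asymp G z f a b.
Proof.
  intros E [H1 [M [N0 [HM0 HM]]]]. split.
  - intros n. apply (cvgC_ext_loc (fun N => F N n / cpow (INR N) z) _ _ (Nat.max N1 (S n))); auto.
    intros N HN. now rewrite E by lia.
  - exists M, (Nat.max N0 N1). split; auto. intros N n HN Hn. rewrite <- E by lia. apply HM; lia.
Qed.

Lemma asymp_cutoff_right e L s0 : asymp (fun N n => cutoff e L N (s0 + nC n)) 0 (fun _ => 1) 0 (INR e).
Proof.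
  destruct (im_below_ev s0) as [N0 HN0].
  assert (H : asymp (fun N n => (1 - (s0 + nC n) / nC N) ^ e * (1 + (s0 + nC n) / nC N) ^ e *
    prodC (map (fun l => / (1 - (s0 + nC n) / (nC N * (Ci * nC (S l))))) (seq 0 L))) 0 (fun _ => 1) 0 (INR e)).
  { eapply asymp_ext; [| | | | |apply asymp_mult; [apply asymp_mult; [apply (asymp_pow _ _ _ _ _ e (asymp_zero_near s0)) |
      apply (asymp_pow _ _ _ _ _ e (asymp_zero_far s0))] |
      apply (asymp_prod (seq 0 L) (fun l N n => / (1 - (s0 + nC n) / (nC N * (Ci * nC (S l)))))
        (fun _ => RtoC 0) (fun _ _ => RtoC 1) (fun _ => 0%R) (fun _ => 0%R))]].
    - reflexivity.
    - intros n. cbv beta. rewrite prodC_one, !Cpow_one. ring.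
    - rewrite sumC_zero. ring.
    - rewrite Re_sumC0. ring.
    - rewrite Re_sumC0. ring.
    - intros l _. apply asymp_farpole.
      + unfold Ci, nC, RtoC, Cmult, Re; simpl. ring.
      + rewrite Cmod_mult, Cmod_Ci, Cmod_nC. rewrite S_INR. assert (T := pos_INR l). lra. }
  eapply (asymp_ext_ev _ _ _ _ _ _ (Nat.max 1 N0)); [|exact H].
  intros N n HN Hn. symmetry. apply cutoff_eq; [lia|]. intros l Hl. apply im_below_neq; [lia|].
  apply im_below_shift; [apply Im_nC | apply HN0; lia].
Qed.

(** The substitution s -> -s exchanges the zeros N and -N and reflects the cutoff poles in the
    origin; the direction K becomes -K and remains imaginary. *)
Lemma asymp_cutoff_left e L s0 : asymp (fun N n => cutoff e L N (s0 - nC n)) 0 (fun _ => 1) 0 (INR e).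
Proof.
  destruct (im_below_ev s0) as [N0 HN0].
  assert (H : asymp (fun N n => (1 - (- s0 + nC n) / nC N) ^ e * (1 + (- s0 + nC n) / nC N) ^ e *
    prodC (map (fun l => / (1 - (- s0 + nC n) / (nC N * - (Ci * nC (S l))))) (seq 0 L))) 0 (fun _ => 1) 0 (INR e)).
  { eapply asymp_ext; [| | | | |apply asymp_mult; [apply asymp_mult; [apply (asymp_pow _ _ _ _ _ e (asymp_zero_near (- s0))) |
      apply (asymp_pow _ _ _ _ _ e (asymp_zero_far (- s0)))] |
      apply (asymp_prod (seq 0 L) (fun l N n => / (1 - (- s0 + nC n) / (nC N * - (Ci * nC (S l)))))
        (fun _ => RtoC 0) (fun _ _ => RtoC 1) (fun _ => 0%R) (fun _ => 0%R))]].
    - reflexivity.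
    - intros n. cbv beta. rewrite prodC_one, !Cpow_one. ring.
    - rewrite sumC_zero. ring.
    - rewrite Re_sumC0. ring.
    - rewrite Re_sumC0. ring.
    - intros l _. apply asymp_farpole.
      + unfold Ci, nC, RtoC, Cmult, Copp, Re; simpl. ring.
      + rewrite Cmod_opp, Cmod_mult, Cmod_Ci, Cmod_nC. rewrite S_INR. assert (T := pos_INR l). lra. }
  eapply (asymp_ext_ev _ _ _ _ _ _ (Nat.max 1 N0)); [|exact H].
  intros N n HN Hn. symmetry. assert (A := nC_neq0 N ltac:(lia)). rewrite cutoff_eq.
  - replace (1 - (s0 - nC n) / nC N) with (1 + (- s0 + nC n) / nC N) by (field; auto).
    replace (1 + (s0 - nC n) / nC N) with (1 - (- s0 + nC n) / nC N) by (field; auto).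
    rewrite (Cmult_comm (_ ^ e)). f_equal. apply prodC_ext_in. intros l _. do 2 f_equal.
    unfold far_pole. assert (B := Ci_nC_neq0 l). 
    replace (nC N * - (Ci * nC (S l))) with (- (nC N * (Ci * nC (S l)))) by ring.
    assert (D : nC N * (Ci * nC (S l)) <> 0) by (apply Cmult_neq_0; auto).
    set (w := nC N * (Ci * nC (S l))) in *. field. auto.
  - lia.
  - intros l Hl. apply im_below_neq; [lia|].
    unfold Cminus. apply im_below_shift; [unfold nC, RtoC, Copp, Im; simpl; ring | apply HN0; lia].
Qed.

(** * Exact residues of the truncated integrand *)

(** The blocks come from (1+s)_m, Gamma(u+s), the factors Gamma(1-y-s) and the cutoff. The double
    poles are kept apart as [roots_up 0 N]. *)
Definition simple_poles (m : nat) (u : C) (Y : list C) (N L : nat) : list C :=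
  roots_down (- (1)) m ++ roots_down (- u) N ++ flat_map (fun y => roots_up (1 - y) N) Y ++ far_poles N L.
Definition numer_roots (v : C) (X : list C) (N e : nat) : list C :=
  roots_down (- v) N ++ flat_map (fun x => roots_up (1 - x) N) X ++ edge_zeros N e.

(** The part common to the residues at s0 + n, used for s0 = 0 and s0 = 1-y. Its counterpart
    [left_core] serves the points s0 - n with s0 = -u and s0 = -1, and includes the squared factor
    of the double-pole list. *)
Definition right_core (v u : C) (X Y : list C) (s0 : C) (N n : nat) : C :=
  far_poch (s0 + v) N n * / far_poch (s0 + u) N n * (poch_over_fact (s0 + u) n * / poch_over_fact (s0 + v) n) *
  prodC (map (fun x => near_poch (1 - x - s0) N n) X) *
  prodC (map (fun y => / near_poch (1 - y - s0) N n) Y).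

Definition left_core (X Y : list C) (s0 : C) (N n : nat) : C :=
  prodC (map (fun x => far_poch (1 - x - s0) N n * / poch_over_fact (1 - x - s0) n) X) *
  prodC (map (fun y => / far_poch (1 - y - s0) N n * poch_over_fact (1 - y - s0) n) Y) *
  ((/ far_poch (- s0) N n * poch_over_fact (- s0) n) * (/ far_poch (- s0) N n * poch_over_fact (- s0) n)).

Definition cutoff_norm (N e L : nat) : C := root_prod (far_poles N L) 0 / root_prod (edge_zeros N e) 0.

Lemma roots_ups_right (X : list C) s0 N n : (n <= N)%nat ->
  prodC (map (fun x => root_prod (roots_up (1 - x) N) (s0 + nC n)) X) =
  (sgn1 (N + n) * fact_near N n) ^ length X * prodC (map (fun x => near_poch (1 - x - s0) N n) X).
Proof.
  intros H. rewrite <- prodC_scal. apply prodC_ext_in. intros x _. now apply roots_up_right.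
Qed.

Lemma roots_ups_left (X : list C) s0 N n : (forall x, In x X -> nonpole (1 - x - s0)) ->
  prodC (map (fun x => root_prod (roots_up (1 - x) N) (s0 - nC n)) X) =
  (sgn1 N * fact_far N n * / nC (fact n)) ^ length X *
  prodC (map (fun x => far_poch (1 - x - s0) N n * / poch_over_fact (1 - x - s0) n) X).
Proof.
  intros H. rewrite <- prodC_scal. apply prodC_ext_in. intros x Hx.
  rewrite roots_up_left by auto. field. split; auto using nC_fact_neq0, poch_over_fact_neq0.
Qed.

Lemma root_prod_numer_roots_right v X N e s0 n : (n <= N)%nat -> nonpole (s0 + v) ->
  root_prod (numer_roots v X N e) (s0 + nC n) =
  fact_far N n * far_poch (s0 + v) N n * / (poch_over_fact (s0 + v) n * nC (fact n)) *
  ((sgn1 (N + n) * fact_near N n) ^ length X * prodC (map (fun x => near_poch (1 - x - s0) N n) X)) *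
  root_prod (edge_zeros N e) (s0 + nC n).
Proof.
  intros Hn Hv. unfold numer_roots. rewrite 2!root_prod_app, root_prod_flat_map, roots_ups_right by auto.
  rewrite roots_down_right; replace (s0 - - v) with (s0 + v) by ring; auto. ring.
Qed.

Lemma root_prod_numer_roots_left v X N e s0 n : (n <= N)%nat -> (forall x, In x X -> nonpole (1 - x - s0)) ->
  root_prod (numer_roots v X N e) (s0 - nC n) =
  sgn1 n * fact_near N n * near_poch (s0 + v) N n *
  ((sgn1 N * fact_far N n * / nC (fact n)) ^ length X *
    prodC (map (fun x => far_poch (1 - x - s0) N n * / poch_over_fact (1 - x - s0) n) X)) *
  root_prod (edge_zeros N e) (s0 - nC n).
Proof.
  intros Hn Hv. unfold numer_roots. rewrite 2!root_prod_app, root_prod_flat_map, roots_ups_left by auto.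
  rewrite roots_down_left by auto. replace (s0 - - v) with (s0 + v) by ring. ring.
Qed.

Lemma inv_prod (f : C -> C) Y : (forall y, In y Y -> f y <> 0) ->
  prodC (map f Y) = / prodC (map (fun y => / f y) Y).
Proof.
  intros H. rewrite prodC_inv by auto. field. now apply prodC_neq0.
Qed.

Lemma inv_prodC_neq0 (f : C -> C) Y : (forall y, In y Y -> f y <> 0) ->
  prodC (map (fun y => / f y) Y) <> 0.
Proof. intros H. apply prodC_neq0. intros y Hy. apply Cinv_neq0; auto. Qed.

Lemma root_prod_edge_zeros0_neq0 N e : (0 < N)%nat -> root_prod (edge_zeros N e) 0 <> 0.
Proof.
  intros H. rewrite root_prod_edge_zeros. apply Cpow_nz. apply nC_neq0 in H.
  replace ((0 - nC N) * (0 + nC N)) with (- (1) * (nC N * nC N)) by ring.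
  repeat apply Cmult_neq_0; auto. intros E. injection E. lra.
Qed.

Lemma root_prod_far_poles_neq0 N L s : (0 < N)%nat -> im_below N s -> root_prod (far_poles N L) s <> 0.
Proof.
  intros HN H. apply root_prod_notin. intros Hin. unfold far_poles in Hin. apply in_map_iff in Hin.
  destruct Hin as [l [E _]]. apply (im_below_neq N s l); auto.
Qed.

Lemma sgn1_fact_near_pow_neq0 N n k : (sgn1 (N + n) * fact_near N n) ^ k <> 0.
Proof. apply Cpow_nz, Cmult_neq_0; [apply sgn1_neq0 | apply fact_near_neq0]. Qed.
Lemma sgn1_fact_far_pow_neq0 N n k : (sgn1 N * fact_far N n * / nC (fact n)) ^ k <> 0.
Proof.
  apply Cpow_nz. repeat apply Cmult_neq_0; auto using sgn1_neq0, fact_far_neq0, Cinv_neq0, nC_fact_neq0.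
Qed.

Lemma cutoff_normal e L N s : root_prod (edge_zeros N e) s / root_prod (far_poles N L) s * cutoff_norm N e L = cutoff e L N s.
Proof. unfold cutoff, cutoff_norm, Cdiv. ring. Qed.

Lemma im_below_nat N n : (0 < N)%nat -> im_below N (nC n).
Proof. intros H. unfold im_below. rewrite Im_nC, Rabs_R0. now apply lt_0_INR. Qed.

(** The |X| near factors above meet |Y| + 2 below, two of them from the squared derivative of
    [roots_up 0 N]; equality of these counts removes all signs and factorials and leaves (N-k)^2. *)
Lemma double_coeff_exact m u v X Y N e L k : (k < N)%nat -> length X = S (S (length Y)) ->
  nonpole v -> nonpole u -> (forall y, In y Y -> notInt y) ->
  root_prod (numer_roots v X N e) (nC k) /
    (root_prod (simple_poles m u Y N L) (nC k) * (root_prod1 (roots_up 0 N) (nC k) * root_prod1 (roots_up 0 N) (nC k))) * cutoff_norm N e L =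
  right_core v u X Y 0 N k * (nC (N - k) * nC (N - k)) * / poch (1 + nC k) m * cutoff e L N (0 + nC k).
Proof.
  intros Hk HXY Hv Hu HY.
  replace (nC k) with (0 + nC k) at 1 2 3 4 by ring.
  rewrite <- cutoff_normal, root_prod1_roots_up_own by auto.
  assert (Hy : forall y, In y Y -> near_poch (1 - y - 0) N k <> 0).
  { intros y Hy. specialize (HY y Hy). replace (1 - y - 0) with (1 - y) by ring.
    apply near_neq0; apply notInt_nonpole; [now apply notInt_1_sub|].
    replace (1 - (1 - y)) with y by ring. auto. }
  rewrite root_prod_numer_roots_right by (rewrite ?Cplus_0_l; auto; lia).
  unfold simple_poles. rewrite 3!root_prod_app, root_prod_flat_map, roots_ups_right by lia.
  rewrite (roots_down_right (- u)) by (replace (0 - - u) with (0 + u) by ring; rewrite Cplus_0_l; auto).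
  rewrite (inv_prod (fun y => near_poch (1 - y - 0) N k) Y Hy), root_prod_roots_down, HXY, 2!Cpow_S.
  unfold right_core. replace (0 - - u) with (0 + u) by ring.
  assert (N1 := inv_prodC_neq0 _ _ Hy).
  set (PX := prodC (map (fun x => near_poch (1 - x - 0) N k) X)).
  set (PY := prodC (map (fun y => / near_poch (1 - y - 0) N k) Y)) in *.
  assert (N2 := sgn1_fact_near_pow_neq0 N k (length Y)). set (W := (sgn1 (N + k) * fact_near N k) ^ length Y) in *.
  assert (N3 : poch_over_fact (0 + u) k <> 0) by (rewrite Cplus_0_l; now apply poch_over_fact_neq0).
  assert (N4 : poch_over_fact (0 + v) k <> 0) by (rewrite Cplus_0_l; now apply poch_over_fact_neq0).
  assert (N5 : far_poch (0 + u) N k <> 0) by (rewrite Cplus_0_l; now apply far_neq0).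
  replace (0 + nC k - - (1)) with (1 + nC k) by ring.
  assert (N6 : poch (1 + nC k) m <> 0).
  { apply poch_neq0. apply (nonpole_add 1 k). apply (nonpole_nC_S 0). }
  assert (N7 : root_prod (far_poles N L) (0 + nC k) <> 0).
  { apply root_prod_far_poles_neq0; [lia|]. rewrite Cplus_0_l. apply im_below_nat; lia. }
  assert (N8 := sgn1_neq0 (N + k)). assert (N9 := fact_near_neq0 N k). assert (N10 := fact_far_neq0 N k).
  assert (N11 := nC_fact_neq0 k). assert (N12 : nC (N - k) <> 0) by (apply nC_neq0; lia).
  field. repeat split; auto.
Qed.

(** The derivative of the progression of y gives the minus sign and N-n; the squared double-pole
    list gives the two inverse factors [near_poch (y - 1)]. *)
Lemma simple_right_exact m u v X Y Y1 y Y2 N e L n : (n < N)%nat -> Y = Y1 ++ y :: Y2 ->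
  length X = S (S (length Y)) -> im_below N (1 - y) ->
  nonpole (1 - y + v) -> nonpole (1 - y + u) -> notInt y ->
  (forall y', In y' (Y1 ++ Y2) -> notInt (y - y')) ->
  simple_residue (simple_poles m u Y N L) (roots_up 0 N) (numer_roots v X N e) (1 - y + nC n) * cutoff_norm N e L =
  - (right_core v u X (Y1 ++ Y2) (1 - y) N n * nC (N - n) * (/ near_poch (y - 1) N n * / near_poch (y - 1) N n) *
     / poch (2 - y + nC n) m * cutoff e L N (1 - y + nC n)).
Proof.
  intros Hn HYeq HXY Hfar Hv Hu Hy HY.
  rewrite <- cutoff_normal. unfold simple_residue.
  assert (Hy' : forall y', In y' (Y1 ++ Y2) -> near_poch (1 - y' - (1 - y)) N n <> 0).
  { intros y' Hi. specialize (HY y' Hi). replace (1 - y' - (1 - y)) with (y - y') by ring.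
    apply near_neq0; apply notInt_nonpole; [auto | now apply notInt_1_sub]. }
  rewrite root_prod_numer_roots_right by (auto; lia).
  assert (HA : simple_poles m u Y N L =
    (roots_down (- (1)) m ++ roots_down (- u) N ++ flat_map (fun y => roots_up (1 - y) N) Y1) ++ roots_up (1 - y) N ++
    (flat_map (fun y => roots_up (1 - y) N) Y2 ++ far_poles N L)).
  { unfold simple_poles. rewrite HYeq, flat_map_app. cbn [flat_map]. now rewrite <- !app_assoc. }
  rewrite HA, root_prod1_mid by (now apply in_roots_up). rewrite root_prod1_roots_up_own by auto.
  rewrite !root_prod_app, !root_prod_flat_map, root_prod_roots_down.
  rewrite (roots_down_right (- u)) by (now replace (1 - y - - u) with (1 - y + u) by ring).
  rewrite (roots_up_right 0) by lia.
  replace (0 - (1 - y)) with (y - 1) by ring. replace (1 - y - - u) with (1 - y + u) by ring.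
  replace (1 - y + nC n - - (1)) with (2 - y + nC n) by ring.
  assert (HP : prodC (map (fun y0 => root_prod (roots_up (1 - y0) N) (1 - y + nC n)) Y1) *
     prodC (map (fun y0 => root_prod (roots_up (1 - y0) N) (1 - y + nC n)) Y2) =
     (sgn1 (N + n) * fact_near N n) ^ length (Y1 ++ Y2) * / prodC (map (fun y0 => / near_poch (1 - y0 - (1 - y)) N n) (Y1 ++ Y2))).
  { rewrite <- prodC_app, <- map_app, roots_ups_right by lia. f_equal.
    now apply (inv_prod (fun y0 => near_poch (1 - y0 - (1 - y)) N n)). }
  assert (HL : length X = S (S (S (length (Y1 ++ Y2))))).
  { rewrite HXY, HYeq, !length_app. simpl. lia. }
  rewrite HL, 3!Cpow_S. unfold right_core.
  set (P1 := prodC (map (fun y0 => root_prod (roots_up (1 - y0) N) (1 - y + nC n)) Y1)) in *.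
  set (P2 := prodC (map (fun y0 => root_prod (roots_up (1 - y0) N) (1 - y + nC n)) Y2)) in *.
  assert (N1 := inv_prodC_neq0 _ _ Hy').
  set (PX := prodC (map (fun x => near_poch (1 - x - (1 - y)) N n) X)) in *.
  set (PY := prodC (map (fun y0 => / near_poch (1 - y0 - (1 - y)) N n) (Y1 ++ Y2))) in *.
  assert (N2 := sgn1_fact_near_pow_neq0 N n (length (Y1 ++ Y2))).
  set (W := (sgn1 (N + n) * fact_near N n) ^ length (Y1 ++ Y2)) in *.
  assert (N3 : poch_over_fact (1 - y + u) n <> 0) by now apply poch_over_fact_neq0.
  assert (N4 : poch_over_fact (1 - y + v) n <> 0) by now apply poch_over_fact_neq0.
  assert (N5 : far_poch (1 - y + u) N n <> 0) by now apply far_neq0.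
  assert (N6 : poch (2 - y + nC n) m <> 0).
  { apply poch_neq0, nonpole_add. apply notInt_nonpole. apply (notInt_nat_sub y 2). auto. }
  assert (N7 : root_prod (far_poles N L) (1 - y + nC n) <> 0).
  { apply root_prod_far_poles_neq0; [lia|]. apply im_below_shift; [apply Im_nC | auto]. }
  assert (N8 := sgn1_neq0 (N + n)). assert (N9 := fact_near_neq0 N n). assert (N10 := fact_far_neq0 N n).
  assert (N11 := nC_fact_neq0 n). assert (N12 : nC (N - n) <> 0) by (apply nC_neq0; lia).
  assert (N13 : near_poch (y - 1) N n <> 0).
  { apply near_neq0; apply notInt_nonpole; [now apply (notInt_sub_nat y 1)|].
    replace (1 - (y - 1)) with (nC 2 - y) by (change (nC 2) with (RtoC 2); ring). now apply notInt_nat_sub. }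
  set (F := root_prod (far_poles N L) (1 - y + nC n)) in *. set (Q := poch (2 - y + nC n) m) in *.
  set (LT := fact_far N n * far_poch (1 - y + u) N n * / (poch_over_fact (1 - y + u) n * nC (fact n))) in *.
  set (OWN := - sgn1 (N + n) * (fact_near N n / nC (N - n))) in *.
  replace (Q * (LT * P1) * OWN * (P2 * F)) with (Q * LT * (P1 * P2) * OWN * F) by ring.
  rewrite HP. unfold LT, OWN. field. repeat split; auto.
Qed.

Lemma root_prod_roots_down1_left s0 m n : root_prod (roots_down (- (1)) m) (s0 - nC n) = sgn1 m * poch (- s0 - nC m + nC n) m.
Proof.
  rewrite root_prod_roots_down, poch_refl. do 2 f_equal. ring.
Qed.

(** Going left from -u, the progressions of X, Y and the double poles are far. The factor (1+s)_m is
    reflected to (u-m+n)_m, at the cost of (-1)^m. *)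
Lemma simple_left_exact m u v X Y N e L n : (n < N)%nat ->
  length X = S (S (length Y)) -> im_below N (- u) -> notInt u ->
  (forall x, In x X -> nonpole (1 - x + u)) -> (forall y, In y Y -> nonpole (1 - y + u)) ->
  simple_residue (simple_poles m u Y N L) (roots_up 0 N) (numer_roots v X N e) (- u - nC n) * cutoff_norm N e L =
  near_poch (- u + v) N n * nC (N - n) * left_core X Y (- u) N n * (sgn1 m * / poch (u - nC m + nC n) m) *
     cutoff e L N (- u - nC n).
Proof.
  intros Hn HXY Hfar Hu HX HY.
  rewrite <- cutoff_normal. unfold simple_residue.
  rewrite root_prod_numer_roots_left by (try lia; intros x Hx; replace (1 - x - - u) with (1 - x + u) by ring; auto).
  unfold simple_poles. rewrite root_prod1_mid by (now apply in_roots_down). rewrite root_prod1_roots_down_own by auto.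
  rewrite root_prod_app, root_prod_flat_map, root_prod_roots_down1_left.
  rewrite roots_ups_left by (intros y Hy; replace (1 - y - - u) with (1 - y + u) by ring; auto).
  rewrite (roots_up_left 0) by (replace (0 - - u) with u by ring; now apply notInt_nonpole).
  replace (0 - - u) with u by ring. replace (- - u) with u by ring.
  rewrite HXY, 2!Cpow_S. unfold left_core. replace (- - u) with u by ring.
  rewrite (prodC_ext_in (fun y => far_poch (1 - y - - u) N n * / poch_over_fact (1 - y - - u) n)
    (fun y => / (/ far_poch (1 - y - - u) N n * poch_over_fact (1 - y - - u) n)) Y).
  2:{ intros y Hy. specialize (HY y Hy). replace (1 - y - - u) with (1 - y + u) by ring.
      field. split; auto using far_neq0, poch_over_fact_neq0. }
  assert (Hy : forall y, In y Y -> / far_poch (1 - y - - u) N n * poch_over_fact (1 - y - - u) n <> 0).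
  { intros y Hi. specialize (HY y Hi). replace (1 - y - - u) with (1 - y + u) by ring.
    apply Cmult_neq_0; auto using far_neq0, poch_over_fact_neq0, Cinv_neq0. }
  rewrite prodC_inv by auto. assert (N1 := prodC_neq0 _ _ Hy).
  set (PX := prodC (map (fun x => far_poch (1 - x - - u) N n * / poch_over_fact (1 - x - - u) n) X)) in *.
  set (PY := prodC (map (fun y => / far_poch (1 - y - - u) N n * poch_over_fact (1 - y - - u) n) Y)) in *.
  assert (N2 := sgn1_fact_far_pow_neq0 N n (length Y)).
  set (W := (sgn1 N * fact_far N n * / nC (fact n)) ^ length Y) in *.
  assert (Hu' := notInt_nonpole u Hu).
  assert (N3 := poch_over_fact_neq0 u n Hu'). assert (N5 := far_neq0 u N n Hu').
  assert (N6 : poch (u - nC m + nC n) m <> 0).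
  { apply poch_neq0, nonpole_add. now apply notInt_nonpole, notInt_sub_nat. }
  assert (N7 : root_prod (far_poles N L) (- u - nC n) <> 0).
  { apply root_prod_far_poles_neq0; [lia|]. apply im_below_shift; [unfold nC, RtoC, Copp, Im; simpl; ring | auto]. }
  assert (N8 := sgn1_neq0 N). assert (N9 := fact_near_neq0 N n). assert (N10 := fact_far_neq0 N n).
  assert (N11 := nC_fact_neq0 n). assert (N12 : nC (N - n) <> 0) by (apply nC_neq0; lia).
  assert (N13 := sgn1_neq0 n). assert (N14 := sgn1_neq0 m). assert (E := sgn1_sq m).
  set (F := root_prod (far_poles N L) (- u - nC n)) in *. set (Q := poch (u - nC m + nC n) m) in *.
  replace (sgn1 m * / Q) with (sgn1 m * sgn1 m * / (sgn1 m * Q)) by (field; auto). rewrite E.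
  field. repeat split; auto.
Qed.

Lemma simple_int_exact m u v X Y N e L j : (j < m)%nat -> (j <= N)%nat -> (0 < N)%nat ->
  length X = S (S (length Y)) -> notInt u ->
  (forall x, In x X -> nonpole (2 - x)) -> (forall y, In y Y -> nonpole (2 - y)) ->
  simple_residue (simple_poles m u Y N L) (roots_up 0 N) (numer_roots v X N e) (- (1) - nC j) * cutoff_norm N e L =
  near_poch (- (1) + v) N j * / near_poch (- (1) + u) N j * left_core X Y (- (1)) N j *
     (sgn1 j * / (nC (fact j) * nC (fact (m - j - 1)))) * cutoff e L N (- (1) - nC j).
Proof.
  intros Hj HjN HN HXY Hu HX HY.
  rewrite <- cutoff_normal. unfold simple_residue.
  rewrite root_prod_numer_roots_left by (try lia; intros x Hx; replace (1 - x - - (1)) with (2 - x) by ring; auto).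
  (* The block of -1, ..., -m is the first one; an empty list in front gives it the shape of
     [root_prod1_mid]. *)
  unfold simple_poles. change (roots_down (- (1)) m ++ ?r) with ([] ++ roots_down (- (1)) m ++ r).
  rewrite root_prod1_mid by (now apply in_roots_down). rewrite root_prod1_roots_down_own, <- fact_near_own by auto.
  rewrite 2!root_prod_app, root_prod_flat_map.
  rewrite (roots_down_left (- u)) by auto. replace (- (1) - - u) with (- (1) + u) by ring.
  rewrite roots_ups_left by (intros y Hy; replace (1 - y - - (1)) with (2 - y) by ring; auto).
  assert (H1 : nonpole 1) by apply (nonpole_nC_S 0).
  rewrite (roots_up_left 0) by (replace (0 - - (1)) with (RtoC 1) by ring; auto).
  replace (0 - - (1)) with (RtoC 1) by ring.
  rewrite HXY, 2!Cpow_S. unfold left_core. replace (- - (1)) with (RtoC 1) by ring.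
  rewrite (prodC_ext_in (fun y => far_poch (1 - y - - (1)) N j * / poch_over_fact (1 - y - - (1)) j)
    (fun y => / (/ far_poch (1 - y - - (1)) N j * poch_over_fact (1 - y - - (1)) j)) Y).
  2:{ intros y Hy. specialize (HY y Hy). replace (1 - y - - (1)) with (2 - y) by ring.
      field. split; auto using far_neq0, poch_over_fact_neq0. }
  assert (Hy : forall y, In y Y -> / far_poch (1 - y - - (1)) N j * poch_over_fact (1 - y - - (1)) j <> 0).
  { intros y Hi. specialize (HY y Hi). replace (1 - y - - (1)) with (2 - y) by ring.
    apply Cmult_neq_0; auto using far_neq0, poch_over_fact_neq0, Cinv_neq0. }
  rewrite prodC_inv by auto. assert (N1 := prodC_neq0 _ _ Hy).
  set (PX := prodC (map (fun x => far_poch (1 - x - - (1)) N j * / poch_over_fact (1 - x - - (1)) j) X)) in *.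
  set (PY := prodC (map (fun y => / far_poch (1 - y - - (1)) N j * poch_over_fact (1 - y - - (1)) j) Y)) in *.
  assert (N2 := sgn1_fact_far_pow_neq0 N j (length Y)).
  set (W := (sgn1 N * fact_far N j * / nC (fact j)) ^ length Y) in *.
  assert (N3 := poch_over_fact_neq0 1 j H1). assert (N5 := far_neq0 1 N j H1).
  assert (N6 : near_poch (- (1) + u) N j <> 0).
  { apply near_neq0; apply notInt_nonpole.
    - replace (- (1) + u) with (u - nC 1) by (change (nC 1) with (RtoC 1); ring). now apply notInt_sub_nat.
    - replace (1 - (- (1) + u)) with (nC 2 - u) by (change (nC 2) with (RtoC 2); ring). now apply notInt_nat_sub. }
  assert (N7 : root_prod (far_poles N L) (- (1) - nC j) <> 0).
  { apply root_prod_far_poles_neq0; [lia|]. unfold im_below.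
    replace (Im (- (1) - nC j)) with 0%R by (unfold nC, RtoC, Copp, Cminus, Cplus, Im; simpl; ring).
    rewrite Rabs_R0. now apply lt_0_INR. }
  assert (N8 := sgn1_neq0 N). assert (N9 := fact_near_neq0 N j). assert (N10 := fact_far_neq0 N j).
  assert (N11 := nC_fact_neq0 j). assert (N12 := nC_fact_neq0 (m - j - 1)).
  assert (N13 := sgn1_neq0 j). assert (E := sgn1_sq j).
  set (F := root_prod (far_poles N L) (- (1) - nC j)) in *.
  replace (sgn1 j * / (nC (fact j) * nC (fact (m - j - 1)))) with
    (sgn1 j * sgn1 j * / (sgn1 j * (nC (fact j) * nC (fact (m - j - 1))))) by (field; auto). rewrite E.
  change (root_prod [] (- (1) - nC j)) with (RtoC 1).
  field. repeat split; auto.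
Qed.

(** * Growth and limits of the residues *)

Lemma Re_sumC {T} (g : T -> C) l : Re (sumC (map g l)) = fold_right Rplus 0%R (map (fun x => Re (g x)) l).
Proof. induction l as [|x l IH]; [reflexivity|]. cbn [map fold_right]. rewrite sumC_cons, Re_plus, IH. reflexivity. Qed.

Lemma asymp_prodC (l : list C) (F : C -> nat -> nat -> C) z f ga gb :
  (forall x, In x l -> asymp (F x) (z x) (f x) (Re (ga x)) (Re (gb x))) ->
  asymp (fun N n => prodC (map (fun x => F x N n) l)) (sumC (map z l))
    (fun n => prodC (map (fun x => f x n) l)) (Re (sumC (map ga l))) (Re (sumC (map gb l))).
Proof. intros H. rewrite 2!Re_sumC. now apply asymp_prod. Qed.

Lemma sumC_affine (c k : C) l : sumC (map (fun x => c + k * x) l) = nC (length l) * c + k * sumC l.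
Proof.
  induction l as [|x l IH]; cbn [map length]; [rewrite nC_0; unfold sumC; simpl; ring|].
  rewrite 2!sumC_cons, IH, nC_S. ring.
Qed.

Lemma sumC_affine_ext (f : C -> C) (c k : C) l : (forall x, f x = c + k * x) ->
  sumC (map f l) = nC (length l) * c + k * sumC l.
Proof. intros H. rewrite <- sumC_affine. apply sumC_ext_in. auto. Qed.

Definition right_core_lim (v u : C) (X Y : list C) (s0 : C) (n : nat) : C :=
  RGamma (s0 + v) * / RGamma (s0 + u) * (poch_over_fact (s0 + u) n * / poch_over_fact (s0 + v) n) *
  prodC (map (fun x => poch_over_fact (x + s0) n * RGamma (1 - x - s0)) X) *
  prodC (map (fun y => / (poch_over_fact (y + s0) n * RGamma (1 - y - s0))) Y).

Definition left_core_lim (X Y : list C) (s0 : C) (n : nat) : C :=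
  prodC (map (fun x => RGamma (1 - x - s0) * / poch_over_fact (1 - x - s0) n) X) *
  prodC (map (fun y => / RGamma (1 - y - s0) * poch_over_fact (1 - y - s0) n) Y) *
  ((/ RGamma (- s0) * poch_over_fact (- s0) n) * (/ RGamma (- s0) * poch_over_fact (- s0) n)).

Lemma asymp_poch_over_fact w : asymp (fun _ n => poch_over_fact w n) 0 (poch_over_fact w) (Re (w - 1)) (Re 0).
Proof. apply asymp_poch. Qed.
Lemma asymp_poch_over_fact_inv w : nonpole w -> asymp (fun _ n => / poch_over_fact w n) 0 (fun n => / poch_over_fact w n) (Re (1 - w)) (Re 0).
Proof. apply asymp_poch_inv. Qed.
Lemma asymp_far' w : asymp (far_poch w) (w - 1) (fun _ => RGamma w) (Re 0) (Re 0).
Proof. apply asymp_far. Qed.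
Lemma asymp_far_inv' w : nonpole w -> asymp (fun N n => / far_poch w N n) (1 - w) (fun _ => / RGamma w) (Re 0) (Re 0).
Proof. apply asymp_far_inv. Qed.
Lemma asymp_near' w : asymp (near_poch w) (w - 1) (fun n => poch_over_fact (1 - w) n * RGamma w) (Re (- w)) (Re (w - 1)).
Proof. apply asymp_near. Qed.
Lemma asymp_near_inv' w : nonpole w -> nonpole (1 - w) ->
  asymp (fun N n => / near_poch w N n) (1 - w) (fun n => / (poch_over_fact (1 - w) n * RGamma w)) (Re w) (Re (1 - w)).
Proof. apply asymp_near_inv. Qed.

Lemma asymp_right_core v u X Y s0 : nonpole (s0 + v) -> nonpole (s0 + u) ->
  (forall y, In y Y -> nonpole (1 - y - s0) /\ nonpole (y + s0)) ->
  asymp (right_core v u X Y s0)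
    (v - u - sumC X + sumC Y - nC (length X) * s0 + nC (length Y) * s0)
    (right_core_lim v u X Y s0)
    (Re (u - v + (sumC X + nC (length X) * (s0 - 1)) - (sumC Y + nC (length Y) * (s0 - 1))))
    (Re (- sumC X - nC (length X) * s0 + sumC Y + nC (length Y) * s0)).
Proof.
  intros Hv Hu HY.
  assert (HX : asymp (fun N n => prodC (map (fun x => near_poch (1 - x - s0) N n) X)) (sumC (map (fun x => 1 - x - s0 - 1) X))
    (fun n => prodC (map (fun x => poch_over_fact (x + s0) n * RGamma (1 - x - s0)) X))
    (Re (sumC (map (fun x => - (1 - x - s0)) X))) (Re (sumC (map (fun x => 1 - x - s0 - 1) X)))).
  { apply asymp_prodC. intros x _. eapply asymp_ext; [| | | | |apply asymp_near']; try reflexivity.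
    intros n. cbv beta. do 2 f_equal. ring. }
  assert (HYa : asymp (fun N n => prodC (map (fun y => / near_poch (1 - y - s0) N n) Y)) (sumC (map (fun y => 1 - (1 - y - s0)) Y))
    (fun n => prodC (map (fun y => / (poch_over_fact (y + s0) n * RGamma (1 - y - s0))) Y))
    (Re (sumC (map (fun y => 1 - y - s0) Y))) (Re (sumC (map (fun y => 1 - (1 - y - s0)) Y)))).
  { apply asymp_prodC. intros y Hy. destruct (HY y Hy) as [H1 H2].
    eapply asymp_ext; [| | | | |apply (asymp_near_inv' (1 - y - s0))]; try reflexivity; auto.
    - intros n. cbv beta. do 3 f_equal. ring.
    - now replace (1 - (1 - y - s0)) with (y + s0) by ring. }
  unfold right_core, right_core_lim.
  eapply asymp_ext; [| | | | |apply asymp_mult; [apply asymp_mult; [apply asymp_mult; [apply asymp_mult;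
     [apply (asymp_far' (s0 + v)) | apply (asymp_far_inv' (s0 + u) Hu)] |
      apply asymp_mult; [apply (asymp_poch_over_fact (s0 + u)) | apply (asymp_poch_over_fact_inv (s0 + v) Hv)]] | exact HX] | exact HYa]];
    try reflexivity.
  - rewrite (sumC_affine_ext _ (- s0) (- (1))), (sumC_affine_ext _ s0 1) by (intros; ring). ring.
  - rewrite <- !Re_plus. f_equal.
    rewrite (sumC_affine_ext _ (s0 - 1) 1), (sumC_affine_ext _ (1 - s0) (- (1))) by (intros; ring). ring.
  - rewrite <- !Re_plus. f_equal.
    rewrite (sumC_affine_ext _ (- s0) (- (1))), (sumC_affine_ext _ s0 1) by (intros; ring). ring.
Qed.

Lemma asymp_left_core X Y s0 : nonpole (- s0) -> length X = S (S (length Y)) ->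
  (forall x, In x X -> nonpole (1 - x - s0)) -> (forall y, In y Y -> nonpole (1 - y - s0)) ->
  asymp (left_core X Y s0) (- sumC X + sumC Y + 2) (left_core_lim X Y s0) (Re (sumC X - sumC Y - 2)) (Re 0).
Proof.
  intros Hs HXY HX HY.
  assert (HXa : asymp (fun N n => prodC (map (fun x => far_poch (1 - x - s0) N n * / poch_over_fact (1 - x - s0) n) X)) (sumC (map (fun x => 1 - x - s0 - 1) X))
    (fun n => prodC (map (fun x => RGamma (1 - x - s0) * / poch_over_fact (1 - x - s0) n) X))
    (Re (sumC (map (fun x => 1 - (1 - x - s0)) X))) (Re (sumC (map (fun x => RtoC 0) X)))).
  { apply asymp_prodC. intros x Hx.
    eapply asymp_ext; [| | | | |apply asymp_mult; [apply (asymp_far' (1 - x - s0)) | apply (asymp_poch_over_fact_inv _ (HX x Hx))]];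
      try reflexivity; [ring | |]; rewrite <- !Re_plus; f_equal; ring. }
  assert (HYa : asymp (fun N n => prodC (map (fun y => / far_poch (1 - y - s0) N n * poch_over_fact (1 - y - s0) n) Y)) (sumC (map (fun y => 1 - (1 - y - s0)) Y))
    (fun n => prodC (map (fun y => / RGamma (1 - y - s0) * poch_over_fact (1 - y - s0) n) Y))
    (Re (sumC (map (fun y => (1 - y - s0) - 1) Y))) (Re (sumC (map (fun y => RtoC 0) Y)))).
  { apply asymp_prodC. intros y Hy.
    eapply asymp_ext; [| | | | |apply asymp_mult; [apply (asymp_far_inv' (1 - y - s0) (HY y Hy)) | apply (asymp_poch_over_fact (1 - y - s0))]];
      try reflexivity; [ring | |]; rewrite <- !Re_plus; f_equal; ring. }
  assert (HS := asymp_mult _ _ _ _ _ _ _ _ _ _ (asymp_far_inv' _ Hs) (asymp_poch_over_fact (- s0))).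
  unfold left_core, left_core_lim.
  eapply asymp_ext; [| | | | |apply asymp_mult; [apply asymp_mult; [exact HXa | exact HYa] | apply asymp_mult; [exact HS | exact HS]]];
    try reflexivity.
  - rewrite (sumC_affine_ext _ (- s0) (- (1))), (sumC_affine_ext _ s0 1), HXY, !nC_S by (intros; ring). ring.
  - rewrite <- !Re_plus. f_equal.
    rewrite (sumC_affine_ext _ s0 1), (sumC_affine_ext _ (- s0) (- (1))), HXY, !nC_S by (intros; ring). ring.
  - rewrite <- !Re_plus. f_equal. rewrite 2!sumC_zero. ring.
Qed.

(** From (w)_m (w+m)_n = (w)_n (w+n)_m the factor is a constant times a quotient of two normalised
    symbols whose exponents differ by m. *)
Lemma asymp_poch_shift_inv w m : nonpole w ->
  asymp (fun _ n => / poch (w + nC n) m) 0 (fun n => / poch (w + nC n) m) (- INR m) (Re 0).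
Proof.
  intros Hw.
  assert (E : forall n, / poch w m * (poch_over_fact w n * / poch_over_fact (w + nC m) n) = / poch (w + nC n) m).
  { intros n. assert (P1 := poch_neq0 w m Hw). assert (P2 := poch_neq0 w n Hw).
    assert (P3 := poch_neq0 _ n (nonpole_add w m Hw)). assert (P4 := poch_neq0 _ m (nonpole_add w n Hw)).
    assert (P5 := nC_fact_neq0 n).
    assert (Q : poch w m * poch (w + nC m) n = poch w n * poch (w + nC n) m).
    { rewrite <- 2!poch_add. f_equal. lia. }
    unfold poch_over_fact. replace (poch (w + nC n) m) with (poch w m * poch (w + nC m) n / poch w n) by (rewrite Q; field; auto).
    field. auto. }
  eapply asymp_ext; [| | | | |apply asymp_mult; [apply (asymp_const (fun _ => / poch w m) 0) |
     apply asymp_mult; [apply (asymp_poch_over_fact w) | apply (asymp_poch_over_fact_inv _ (nonpole_add w m Hw))]]].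
  - intros N n _. apply E.
  - apply E.
  - ring.
  - rewrite 2!Re_minus, Re_plus, Re_1, Re_nC. ring.
  - rewrite Re_0. ring.
  - exists (Cmod (/ poch w m)). split; [apply Cmod_ge_0|]. intros n. rewrite succ_pow_0. lra.
Qed.

(** * The logarithmic derivative at the double poles *)

(** The relation [asymp] composes under products, but a logarithmic derivative is a sum; uniform
    boundedness is stable under sums and yields [asymp] with all exponents 0. *)
Definition bounded_limit (F : nat -> nat -> C) (f : nat -> C) : Prop :=
  (forall n, cvgC (fun N => F N n) (f n)) /\
  exists M N0, forall N n, (N0 <= N)%nat -> (n < N)%nat -> (Cmod (F N n) <= M)%R.

Lemma bounded_limit_plus F G f g : bounded_limit F f -> bounded_limit G g -> bounded_limit (fun N n => F N n + G N n) (fun n => f n + g n).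
Proof.
  intros [H1 [M [N0 H2]]] [K1 [M' [N0' K2]]]. split.
  - intros n. apply cvgC_plus; auto.
  - exists (M + M')%R, (Nat.max N0 N0'). intros N n HN Hn. eapply Rle_trans; [apply Cmod_triangle|].
    apply Rplus_le_compat; [apply H2 | apply K2]; lia.
Qed.

Lemma bounded_limit_opp F f : bounded_limit F f -> bounded_limit (fun N n => - F N n) (fun n => - f n).
Proof.
  intros [H1 [M [N0 H2]]]. split.
  - intros n. apply cvgC_opp; auto.
  - exists M, N0. intros. rewrite Cmod_opp. auto.
Qed.

Lemma bounded_limit_minus F G f g : bounded_limit F f -> bounded_limit G g -> bounded_limit (fun N n => F N n - G N n) (fun n => f n - g n).
Proof. intros H K. apply bounded_limit_plus; auto. now apply bounded_limit_opp. Qed.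

Lemma bounded_limit_sumC {T} (l : list T) (F : T -> nat -> nat -> C) f : (forall x, In x l -> bounded_limit (F x) (f x)) ->
  bounded_limit (fun N n => sumC (map (fun x => F x N n) l)) (fun n => sumC (map (fun x => f x n) l)).
Proof.
  induction l as [|x l IH]; intros H.
  - split; [intros; apply (cvgC_const 0)|]. exists 0%R, 0%nat. intros. unfold sumC; simpl. rewrite Cmod_0; lra.
  - apply (bounded_limit_plus (F x) _ (f x)); [apply H; now left | apply IH; intros; apply H; now right].
Qed.

Lemma bounded_limit_seq (s : nat -> C) (l : C) (g : nat -> nat -> nat) : cvgC s l -> (forall n, to_inf (fun N => g N n)) ->
  bounded_limit (fun N n => s (g N n)) (fun _ => l).
Proof.
  intros H Hg. split; [intros n; now apply (cvgC_comp s l (fun N => g N n))|].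
  destruct (cvgC_bounded s l H) as [M [_ HM]]. exists M, 0%nat. auto.
Qed.

Lemma bounded_limit_const (f : nat -> C) M : (forall n, (Cmod (f n) <= M)%R) -> bounded_limit (fun _ n => f n) f.
Proof. intros H. split; [intros; apply cvgC_const|]. exists M, 0%nat. auto. Qed.

Lemma bounded_limit_cvg (f : nat -> C) l : cvgC f l -> bounded_limit (fun _ n => f n) f.
Proof. intros H. destruct (cvgC_bounded f l H) as [M [_ HM]]. now apply (bounded_limit_const f M). Qed.

Definition psi0_partial (x : C) (k : nat) : C := csum (fun j => / nC (S j) - / (nC j + x)) k.
Definition harmonic (k : nat) : C := csum (fun j => / nC (S j)) k.

Lemma psi0_partial_harmonic x k : csum (fun j => / (nC j + x)) k = harmonic k - psi0_partial x k.
Proof. unfold harmonic, psi0_partial. rewrite csum_minus. ring. Qed.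

(** The sum of 1/(k-r) over r in [roots_up (1 - x) N], with its harmonic numbers removed: k roots
    with smaller index, the root 1-x+k, and N-1-k roots with larger index. *)
Definition log_deriv_term (x : C) (N k : nat) : C := - psi0_partial x k + / (x - 1) + psi0_partial (2 - x) (N - 1 - k).

(** The logarithmic derivative at s = k of (s-k)^2 times the truncated integrand. *)
Definition log_deriv (m : nat) (u v : C) (X Y : list C) (e L : nat) (N k : nat) : C :=
  psi0_partial u (k + N) - psi0_partial v (k + N) - psi0_partial u k + psi0_partial v k
  + sumC (map (fun x => log_deriv_term x N k) X) - sumC (map (fun y => log_deriv_term y N k) Y)
  - csum (fun i => / (nC k + 1 + nC i)) m
  + (nC e * / (nC k - nC N) + nC e * / (nC k + nC N))
  - sumC (map (fun l => / (nC k - far_pole N l)) (seq 0 L)).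

Definition log_deriv_lim (m : nat) (u v : C) (X Y : list C) (k : nat) : C :=
  psi0 u - psi0 v - psi0_partial u k + psi0_partial v k
  + sumC (map (fun x => - psi0_partial x k + / (x - 1) + psi0 (2 - x)) X)
  - sumC (map (fun x => - psi0_partial x k + / (x - 1) + psi0 (2 - x)) Y)
  - csum (fun i => / (nC k + 1 + nC i)) m.

Lemma bounded_limit_log_deriv_term x : nonpole x -> nonpole (2 - x) -> bounded_limit (log_deriv_term x) (fun k => - psi0_partial x k + / (x - 1) + psi0 (2 - x)).
Proof.
  intros H1 H2. apply bounded_limit_plus; [apply bounded_limit_plus|].
  - apply bounded_limit_opp. apply (bounded_limit_cvg (psi0_partial x) (psi0 x)). now apply psi0_cvg.
  - apply (bounded_limit_const (fun _ => / (x - 1)) (Cmod (/ (x - 1)))). intros; lra.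
  - apply (bounded_limit_seq (psi0_partial (2 - x)) (psi0 (2 - x)) (fun N k => N - 1 - k)%nat).
    + now apply psi0_cvg.
    + intros n K. exists (K + n + 1)%nat. intros; lia.
Qed.

(** The zeros and poles of the cutoff contribute terms of size 1/(N-n). These are not uniformly
    small near n = N, but they stay bounded, which suffices for domination. *)
Lemma bounded_limit_small (F : nat -> nat -> C) (c : R) : (0 <= c)%R ->
  (forall N n, (1 <= N)%nat -> (n < N)%nat -> (Cmod (F N n) <= c / INR (N - n))%R) ->
  bounded_limit F (fun _ => RtoC 0).
Proof.
  intros Hc H. split.
  - intros n. apply (cvgC_squeeze _ _ (fun N => c / (INR N - INR n))%R (S n)).
    + intros N HN. replace (F N n - 0) with (F N n) by ring. rewrite <- minus_INR by lia. apply H; lia.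
    + apply is_lim_seq_spec. intros eps.
      destruct (INR_unbounded (INR n + c / eps)) as [N0 HN0]. exists N0. intros N HN.
      assert (He := cond_pos eps). apply le_INR in HN.
      assert (0 <= c / eps)%R by (apply Rle_mult_inv_pos; lra).
      rewrite Rminus_0_r, Rabs_pos_eq by (apply Rle_mult_inv_pos; lra).
      apply Rlt_div_l; [lra|]. apply Rmult_lt_reg_r with (/ eps)%R; [now apply Rinv_0_lt_compat|].
      replace (eps * (INR N - INR n) * / eps)%R with (INR N - INR n)%R by (field; lra). unfold Rdiv in *. lra.
  - exists c, 1%nat. intros N n HN Hn. eapply Rle_trans; [apply H; auto|].
    assert (P : (1 <= INR (N - n))%R) by (apply (le_INR 1); lia).
    apply Rle_div_l; nra.
Qed.

Lemma bounded_limit_log_deriv m u v X Y e L : nonpole u -> nonpole v ->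
  (forall x, In x X -> nonpole x /\ nonpole (2 - x)) -> (forall y, In y Y -> nonpole y /\ nonpole (2 - y)) ->
  bounded_limit (log_deriv m u v X Y e L) (log_deriv_lim m u v X Y).
Proof.
  intros Hu Hv HX HY.
  assert (A : forall w, nonpole w -> bounded_limit (fun N k => psi0_partial w (k + N)) (fun _ => psi0 w)).
  { intros w Hw. apply (bounded_limit_seq (psi0_partial w) (psi0 w) (fun N k => k + N)%nat).
    - now apply psi0_cvg.
    - intros n K. exists K. intros; lia. }
  assert (B : forall w, nonpole w -> bounded_limit (fun N k => psi0_partial w k) (psi0_partial w)).
  { intros w Hw. apply (bounded_limit_cvg (psi0_partial w) (psi0 w)). now apply psi0_cvg. }
  assert (HXb : bounded_limit (fun N k => sumC (map (fun x => log_deriv_term x N k) X))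
     (fun k => sumC (map (fun x => - psi0_partial x k + / (x - 1) + psi0 (2 - x)) X))).
  { apply (bounded_limit_sumC X log_deriv_term (fun x k => - psi0_partial x k + / (x - 1) + psi0 (2 - x))).
    intros x Hx. destruct (HX x Hx). now apply bounded_limit_log_deriv_term. }
  assert (HYb : bounded_limit (fun N k => sumC (map (fun x => log_deriv_term x N k) Y))
     (fun k => sumC (map (fun x => - psi0_partial x k + / (x - 1) + psi0 (2 - x)) Y))).
  { apply (bounded_limit_sumC Y log_deriv_term (fun x k => - psi0_partial x k + / (x - 1) + psi0 (2 - x))).
    intros x Hx. destruct (HY x Hx). now apply bounded_limit_log_deriv_term. }
  assert (Hm : bounded_limit (fun _ k => csum (fun i => / (nC k + 1 + nC i)) m) (fun k => csum (fun i => / (nC k + 1 + nC i)) m)).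
  { apply (bounded_limit_const _ (rsum (fun _ => 1%R) m)). intros k. apply csum_Cmod0. intros i _.
    replace (nC k + 1 + nC i) with (nC (S (k + i))) by (rewrite nC_S, nC_add; ring).
    rewrite Cmod_inv, Cmod_nC by apply nC_S_neq0. rewrite <- Rinv_1. apply Rinv_le_contravar; [lra|].
    apply (le_INR 1); lia. }
  assert (Hz : bounded_limit (fun N k => nC e * / (nC k - nC N) + nC e * / (nC k + nC N)) (fun _ => 0)).
  { apply (bounded_limit_small _ (INR e + INR e)%R); [assert (T := pos_INR e); lra|].
    intros N n HN Hn. eapply Rle_trans; [apply Cmod_triangle|]. rewrite 2!Cmod_mult, Cmod_nC.
    replace (nC n - nC N) with (- nC (N - n)) by (rewrite nC_sub by lia; ring). rewrite <- nC_add.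
    assert (Z1 : nC (N - n) <> 0) by (apply nC_neq0; lia).
    rewrite 2!Cmod_inv, Cmod_opp, 2!Cmod_nC;
      [|apply nC_neq0; lia| intros E; apply Z1; replace (nC (N - n)) with (- - nC (N - n)) by ring; rewrite E; ring].
    assert (P : (0 < INR (N - n))%R) by (apply lt_0_INR; lia).
    assert (P2 : (/ INR (n + N) <= / INR (N - n))%R) by (apply Rinv_le_contravar; auto; apply le_INR; lia).
    assert (T := pos_INR e). unfold Rdiv. nra. }
  assert (Hf : bounded_limit (fun N k => sumC (map (fun l => / (nC k - far_pole N l)) (seq 0 L)))
     (fun _ => sumC (map (fun _ => RtoC 0) (seq 0 L)))).
  { apply (bounded_limit_sumC (seq 0 L) (fun l N k => / (nC k - far_pole N l)) (fun _ _ => 0)). intros l _.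
    apply (bounded_limit_small _ 1%R); [lra|]. intros N n HN Hn.
    assert (P : (0 < INR (N - n))%R) by (apply lt_0_INR; lia).
    assert (P2 : (INR (N - n) <= Cmod (nC n - far_pole N l))%R).
    { eapply Rle_trans; [|apply Im_le_Cmod].
      replace (Im (nC n - far_pole N l)) with (- Im (far_pole N l))%R by (unfold nC, RtoC, Cminus, Cplus, Copp, Im; simpl; ring).
      rewrite Rabs_Ropp, far_pole_Im.
      assert (Q1 : (INR (N - n) <= INR N)%R) by (apply le_INR; lia).
      assert (Q2 : (1 <= INR (S l))%R) by (apply (le_INR 1); lia).
      rewrite Rabs_pos_eq; nra. }
    rewrite Cmod_inv by (apply Cmod_gt_0; lra). unfold Rdiv. rewrite Rmult_1_l.
    apply Rinv_le_contravar; auto. }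
  assert (T := bounded_limit_minus _ _ _ _ (bounded_limit_plus _ _ _ _ (bounded_limit_minus _ _ _ _ (bounded_limit_minus _ _ _ _ (bounded_limit_plus _ _ _ _
    (bounded_limit_plus _ _ _ _ (bounded_limit_minus _ _ _ _ (bounded_limit_minus _ _ _ _ (A u Hu) (A v Hv)) (B u Hu)) (B v Hv)) HXb) HYb) Hm) Hz) Hf).
  destruct T as [T1 T2]. split; auto.
  intros n. eapply cvgC_lim_eq; [apply T1|]. cbv beta. unfold log_deriv_lim. rewrite sumC_zero. ring.
Qed.

Lemma asymp_bounded_limit F f : bounded_limit F f -> asymp F 0 f 0 0.
Proof. intros [H1 [M [N0 H2]]]. now apply (asymp_bounded F f N0 M). Qed.

Definition inv_sum (l : list C) (s : C) : C := sumC (map (fun r => / (s - r)) l).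

Lemma inv_sum_app l k s : inv_sum (l ++ k) s = inv_sum l s + inv_sum k s.
Proof. unfold inv_sum. now rewrite map_app, sumC_app. Qed.
Lemma inv_sum_cons r l s : inv_sum (r :: l) s = / (s - r) + inv_sum l s. Proof. reflexivity. Qed.

Lemma inv_sum_flat_map (g : C -> list C) Y s : inv_sum (flat_map g Y) s = sumC (map (fun y => inv_sum (g y) s) Y).
Proof. induction Y as [|y Y IH]; [reflexivity|]. simpl. now rewrite inv_sum_app, IH. Qed.

Lemma double_residue_log A D B x : ~ In x B -> ~ In x A -> root_prod1 D x <> 0 ->
  double_residue A D B x = root_prod B x / (root_prod A x * (root_prod1 D x * root_prod1 D x)) * (inv_sum B x - inv_sum A x - root_prod2 D x / root_prod1 D x).
Proof.
  intros HB HA HD. unfold double_residue. rewrite (root_prod1_log B x HB), (root_prod1_log A x HA).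
  assert (P := root_prod_notin A x HA). unfold inv_sum. field. auto.
Qed.

Lemma inv_sum_roots_down v N k : inv_sum (roots_down (- v) N) (nC k) = harmonic (k + N) - psi0_partial v (k + N) - harmonic k + psi0_partial v k.
Proof.
  unfold inv_sum, roots_down. rewrite map_map.
  transitivity (csum (fun i => / (nC (k + i) + v)) N).
  - apply csum_ext. intros i _. f_equal. rewrite nC_add. ring.
  - assert (E := csum_add (fun j => / (nC j + v)) k N). rewrite 2!psi0_partial_harmonic in E.
    replace (csum (fun i => / (nC (k + i) + v)) N) with
      ((harmonic k - psi0_partial v k + csum (fun i => / (nC (k + i) + v)) N) - (harmonic k - psi0_partial v k)) by ring.
    rewrite <- E. ring.
Qed.

Lemma inv_sum_roots_up_split (x : C) N k : (k < N)%nat -> x <> 1 ->  (forall j, nC j + x <> 0) -> (forall j, nC j + (2 - x) <> 0) ->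
  inv_sum (roots_up (1 - x) N) (nC k) = log_deriv_term x N k + harmonic k - harmonic (N - 1 - k).
Proof.
  intros Hk Hx Hx1 Hx2. unfold inv_sum, roots_up. rewrite map_map.
  change (csum (fun i => / (nC k - (1 - x + nC i))) N = log_deriv_term x N k + harmonic k - harmonic (N - 1 - k)).
  replace N with (k + (1 + (N - 1 - k)))%nat at 1 by lia.
  rewrite csum_add, csum_add, (csum_S _ 0), csum_0, (csum_rev _ k).
  replace (csum (fun i => / (nC k - (1 - x + nC (k - 1 - i)))) k) with (csum (fun j => / (nC j + x)) k).
  2:{ apply csum_ext. intros i Hi. f_equal. rewrite !nC_sub by lia. change (nC 1) with (RtoC 1). ring. }
  replace (csum (fun i => / (nC k - (1 - x + nC (k + (1 + i))))) (N - 1 - k)) with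
    (- (1) * csum (fun j => / (nC j + (2 - x))) (N - 1 - k)).
  2:{ rewrite <- csum_scal. apply csum_ext. intros i _. rewrite !nC_add. change (nC 1) with (RtoC 1).
      replace (nC k - (1 - x + (nC k + (1 + nC i)))) with (- (nC i + (2 - x))) by ring.
      specialize (Hx2 i). field. auto. }
  rewrite 2!psi0_partial_harmonic. replace (nC k - (1 - x + nC (k + 0))) with (x - 1) by (rewrite Nat.add_0_r; ring).
  unfold log_deriv_term. ring.
Qed.

Lemma root_prod2_at_split l1 x l2 : ~ In x l1 -> ~ In x l2 ->
  root_prod2 (l1 ++ x :: l2) x = 2 * root_prod1 (l1 ++ x :: l2) x * (inv_sum l1 x + inv_sum l2 x).
Proof.
  intros H1 H2. rewrite root_prod1_at_split, root_prod2_app, root_prod_cons. cbn [root_prod1 root_prod2].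
  rewrite (root_prod1_log l1 x H1), (root_prod1_log l2 x H2). unfold inv_sum. ring.
Qed.

Lemma nC_inj a b : nC a = nC b -> a = b.
Proof. unfold nC. intros E. injection E. apply INR_eq. Qed.

Lemma root_prod2_roots_up0 N k : (k < N)%nat -> root_prod1 (roots_up 0 N) (nC k) <> 0 /\
  root_prod2 (roots_up 0 N) (nC k) / root_prod1 (roots_up 0 N) (nC k) = 2 * (harmonic k - harmonic (N - 1 - k)).
Proof.
  intros Hk.
  assert (Hd : root_prod1 (roots_up 0 N) (nC k) <> 0).
  { replace (nC k) with (0 + nC k) by ring. rewrite root_prod1_roots_up_own by auto.
    assert (A := sgn1_neq0 (N + k)). assert (B := fact_near_neq0 N k). assert (D : nC (N - k) <> 0) by (apply nC_neq0; lia).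
    intros E. apply (Cmult_neq_0 _ _ A (Cmult_neq_0 _ _ B (Cinv_neq0 _ D))).
    replace (sgn1 (N + k) * (fact_near N k * / nC (N - k))) with (- (- sgn1 (N + k) * (fact_near N k / nC (N - k)))) by (unfold Cdiv; ring).
    rewrite E. ring. }
  split; auto.
  assert (E : roots_up 0 N = roots_up 0 k ++ nC k :: roots_up (nC (S k)) (N - k - 1)).
  { rewrite (roots_up_split 0 N k Hk). now rewrite 2!Cplus_0_l. }
  rewrite E in Hd |- *. rewrite root_prod2_at_split.
  - replace (inv_sum (roots_up 0 k) (nC k)) with (harmonic k).
    2:{ unfold inv_sum, roots_up. rewrite map_map. symmetry. change (csum (fun i => / (nC k - (0 + nC i))) k = harmonic k).
        rewrite csum_rev. apply csum_ext. intros i Hi. f_equal. rewrite !nC_sub by lia. rewrite (nC_S i).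
        change (nC 1) with (RtoC 1). ring. }
    replace (inv_sum (roots_up (nC (S k)) (N - k - 1)) (nC k)) with (- (1) * harmonic (N - 1 - k)).
    2:{ unfold inv_sum, roots_up. rewrite map_map. replace (N - k - 1)%nat with (N - 1 - k)%nat by lia.
        unfold harmonic. rewrite <- csum_scal. apply csum_ext. intros i _.
        replace (nC k - (nC (S k) + nC i)) with (- nC (S i)) by (rewrite !nC_S; ring).
        assert (A := nC_S_neq0 i). field. auto. }
    field. auto.
  - intros Hin. unfold roots_up in Hin. apply in_map_iff in Hin. destruct Hin as [i [Ei Hi]]. apply in_seq in Hi.
    rewrite Cplus_0_l in Ei. apply nC_inj in Ei. lia.
  - intros Hin. unfold roots_up in Hin. apply in_map_iff in Hin. destruct Hin as [i [Ei Hi]].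
    rewrite <- nC_add in Ei. apply nC_inj in Ei. lia.
Qed.

Lemma inv_sum_repeat r e s : inv_sum (repeat r e) s = nC e * / (s - r).
Proof.
  induction e as [|e IH]; [unfold inv_sum; simpl; rewrite nC_0; ring|].
  simpl repeat. rewrite inv_sum_cons, IH, nC_S. ring.
Qed.

(** Each progression of X or Y carries the difference of the harmonic numbers H_k - H_(N-1-k). The
    surplus |X| - |Y| = 2 cancels the ratio of derivatives of the double-pole list, and the harmonic
    numbers of u and v cancel each other. *)
Lemma log_derivative_exact m u v X Y N e L k : (k < N)%nat -> length X = S (S (length Y)) ->
  (forall x, In x X -> notInt x) -> (forall y, In y Y -> notInt y) ->
  inv_sum (numer_roots v X N e) (nC k) - inv_sum (simple_poles m u Y N L) (nC k)
   - root_prod2 (roots_up 0 N) (nC k) / root_prod1 (roots_up 0 N) (nC k) = log_deriv m u v X Y e L N k.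
Proof.
  intros Hk HXY HX HY. destruct (root_prod2_roots_up0 N k Hk) as [_ E]. rewrite E.
  unfold numer_roots, simple_poles, edge_zeros. rewrite !inv_sum_app, !inv_sum_flat_map, !inv_sum_repeat, (inv_sum_roots_down v), (inv_sum_roots_down u).
  assert (Q : forall Z, (forall z, In z Z -> notInt z) ->
    sumC (map (fun y => inv_sum (roots_up (1 - y) N) (nC k)) Z) =
    sumC (map (fun y => log_deriv_term y N k) Z) + nC (length Z) * (harmonic k - harmonic (N - 1 - k))).
  { induction Z as [|z Z IH]; intros HZ.
    - unfold sumC; cbn [map fold_right length]. rewrite nC_0. ring.
    - cbn [map length]; cbv beta. rewrite 2!sumC_cons, IH by (intros; apply HZ; now right).
      assert (Hz := HZ z (or_introl eq_refl)).
      rewrite inv_sum_roots_up_split, nC_S; auto; [ring| |].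
      + intros j. rewrite Cplus_comm. now apply notInt_nonpole.
      + intros j. rewrite Cplus_comm. apply notInt_nonpole. now apply (notInt_nat_sub z 2). }
  rewrite (Q X HX), (Q Y HY), HXY, !nC_S.
  replace (inv_sum (roots_down (- (1)) m) (nC k)) with (csum (fun i => / (nC k + 1 + nC i)) m).
  2:{ unfold inv_sum, roots_down. rewrite map_map. apply csum_ext. intros i _. f_equal. ring. }
  replace (inv_sum (far_poles N L) (nC k)) with (sumC (map (fun l => / (nC k - far_pole N l)) (seq 0 L))).
  2:{ unfold inv_sum, far_poles. now rewrite map_map. }
  unfold log_deriv. replace (nC k - - nC N) with (nC k + nC N) by ring. ring.
Qed.

(** * Separation of the poles and the identity at level N *)

Lemma NoDup_app_intro {T} (l k : list T) : NoDup l -> NoDup k -> (forall x, In x l -> ~ In x k) -> NoDup (l ++ k).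
Proof.
  induction l as [|a l IH]; intros H1 H2 H3; [auto|]. simpl. inversion H1; subst.
  constructor.
  - rewrite in_app_iff. intros [H|H]; auto. apply (H3 a); auto. now left.
  - apply IH; auto. intros x Hx. apply H3. now right.
Qed.

Lemma in_roots_up_inv x N a : In a (roots_up x N) -> exists n, (n < N)%nat /\ a = x + nC n.
Proof. intros H. apply in_map_iff in H. destruct H as [i [E Hi]]. apply in_seq in Hi. exists i. split; [lia|auto]. Qed.
Lemma in_roots_down_inv x N a : In a (roots_down x N) -> exists n, (n < N)%nat /\ a = x - nC n.
Proof. intros H. apply in_map_iff in H. destruct H as [i [E Hi]]. apply in_seq in Hi. exists i. split; [lia|auto]. Qed.

Lemma NoDup_map_seq (f : nat -> C) n : (forall i j, f i = f j -> i = j) -> NoDup (map f (seq 0 n)).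
Proof. intros H. apply FinFun.Injective_map_NoDup; [intros i j; apply H | apply seq_NoDup]. Qed.

Lemma NoDup_roots_up x N : NoDup (roots_up x N).
Proof.
  apply NoDup_map_seq. intros i j E. apply nC_inj.
  replace (nC i) with (x + nC i - x) by ring. rewrite E. ring.
Qed.
Lemma NoDup_roots_down x N : NoDup (roots_down x N).
Proof.
  apply NoDup_map_seq. intros i j E. apply nC_inj.
  replace (nC i) with (x - (x - nC i)) by ring. rewrite E. ring.
Qed.

Lemma nC_IZR n : nC n = RtoC (IZR (Z.of_nat n)).
Proof. unfold nC. now rewrite INR_IZR_INZ. Qed.

Lemma notInt_sep a b n k : notInt (a - b) -> a + nC n <> b + nC k.
Proof.
  intros H E. apply (H (Z.of_nat k - Z.of_nat n)%Z). rewrite minus_IZR, RtoC_minus, <- !nC_IZR.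
  replace (a - b) with (a + nC n - b - nC n) by ring. rewrite E. ring.
Qed.

Lemma notInt_sep' a b n k : notInt (a - b) -> a + nC n <> b - nC k.
Proof.
  intros H E. apply (notInt_sep a b (n + k) 0 H). rewrite nC_add, nC_0, Cplus_assoc, E. ring.
Qed.

Definition poles_generic (u : C) (Y : list C) : Prop :=
  notInt u /\ (forall y, In y Y -> notInt y /\ notInt (y - u)) /\
  ForallOrdPairs (fun y y' => notInt (y - y')) Y.

Lemma notInt_sub_sym a b : notInt (a - b) -> notInt (b - a).
Proof. intros H. replace (b - a) with (- (a - b)) by ring. now apply notInt_opp. Qed.

Lemma NoDup_flat_roots_up Y N : ForallOrdPairs (fun y y' => notInt (y - y')) Y ->
  NoDup (flat_map (fun y => roots_up (1 - y) N) Y).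
Proof.
  induction 1 as [|y Y Hy HY IH]; [constructor|]. simpl. apply NoDup_app_intro; auto using NoDup_roots_up.
  intros a H1 H2. apply in_roots_up_inv in H1. destruct H1 as [n [_ E1]].
  apply in_flat_map in H2. destruct H2 as [y' [Hy' H2]]. apply in_roots_up_inv in H2. destruct H2 as [k [_ E2]].
  rewrite Forall_forall in Hy. specialize (Hy y' Hy'). subst a.
  apply (notInt_sep (1 - y) (1 - y') n k); auto.
  replace (1 - y - (1 - y')) with (y' - y) by ring. now apply notInt_sub_sym.
Qed.

Definition poles_far (N : nat) (u : C) (Y : list C) : Prop :=
  (0 < N)%nat /\ im_below N (- u) /\ forall y, In y Y -> im_below N (1 - y).

Lemma poles_far_ev u Y : exists N0, forall N, (N0 <= N)%nat -> poles_far N u Y.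
Proof.
  destruct (im_below_ev (- u)) as [N1 H1].
  assert (H : exists N2, forall N, (N2 <= N)%nat -> forall y, In y Y -> im_below N (1 - y)).
  { induction Y as [|y Y [N2 H2]].
    - exists 0%nat. intros N _ y [].
    - destruct (im_below_ev (1 - y)) as [N3 H3]. exists (Nat.max N2 N3). intros N HN z [<-|Hz].
      + apply H3; lia.
      + apply H2; auto; lia. }
  destruct H as [N2 H2]. exists (S (Nat.max N1 N2)). intros N HN. split; [lia|]. split.
  - apply H1; lia.
  - apply H2; lia.
Qed.

Lemma Im_opp_nC n : Im (- nC n) = 0%R.
Proof. unfold nC, RtoC, Copp, Im; simpl. ring. Qed.

Lemma NoDup_far_poles N L : (0 < N)%nat -> NoDup (far_poles N L).
Proof.
  intros HN. apply NoDup_map_seq. intros i j E. 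
  assert (E2 : Im (far_pole N i) = Im (far_pole N j)) by now rewrite E. rewrite 2!far_pole_Im in E2.
  apply lt_0_INR in HN. apply Rmult_eq_reg_l in E2; [|lra]. apply INR_eq in E2. lia.
Qed.

Lemma NoDup_poles m u Y N L : poles_generic u Y -> poles_far N u Y ->
  NoDup (simple_poles m u Y N L ++ roots_up 0 N).
Proof.
  intros [Hu [HY HP]] [HN [Hfu HfY]].
  assert (Far : forall a, im_below N a -> ~ In a (far_poles N L)).
  { intros a Ha Hin. unfold far_poles in Hin. apply in_map_iff in Hin. destruct Hin as [l [E _]].
    apply (im_below_neq N a l HN Ha). auto. }
  assert (FInt : forall r, Im r = 0%R -> im_below N r).
  { intros r Hr. unfold im_below. rewrite Hr, Rabs_R0. now apply lt_0_INR. }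
  unfold simple_poles. rewrite <- !app_assoc.
  apply NoDup_app_intro; [apply NoDup_roots_down | |].
  apply NoDup_app_intro; [apply NoDup_roots_down | |].
  apply NoDup_app_intro; [now apply NoDup_flat_roots_up | |].
  apply NoDup_app_intro; [now apply NoDup_far_poles | apply NoDup_roots_up |].
  - intros a H1 H2. apply in_roots_up_inv in H2. destruct H2 as [n [_ ->]]. apply (Far (0 + nC n)); auto.
    apply FInt. rewrite Cplus_0_l. apply Im_nC.
  - intros a H1. apply in_flat_map in H1. destruct H1 as [y [Hy H1]]. apply in_roots_up_inv in H1.
    destruct H1 as [n [_ ->]]. rewrite in_app_iff. intros [H2|H2].
    + apply (Far _ (im_below_shift _ _ _ (Im_nC n) (HfY y Hy)) H2).
    + apply in_roots_up_inv in H2. destruct H2 as [k [_ E]]. revert E. apply notInt_sep.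
      replace (1 - y - 0) with (1 - y) by ring. apply notInt_1_sub, HY, Hy.
  - intros a H1. apply in_roots_down_inv in H1. destruct H1 as [n [_ ->]]. rewrite !in_app_iff. intros [H2|[H2|H2]].
    + apply in_flat_map in H2. destruct H2 as [y [Hy H2]]. apply in_roots_up_inv in H2. destruct H2 as [k [_ E]].
      symmetry in E. revert E. apply notInt_sep'. replace (1 - y - - u) with (1 - (y - u)) by ring.
      apply notInt_1_sub, HY, Hy.
    + apply (Far (- u - nC n)); auto. apply (im_below_shift N (- u) (- nC n)); auto. apply Im_opp_nC.
    + apply in_roots_up_inv in H2. destruct H2 as [k [_ E]]. symmetry in E. revert E. apply notInt_sep'.
      now replace (0 - - u) with u by ring.
  - intros a H1. apply in_roots_down_inv in H1. destruct H1 as [n [_ ->]]. rewrite !in_app_iff. intros [H2|[H2|[H2|H2]]].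
    + apply in_roots_down_inv in H2. destruct H2 as [k [_ E]].
      apply (notInt_sep (- u) (- (1)) n k).
      * replace (- u - - (1)) with (1 - u) by ring. now apply notInt_1_sub.
      * replace (- (1) + nC k) with (- (1) - nC n + (nC k + nC n)) by ring. rewrite E. ring.
    + apply in_flat_map in H2. destruct H2 as [y [Hy H2]]. apply in_roots_up_inv in H2. destruct H2 as [k [_ E]].
      symmetry in E. revert E. apply notInt_sep'.
      replace (1 - y - - (1)) with (nC 2 - y) by (change (nC 2) with (RtoC 2); ring).
      apply notInt_nat_sub, HY, Hy.
    + apply (Far (- (1) - nC n)); auto. apply FInt. unfold nC, RtoC, Copp, Cminus, Cplus, Im; simpl. ring.
    + apply in_roots_up_inv in H2. destruct H2 as [k [_ E]].
      apply (nC_S_neq0 (k + n)). rewrite nC_S, nC_add.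
      replace (nC k + nC n + 1) with ((0 + nC k) + nC n + 1) by ring. rewrite <- E. ring.
Qed.

Lemma numer_roots_notin v X N e k : (k < N)%nat -> notInt v -> (forall x, In x X -> notInt x) ->
  ~ In (nC k) (numer_roots v X N e).
Proof.
  intros Hk Hv HX. unfold numer_roots, edge_zeros. rewrite !in_app_iff. intros [H|[H|[H|H]]].
  - apply in_roots_down_inv in H. destruct H as [n [_ E]]. revert E. 
    replace (nC k) with (0 + nC k) by ring. apply notInt_sep'. now replace (0 - - v) with v by ring.
  - apply in_flat_map in H. destruct H as [x [Hx H]]. apply in_roots_up_inv in H. destruct H as [n [_ E]].
    revert E. replace (nC k) with (0 + nC k) by ring. apply notInt_sep, notInt_sub_sym.
    replace (1 - x - 0) with (1 - x) by ring. now apply notInt_1_sub, HX.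
  - apply repeat_spec in H. apply nC_inj in H. lia.
  - apply repeat_spec in H. apply (nC_neq0 (k + N)); [lia|]. rewrite nC_add, H. ring.
Qed.

Lemma length_roots_up x N : length (roots_up x N) = N.
Proof. unfold roots_up. now rewrite length_map, length_seq. Qed.
Lemma length_roots_down x N : length (roots_down x N) = N.
Proof. unfold roots_down. now rewrite length_map, length_seq. Qed.
Lemma length_flat_roots_up X N : length (flat_map (fun y => roots_up (1 - y) N) X) = (length X * N)%nat.
Proof. induction X as [|x X IH]; [reflexivity|]. simpl. rewrite length_app, length_roots_up, IH. lia. Qed.

Lemma sumC_flat_map {T} (F : C -> C) (g : T -> list C) Y :
  sumC (map F (flat_map g Y)) = sumC (map (fun y => sumC (map F (g y))) Y).
Proof.
  induction Y as [|y Y IH]; [reflexivity|]. simpl. rewrite map_app, sumC_app, IH. reflexivity.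
Qed.

Lemma sumC_scal_r {T} (c : C) (f : T -> C) l : sumC (map (fun x => f x * c) l) = sumC (map f l) * c.
Proof.
  rewrite <- (Cmult_comm c), <- sumC_scal. apply sumC_ext_in. intros. ring.
Qed.

(** The numerator has degree (1+|X|)N + 2e and the denominator m + N + |Y|N + L + 2N. With |X| = |Y|
    + 2 the difference is m + L - 2e, so the hypothesis on e and L is the degree condition of the
    residue theorem. *)
Lemma level_identity m u v X Y N e L : poles_generic u Y -> poles_far N u Y ->
  (2 * e + 2 <= m + L)%nat -> length X = S (S (length Y)) ->
  notInt v -> (forall x, In x X -> notInt x) ->
  let R := fun a => simple_residue (simple_poles m u Y N L) (roots_up 0 N) (numer_roots v X N e) a * cutoff_norm N e L in
  csum (fun j => R (- (1) - nC j)) m + csum (fun n => R (- u - nC n)) N +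
  sumC (map (fun y => csum (fun n => R (1 - y + nC n)) N) Y) +
  csum (fun l => R (far_pole N l)) L +
  csum (fun k => right_core v u X Y 0 N k * (nC (N - k) * nC (N - k)) * / poch (1 + nC k) m * cutoff e L N (0 + nC k)
     * log_deriv m u v X Y e L N k) N = 0.
Proof.
  intros HG HF He HXY Hv HX R.
  assert (Hn := NoDup_poles m u Y N L HG HF).
  assert (S := sum_of_residues (numer_roots v X N e) (simple_poles m u Y N L) (roots_up 0 N)).
  specialize (S ltac:(unfold numer_roots, simple_poles, edge_zeros, far_poles;
    rewrite !length_app, !length_flat_roots_up, !length_roots_up, !length_roots_down, !repeat_length, length_map, length_seq, HXY; lia) Hn).
  unfold residue_sum in S.
  assert (S2 : (sumC (map (simple_residue (simple_poles m u Y N L) (roots_up 0 N) (numer_roots v X N e)) (simple_poles m u Y N L)) +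
    sumC (map (double_residue (simple_poles m u Y N L) (roots_up 0 N) (numer_roots v X N e)) (roots_up 0 N))) * cutoff_norm N e L = 0) by (rewrite S; ring).
  rewrite Cmult_plus_distr_r, <- 2!sumC_scal_r in S2. fold R in S2.
  assert (Split : forall F : C -> C, sumC (map F (simple_poles m u Y N L)) =
     csum (fun j => F (- (1) - nC j)) m + csum (fun n => F (- u - nC n)) N +
     sumC (map (fun y => csum (fun n => F (1 - y + nC n)) N) Y) + csum (fun l => F (far_pole N l)) L).
  { intros F. unfold simple_poles. rewrite !map_app, !sumC_app, sumC_flat_map.
    unfold roots_down, roots_up, far_poles, csum. rewrite !map_map, !Cplus_assoc. do 2 f_equal. apply sumC_ext_in.
    intros y _. now rewrite map_map. }
  rewrite <- (Split R). etransitivity; [|exact S2]. clear S S2 Split. f_equal.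
  symmetry. unfold roots_up at 2. rewrite map_map. symmetry. apply csum_ext. intros k Hk. rewrite !Cplus_0_l.
  destruct HG as [Hu [HY HP]].
  rewrite double_residue_log.
  + rewrite log_derivative_exact by (auto; intros; now apply HY).
    assert (DE := double_coeff_exact m u v X Y N e L k Hk HXY (notInt_nonpole v Hv) (notInt_nonpole u Hu)
      ltac:(intros; now apply HY)).
    rewrite (Cplus_0_l (nC k)) in DE. rewrite <- DE. ring.
  + now apply numer_roots_notin.
  + intros Hin. destruct (NoDup_app_inv _ _ Hn) as [_ [_ HH]]. apply (HH _ Hin).
    replace (nC k) with (0 + nC k) by ring. now apply in_roots_up.
  + now apply root_prod2_roots_up0.
Qed.

(** * Decay of the residues at the cutoff poles *)

Lemma is_lim_Rpower_neg S : (0 < S)%R -> is_lim_seq (fun N => Rpower (INR N) (- S)) 0.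
Proof.
  intros HS. apply is_lim_seq_spec. intros eps. assert (He := cond_pos eps).
  destruct (INR_unbounded (exp (- ln eps / S))) as [N0 HN0]. exists N0. intros N HN.
  apply le_INR in HN. assert (P := exp_pos (- ln eps / S)).
  rewrite Rminus_0_r, Rabs_pos_eq by (left; apply Rpower_pos).
  rewrite <- (exp_ln eps) by auto. unfold Rpower. apply exp_increasing.
  assert (L : (- ln eps / S < ln (INR N))%R).
  { rewrite <- (ln_exp (- ln eps / S)). apply ln_increasing; auto. lra. }
  apply (Rmult_lt_compat_l S) in L; auto.
  replace (S * (- ln eps / S))%R with (- ln eps)%R in L by (field; lra). lra.
Qed.

(** When every factor of g has size at least N/2, the ratio of the products is at most (1 +
    2|d|/N)^N <= exp(2|d|). Hence, at distance of order N, shifting a whole progression costs only a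
    constant. *)
Lemma cprod_ratio (f g : nat -> C) (d : C) N : (0 < N)%nat ->
  (forall i, (i < N)%nat -> f i = g i + d) -> (forall i, (i < N)%nat -> (INR N / 2 <= Cmod (g i))%R) ->
  (Cmod (cprod f N) <= exp (2 * Cmod d) * Cmod (cprod g N))%R.
Proof.
  intros HN Hf Hg. assert (P : (0 < INR N)%R) by now apply lt_0_INR.
  assert (Hd := Cmod_ge_0 d).
  assert (Hz : forall i, (i < N)%nat -> g i <> 0).
  { intros i Hi. apply Cmod_gt_0. specialize (Hg i Hi). lra. }
  replace (cprod f N) with (cprod (fun i => 1 + d / g i) N * cprod g N).
  2:{ unfold cprod. rewrite <- prodC_mult. apply cprod_ext. intros i Hi. rewrite Hf by auto.
      specialize (Hz i Hi). field. auto. }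
  rewrite Cmod_mult. apply Rmult_le_compat_r; [apply Cmod_ge_0|].
  eapply Rle_trans; [apply (cprod_bound _ (fun _ => 2 * Cmod d / INR N)%R)|].
  - intros k Hk. specialize (Hg k Hk). rewrite Cmod_div by auto.
    apply Rle_trans with (Cmod d / (INR N / 2))%R.
    + apply Rmult_le_compat_l; auto. apply Rinv_le_contravar; lra.
    + right. field. lra.
  - intros _. apply Rle_mult_inv_pos; lra.
  - right. f_equal. transitivity (INR N * (2 * Cmod d / INR N))%R; [|field; lra].
    generalize (2 * Cmod d / INR N)%R as b. intros b. clear.
    induction N as [|N IH]; [simpl; ring|]. rewrite S_INR. simpl rsum. rewrite IH. ring.
Qed.

Definition off_roots_up (N : nat) (s z : C) : Prop :=
  forall i, (i < N)%nat -> (INR N / 2 <= Cmod (s - (z + nC i)))%R.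

Lemma roots_up_ratio x z N s : (0 < N)%nat -> off_roots_up N s z ->
  (Cmod (root_prod (roots_up x N) s) <= exp (2 * Cmod (z - x)) * Cmod (root_prod (roots_up z N) s))%R.
Proof.
  intros HN H. unfold root_prod, roots_up. rewrite !map_map.
  apply (cprod_ratio (fun i => s - (x + nC i)) (fun i => s - (z + nC i)) (z - x)); auto.
  intros i _. ring.
Qed.

Lemma roots_down_ratio x z N s : (0 < N)%nat -> (forall i, (i < N)%nat -> (INR N / 2 <= Cmod (s - (z - nC i)))%R) ->
  (Cmod (root_prod (roots_down x N) s) <= exp (2 * Cmod (z - x)) * Cmod (root_prod (roots_down z N) s))%R.
Proof.
  intros HN H. unfold root_prod, roots_down. rewrite !map_map.
  apply (cprod_ratio (fun i => s - (x - nC i)) (fun i => s - (z - nC i)) (z - x)); auto.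
  intros i _. ring.
Qed.

(** All progressions are compared with the single reference [roots_up 0 N], so that at a cutoff pole
    only powers of one quantity remain, and |X| = |Y| + 2 cancels them. *)
Lemma roots_ups_upper X : exists K, (0 <= K)%R /\ forall N s, (0 < N)%nat -> off_roots_up N s 0 ->
  (Cmod (root_prod (flat_map (fun x => roots_up (1 - x) N) X) s) <= K * Cmod (root_prod (roots_up 0 N) s) ^ length X)%R.
Proof.
  induction X as [|x X [K [HK0 HK]]].
  - exists 1%R. split; [lra|]. intros N s _ _. unfold root_prod; simpl. rewrite Cmod_1. lra.
  - exists (exp (2 * Cmod (0 - (1 - x))) * K)%R. split; [apply Rmult_le_pos; auto; left; apply exp_pos|].
    intros N s HN H. simpl. rewrite root_prod_app, Cmod_mult.
    replace (exp (2 * Cmod (0 - (1 - x))) * K * (Cmod (root_prod (roots_up 0 N) s) * Cmod (root_prod (roots_up 0 N) s) ^ length X))%R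
      with ((exp (2 * Cmod (0 - (1 - x))) * Cmod (root_prod (roots_up 0 N) s)) * (K * Cmod (root_prod (roots_up 0 N) s) ^ length X))%R by ring.
    apply Rmult_le_compat; auto using Cmod_ge_0. now apply roots_up_ratio.
Qed.

Lemma roots_ups_lower Y : exists K, (0 <= K)%R /\ forall N s, (0 < N)%nat -> (forall y, In y Y -> off_roots_up N s (1 - y)) ->
  (Cmod (root_prod (roots_up 0 N) s) ^ length Y <= K * Cmod (root_prod (flat_map (fun x => roots_up (1 - x) N) Y) s))%R.
Proof.
  induction Y as [|y Y [K [HK0 HK]]].
  - exists 1%R. split; [lra|]. intros N s _ _. unfold root_prod; simpl. rewrite Cmod_1. lra.
  - exists (exp (2 * Cmod ((1 - y) - 0)) * K)%R. split; [apply Rmult_le_pos; auto; left; apply exp_pos|].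
    intros N s HN H. simpl. rewrite root_prod_app, Cmod_mult.
    replace (exp (2 * Cmod (1 - y - 0)) * K * (Cmod (root_prod (roots_up (1 - y) N) s) * Cmod (root_prod (flat_map (fun x => roots_up (1 - x) N) Y) s)))%R
      with ((exp (2 * Cmod (1 - y - 0)) * Cmod (root_prod (roots_up (1 - y) N) s)) * (K * Cmod (root_prod (flat_map (fun x => roots_up (1 - x) N) Y) s)))%R by ring.
    apply Rmult_le_compat; auto using Cmod_ge_0, pow_le.
    + apply roots_up_ratio; auto. apply H. now left.
    + apply HK; auto. intros z Hz. apply H. now right.
Qed.

Lemma far_pole_dist N l z : (0 < N)%nat -> (2 * Rabs (Im z) <= INR N)%R -> (INR N / 2 <= Cmod (far_pole N l - z))%R.
Proof.
  intros HN Hz. eapply Rle_trans; [|apply Im_le_Cmod].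
  replace (Im (far_pole N l - z)) with (Im (far_pole N l) - Im z)%R by reflexivity. rewrite far_pole_Im.
  assert (P : (1 <= INR N)%R) by (apply (le_INR 1); lia).
  assert (Q : (1 <= INR (S l))%R) by (apply (le_INR 1); lia).
  assert (T := Rle_abs (Im z)). eapply Rle_trans; [|apply Rle_abs]. nra.
Qed.

Lemma far_pole_dist_int N l r : (0 < N)%nat -> Im r = 0%R -> (INR N <= Cmod (far_pole N l - r))%R.
Proof.
  intros HN Hz. eapply Rle_trans; [|apply Im_le_Cmod].
  replace (Im (far_pole N l - r)) with (Im (far_pole N l) - Im r)%R by reflexivity. rewrite far_pole_Im, Hz.
  assert (P : (1 <= INR N)%R) by (apply (le_INR 1); lia).
  assert (Q : (1 <= INR (S l))%R) by (apply (le_INR 1); lia).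
  eapply Rle_trans; [|apply Rle_abs]. nra.
Qed.

Lemma root_prod_scale c l s : root_prod (map (Cmult c) l) (c * s) = c ^ length l * root_prod l s.
Proof.
  induction l as [|r l IH]; [unfold root_prod; simpl; ring|]. cbn [map length]. rewrite 2!root_prod_cons, IH, Cpow_S. ring.
Qed.

Lemma root_prod1_scale c l s : c * root_prod1 (map (Cmult c) l) (c * s) = c ^ length l * root_prod1 l s.
Proof.
  induction l as [|r l IH]; [simpl; ring|]. cbn [map length root_prod1]. rewrite Cpow_S, root_prod_scale.
  replace (c * (c ^ length l * root_prod l s + (c * s - c * r) * root_prod1 (map (Cmult c) l) (c * s))) with
    (c * c ^ length l * root_prod l s + (c * (s - r)) * (c * root_prod1 (map (Cmult c) l) (c * s))) by ring.
  rewrite IH. ring.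
Qed.

(** The cutoff poles are N times these fixed points; rescaling isolates the powers of N and leaves
    constants depending only on L. *)
Definition far_dirs (L : nat) : list C := map (fun l => Ci * nC (S l)) (seq 0 L).

Lemma far_poles_scale N L : far_poles N L = map (Cmult (nC N)) (far_dirs L).
Proof. unfold far_poles, far_dirs, far_pole. now rewrite map_map. Qed.

Lemma cprod_lower (f : nat -> C) (r : R) n : (0 <= r)%R -> (forall i, (i < n)%nat -> (r <= Cmod (f i))%R) ->
  (r ^ n <= Cmod (cprod f n))%R.
Proof.
  intros Hr H. induction n as [|n IH]; [rewrite cprod_0, Cmod_1; simpl; lra|].
  rewrite cprod_S, Cmod_mult. simpl. rewrite Rmult_comm. apply Rmult_le_compat; auto using pow_le.
Qed.

Lemma NoDup_far_dirs L : NoDup (far_dirs L).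
Proof.
  assert (H := NoDup_far_poles 1 L ltac:(lia)). rewrite far_poles_scale in H.
  now apply NoDup_map_inv in H.
Qed.

(** The comparison of progressions leaves constants; the derivative of the cutoff denominator gives
    a factor N and (1+s)_m at most N^(-m). Divided by N^(Re(v-u-sum X+sum Y)+2), the residue is
    O(N^(-s0)), where s0 > 0 is the assumed inequality. *)
Lemma far_vanish m u v X Y e L l : (l < L)%nat -> length X = S (S (length Y)) ->
  (0 < Re (v - u - sumC X + sumC Y) + INR m + 1)%R ->
  cvgC (fun N => simple_residue (simple_poles m u Y N L) (roots_up 0 N) (numer_roots v X N e) (far_pole N l) * cutoff_norm N e L
     / cpow (INR N) (v - u - sumC X + sumC Y + 2)) 0.
Proof.
  intros Hl HXY HS.
  (* Below, [z0] and [c0] are the N-independent contributions of the zeros and the other poles of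
     the cutoff at s = N w. *)
  destruct (roots_ups_upper X) as [K1 [HK10 HK1]]. destruct (roots_ups_lower Y) as [K2 [HK20 HK2]].
  set (w := Ci * nC (S l)). set (z0 := (1 - w * w) ^ e).
  assert (Hwin : In w (far_dirs L)).
  { unfold far_dirs. apply (in_map (fun l => Ci * nC (S l))). apply in_seq. lia. }
  assert (Hd0 : root_prod1 (far_dirs L) w <> 0) by (apply root_prod1_in_neq0; auto using NoDup_far_dirs).
  set (c0 := root_prod (far_dirs L) 0 / root_prod1 (far_dirs L) w).
  set (growth_exp := v - u - sumC X + sumC Y + 2).
  set (s0 := (Re (v - u - sumC X + sumC Y) + INR m + 1)%R) in *.
  assert (Hev : exists N1, forall N, (N1 <= N)%nat -> (2 * Rabs (Im u) <= INR N)%R /\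
     forall y, In y Y -> (2 * Rabs (Im y) <= INR N)%R).
  { destruct (INR_unbounded (2 * Rabs (Im u))) as [N1 H1].
    assert (H : exists N2, forall N, (N2 <= N)%nat -> forall y, In y Y -> (2 * Rabs (Im y) <= INR N)%R).
    { clear. induction Y as [|y Y [N2 H2]].
      - exists 0%nat. intros N _ y [].
      - destruct (INR_unbounded (2 * Rabs (Im y))) as [N3 H3]. exists (Nat.max N2 N3). intros N HN z [<-|Hz].
        + assert (Q : (INR N3 <= INR N)%R) by (apply le_INR; lia). lra.
        + apply H2; auto; lia. }
    destruct H as [N2 H2]. exists (Nat.max N1 N2). intros N HN. split.
    - assert (Q : (INR N1 <= INR N)%R) by (apply le_INR; lia). lra.
    - apply H2; lia. }
  destruct Hev as [N1 HN1].
  set (E1 := exp (2 * Cmod (- u - - v))).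
  apply (cvgC_squeeze _ _ (fun N => (Cmod (z0 * c0) * (E1 * (K1 * K2))) * Rpower (INR N) (- s0))%R (S N1)).
  2:{ replace (Finite 0) with (Rbar_mult (Cmod (z0 * c0) * (E1 * (K1 * K2)))%R 0) by (simpl; f_equal; ring).
      apply is_lim_seq_scal_l. now apply is_lim_Rpower_neg. }
  intros N HN. destruct (HN1 N ltac:(lia)) as [Hu HY].
  assert (HNp : (0 < N)%nat) by lia. assert (HNC := nC_neq0 N HNp).
  assert (P : (0 < INR N)%R) by now apply lt_0_INR.
  set (s := far_pole N l). assert (Hs : s = nC N * w) by reflexivity.
  assert (Off0 : off_roots_up N s 0).
  { intros i Hi. unfold s. assert (Q := far_pole_dist_int N l (0 + nC i) HNp).
    rewrite Cplus_0_l in Q |- *. specialize (Q (Im_nC i)). lra. }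
  assert (OffY : forall y, In y Y -> off_roots_up N s (1 - y)).
  { intros y Hy i Hi. apply far_pole_dist; auto.
    replace (Im (1 - y + nC i)) with (- Im y)%R by (unfold nC, RtoC, Cplus, Cminus, Copp, Im; simpl; ring).
    rewrite Rabs_Ropp. auto. }
  assert (OffU : forall i, (i < N)%nat -> (INR N / 2 <= Cmod (s - (- u - nC i)))%R).
  { intros i Hi. apply far_pole_dist; auto.
    replace (Im (- u - nC i)) with (- Im u)%R by (unfold nC, RtoC, Cplus, Cminus, Copp, Im; simpl; ring).
    rewrite Rabs_Ropp. auto. }
  assert (Hrho : root_prod (roots_up 0 N) s <> 0).
  { apply root_prod_notin. intros Hin. apply in_roots_up_inv in Hin. destruct Hin as [i [Hi E]].
    specialize (Off0 i Hi). rewrite <- E in Off0. replace (s - s) with (RtoC 0) in Off0 by ring.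
    rewrite Cmod_0 in Off0. lra. }
  assert (Htau : root_prod (roots_down (- u) N) s <> 0).
  { apply root_prod_notin. intros Hin. apply in_roots_down_inv in Hin. destruct Hin as [i [Hi E]].
    specialize (OffU i Hi). rewrite <- E in OffU. replace (s - s) with (RtoC 0) in OffU by ring.
    rewrite Cmod_0 in OffU. lra. }
  assert (HYn : root_prod (flat_map (fun y => roots_up (1 - y) N) Y) s <> 0).
  { apply root_prod_notin. intros Hin. apply in_flat_map in Hin. destruct Hin as [y [Hy Hin]].
    apply in_roots_up_inv in Hin. destruct Hin as [i [Hi E]].
    specialize (OffY y Hy i Hi). rewrite <- E in OffY. replace (s - s) with (RtoC 0) in OffY by ring.
    rewrite Cmod_0 in OffY. lra. }
  assert (HM : (INR N ^ m <= Cmod (root_prod (roots_down (- (1)) m) s))%R).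
  { unfold root_prod, roots_down. rewrite map_map. apply (cprod_lower (fun i => s - (- (1) - nC i))); [lra|].
    intros i _. apply far_pole_dist_int; auto. unfold nC, RtoC, Cplus, Cminus, Copp, Im; simpl; ring. }
  assert (PN : (0 < INR N ^ m)%R) by now apply pow_lt.
  assert (HMn : root_prod (roots_down (- (1)) m) s <> 0) by (apply Cmod_gt_0; lra).
  assert (B1 := roots_down_ratio (- v) (- u) N s HNp OffU). fold E1 in B1.
  specialize (HK1 N s HNp Off0). specialize (HK2 N s HNp OffY).
  assert (HZ : root_prod (edge_zeros N e) s / root_prod (edge_zeros N e) 0 = z0).
  { rewrite 2!root_prod_edge_zeros, <- Cpow_div.
    - unfold z0. f_equal. rewrite Hs. field. auto.
    - replace ((0 - nC N) * (0 + nC N)) with (- (1) * (nC N * nC N)) by ring.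
      repeat apply Cmult_neq_0; auto. intros E. injection E. lra. }
  assert (HF : root_prod (far_poles N L) 0 / root_prod1 (far_poles N L) s = nC N * c0 /\ root_prod1 (far_poles N L) s <> 0).
  { assert (D := root_prod1_scale (nC N) (far_dirs L) w). rewrite <- far_poles_scale, <- Hs in D.
    assert (Q := root_prod_scale (nC N) (far_dirs L) 0). rewrite <- far_poles_scale, Cmult_0_r in Q.
    assert (W : nC N ^ length (far_dirs L) <> 0) by now apply Cpow_nz.
    assert (D2 : root_prod1 (far_poles N L) s <> 0).
    { intros E. rewrite E, Cmult_0_r in D. apply (Cmult_neq_0 _ _ W Hd0). auto. }
    split; auto. rewrite Q. unfold c0.
    replace (root_prod1 (far_poles N L) s) with (nC N ^ length (far_dirs L) * root_prod1 (far_dirs L) w / nC N) by (rewrite <- D; field; auto).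
    field. auto. }
  destruct HF as [HF HFn].
  assert (HZ0 := root_prod_edge_zeros0_neq0 N e HNp).
  assert (HA : root_prod1 (simple_poles m u Y N L) s = root_prod (roots_down (- (1)) m) s * root_prod (roots_down (- u) N) s *
     root_prod (flat_map (fun y => roots_up (1 - y) N) Y) s * root_prod1 (far_poles N L) s).
  { unfold simple_poles. rewrite !app_assoc, root_prod1_app, !root_prod_app, (root_prod_in (far_poles N L)).
    - ring.
    - unfold far_poles. apply (in_map (far_pole N)). apply in_seq. lia. }
  replace (simple_residue (simple_poles m u Y N L) (roots_up 0 N) (numer_roots v X N e) s * cutoff_norm N e L / cpow (INR N) growth_exp - 0) with
    ((z0 * c0) * (nC N * (root_prod (roots_down (- v) N) s * / root_prod (roots_down (- u) N) s) * 
      (root_prod (flat_map (fun x => roots_up (1 - x) N) X) s * / (root_prod (flat_map (fun y => roots_up (1 - y) N) Y) s * (root_prod (roots_up 0 N) s * root_prod (roots_up 0 N) s)))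
      * / root_prod (roots_down (- (1)) m) s * / cpow (INR N) growth_exp)).
  2:{ unfold simple_residue. rewrite HA. unfold numer_roots. rewrite 2!root_prod_app. unfold cutoff_norm.
      replace (z0 * c0) with (z0 * (nC N * c0) * / nC N) by (field; auto). rewrite <- HZ, <- HF.
      field. repeat split; auto using cpow_neq0. }
  assert (Pt := proj1 (Cmod_gt_0 _) Htau). assert (Pr := proj1 (Cmod_gt_0 _) Hrho).
  assert (Py := proj1 (Cmod_gt_0 _) HYn). assert (Pm := proj1 (Cmod_gt_0 _) HMn).
  rewrite Cmod_mult, Rmult_assoc. apply Rmult_le_compat_l; [apply Cmod_ge_0|].
  rewrite !Cmod_mult, !Cmod_inv, !Cmod_mult, Cmod_nC, Cmod_cpow
    by (repeat apply Cmult_neq_0; auto using cpow_neq0).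
  rewrite HXY in HK1. simpl in HK1.
  set (tau := Cmod (root_prod (roots_down (- u) N) s)) in *. set (rho := Cmod (root_prod (roots_up 0 N) s)) in *.
  set (yy := Cmod (root_prod (flat_map (fun y => roots_up (1 - y) N) Y) s)) in *.
  set (vv := Cmod (root_prod (roots_down (- v) N) s)) in *. set (xx := Cmod (root_prod (flat_map (fun x => roots_up (1 - x) N) X) s)) in *.
  set (mm := Cmod (root_prod (roots_down (- (1)) m) s)) in *.
  assert (C1 : (vv * / tau <= E1)%R) by (apply Rle_div_l; lra).
  assert (Pyr : (0 < yy * (rho * rho))%R)
    by (apply Rmult_lt_0_compat; [exact Py | apply Rmult_lt_0_compat; exact Pr]).
  assert (C2 : (xx * / (yy * (rho * rho)) <= K1 * K2)%R).
  { apply Rle_div_l; [exact Pyr|]. eapply Rle_trans; [exact HK1|].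
    replace (K1 * (rho * (rho * rho ^ length Y)))%R with (K1 * ((rho * rho) * rho ^ length Y))%R by ring.
    replace (K1 * K2 * (yy * (rho * rho)))%R with (K1 * ((rho * rho) * (K2 * yy)))%R by ring.
    apply Rmult_le_compat_l; auto. apply Rmult_le_compat_l; auto.
    apply Rmult_le_pos; apply Cmod_ge_0. }
  assert (C3 : (/ mm <= / INR N ^ m)%R) by now apply Rinv_le_contravar.
  assert (Q1 : (0 <= vv * / tau)%R) by (apply Rle_mult_inv_pos; auto; apply Cmod_ge_0).
  assert (Q2 : (0 <= xx * / (yy * (rho * rho)))%R) by (apply Rle_mult_inv_pos; [apply Cmod_ge_0 | exact Pyr]).
  assert (HE1 : (0 < E1)%R) by apply exp_pos.
  assert (Rk := Rpower_pos (INR N) (Re growth_exp)).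
  assert (F : (INR N * / INR N ^ m * / Rpower (INR N) (Re growth_exp) = Rpower (INR N) (- s0))%R).
  { rewrite <- Rpower_pow by auto. rewrite <- (Rpower_1 (INR N)) at 1 by auto.
    rewrite <- 2!Rpower_Ropp, <- 2!Rpower_plus. f_equal. unfold s0, growth_exp. rewrite Re_plus, Re_RtoC. ring. }
  replace (E1 * (K1 * K2) * Rpower (INR N) (- s0))%R with
    (INR N * E1 * (K1 * K2) * / INR N ^ m * / Rpower (INR N) (Re growth_exp))%R by (rewrite <- F; ring).
  apply Rmult_le_compat_r; [left; now apply Rinv_0_lt_compat|].
  apply Rmult_le_compat; auto.
  - apply Rmult_le_pos; auto. apply Rmult_le_pos; auto. lra.
  - left; now apply Rinv_0_lt_compat.
  - apply Rmult_le_compat; auto.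
    + apply Rmult_le_pos; auto. lra.
    + apply Rmult_le_compat_l; lra.
Qed.

(** * The limit of the residue identity *)

Definition int_residue_lim (m : nat) (u v : C) (X Y : list C) (j : nat) : C :=
  poch_over_fact (2 - v) j * RGamma (v - 1) * / (poch_over_fact (2 - u) j * RGamma (u - 1)) * left_core_lim X Y (- (1)) j *
  (sgn1 j * / (nC (fact j) * nC (fact (m - j - 1)))).
Definition left_residue_lim (m : nat) (u v : C) (X Y : list C) (n : nat) : C :=
  poch_over_fact (1 - v + u) n * RGamma (v - u) * left_core_lim X Y (- u) n * (sgn1 m * / poch (u - nC m + nC n) m).
Definition right_residue_lim (m : nat) (u v : C) (X Y : list C) (y : C) (n : nat) : C :=
  - (right_core_lim v u X Y (1 - y) n *
     (/ (poch_over_fact (2 - y) n * RGamma (y - 1)) * / (poch_over_fact (2 - y) n * RGamma (y - 1))) * / poch (2 - y + nC n) m).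
Definition double_coeff_lim (m : nat) (u v : C) (X Y : list C) (k : nat) : C :=
  right_core_lim v u X Y 0 k * / poch (1 + nC k) m.

(** The power of N common to the residues at all the original poles; dividing by it makes every
    family converge simultaneously. *)
Definition growth_exp (u v : C) (X Y : list C) : C := v - u - sumC X + sumC Y + 2.

(** Removal by index, in the same [filter] form as [dvk] in the theorem. *)
Definition others (I : list nat) (k : nat) : list nat := filter (fun i => negb (Nat.eqb i k)) I.

Lemma filter_neq_id k (l : list nat) : ~ In k l -> others l k = l.
Proof.
  unfold others. induction l as [|a l IH]; intros H; [reflexivity|]. simpl.
  destruct (Nat.eqb_spec a k) as [->|]; [exfalso; apply H; now left|]. simpl. f_equal. apply IH.
  intros X; apply H; now right.
Qed.

Lemma others_split I k : In k I -> NoDup I -> exists I1 I2, I = I1 ++ k :: I2 /\ others I k = I1 ++ I2.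
Proof.
  intros Hk Hn. apply in_split in Hk. destruct Hk as [I1 [I2 ->]]. exists I1, I2. split; auto.
  apply NoDup_remove_2 in Hn. rewrite in_app_iff in Hn.
  unfold others. rewrite filter_app. simpl. rewrite Nat.eqb_refl. simpl.
  f_equal; apply filter_neq_id; tauto.
Qed.

Lemma in_others I k i : In i (others I k) -> In i I /\ i <> k.
Proof.
  unfold others. intros H. apply filter_In in H. destruct H as [H1 H2]. split; auto.
  intros ->. rewrite Nat.eqb_refl in H2. discriminate.
Qed.

Lemma asymp_series F z f a b : asymp F z f a b -> (a < -1)%R -> (0 <= b)%R ->
  cvgC (csum f) (CSeries f) /\
  cvgC (fun N => csum (fun n => F N n / cpow (INR N) z) N) (CSeries f).
Proof.
  intros H Ha Hb. destruct (asymp_tannery F z f a b H Ha Hb) as [_ [l [H1 H2]]].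
  rewrite (cvgC_CSeries f l H1). auto.
Qed.

Lemma csum_div (f : nat -> C) (c : C) n : csum (fun k => f k / c) n = csum f n / c.
Proof. unfold Cdiv. unfold csum. now rewrite sumC_scal_r. Qed.

(** The identity at level N is divided by N^growth_exp and each family of residues passes to its
    limit. Convergence is returned together with the identity, because the values of [CSeries]
    cannot be rescaled or subtracted without it. *)
Lemma limit_identity m (u v : C) (X : list C) (d : nat -> C) (I : list nat) :
  let Y := map d I in
  NoDup I -> notInt u -> notInt v ->
  (forall x, In x X -> notInt x /\ notInt (x - u)) ->
  (forall i, In i I -> notInt (d i) /\ notInt (d i - u) /\ notInt (d i - v)) ->
  (forall i j, In i I -> In j I -> i <> j -> notInt (d i - d j)) ->
  length X = S (S (length I)) ->
  (0 < Re (v - u - sumC X + sumC Y) + INR m + 1)%R ->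
  let fD := fun k => double_coeff_lim m u v X Y k * log_deriv_lim m u v X Y k in
  cvgC (csum (double_coeff_lim m u v X Y)) (CSeries (double_coeff_lim m u v X Y)) /\
  cvgC (csum fD) (CSeries fD) /\
  cvgC (csum (left_residue_lim m u v X Y)) (CSeries (left_residue_lim m u v X Y)) /\
  (forall k, In k I -> let f := right_residue_lim m u v X (map d (others I k)) (d k) in cvgC (csum f) (CSeries f)) /\
  csum (int_residue_lim m u v X Y) m + CSeries (left_residue_lim m u v X Y) +
  sumC (map (fun k => CSeries (right_residue_lim m u v X (map d (others I k)) (d k))) I) + CSeries fD = 0.
Proof.
  intros Y HI Hu Hv HX HYI HYY HXY HS fD.
  assert (LY : length Y = length I) by (unfold Y; now rewrite length_map).
  assert (HXY' : length X = S (S (length Y))) by now rewrite LY.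
  assert (HY : forall y, In y Y -> notInt y /\ notInt (y - u) /\ notInt (y - v)).
  { intros y Hy. unfold Y in Hy. apply in_map_iff in Hy. destruct Hy as [i [<- Hi]]. auto. }
  set (S0 := (Re (v - u - sumC X + sumC Y) + INR m + 1)%R) in *.
  (* These are the exponents of 1 - n/N on the right and left progressions after the cutoff has
     added e; both must be nonnegative for Tannery's theorem. *)
  assert (He : exists e : nat, (0 <= Re (sumC Y - sumC X + 2) + INR e)%R /\ (0 <= Re (v - u) + INR e)%R).
  { destruct (INR_unbounded (Rabs (Re (sumC Y - sumC X + 2)) + Rabs (Re (v - u)))) as [e He]. exists e.
    assert (A := Rle_abs (- Re (sumC Y - sumC X + 2))). assert (B := Rle_abs (- Re (v - u))).
    rewrite Rabs_Ropp in A, B.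
    assert (A' := Rabs_pos (Re (sumC Y - sumC X + 2))). assert (B' := Rabs_pos (Re (v - u))). lra. }
  (* [L] is chosen so that 2e + 2 <= m + L holds even for m = 0. *)
  destruct He as [e [He1 He2]]. set (L := (2 * e + 2)%nat).
  assert (np := notInt_nonpole).
  (* On every infinite progression the exponent of n is -S0 - 1, below -1 precisely because S0 >
     0. *)
  assert (asyD0 : asymp (fun N k => right_core v u X Y 0 N k * (nC (N - k) * nC (N - k)) * / poch (1 + nC k) m * cutoff e L N (0 + nC k))
     (growth_exp u v X Y) (double_coeff_lim m u v X Y) (- S0 - 1) (Re (sumC Y - sumC X + 2) + INR e)).
  { assert (A := asymp_right_core v u X Y 0 ltac:(rewrite Cplus_0_l; auto) ltac:(rewrite Cplus_0_l; auto)).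
    assert (G := asymp_gap).
    eapply asymp_ext; [| | | | |apply asymp_mult; [apply asymp_mult; [apply asymp_mult; [apply A | apply asymp_mult; [exact G | exact G]] |
       apply (asymp_poch_shift_inv 1 m (nonpole_nC_S 0))] | apply (asymp_cutoff_right e L 0)]].
    - reflexivity.
    - intros n. cbv beta. unfold double_coeff_lim. ring.
    - unfold growth_exp. ring.
    - rewrite HXY', !nC_S.
      replace (u - v + (sumC X + (nC (length Y) + 1 + 1) * (0 - 1)) - (sumC Y + nC (length Y) * (0 - 1)))
        with (- (v - u - sumC X + sumC Y) - 2) by ring.
      unfold S0. rewrite Re_minus, Re_opp, !Re_RtoC. ring.
    - replace (- sumC X - nC (length X) * 0 + sumC Y + nC (length Y) * 0) with (sumC Y - sumC X) by ring.
      rewrite Re_plus, !Re_RtoC. ring.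
    - intros y Hy. destruct (HY y Hy) as [H1 _]. split; apply np.
      + replace (1 - y - 0) with (1 - y) by ring. now apply notInt_1_sub.
      + now rewrite Cplus_0_r. }
  assert (blL : bounded_limit (log_deriv m u v X Y e L) (log_deriv_lim m u v X Y)).
  { apply bounded_limit_log_deriv; auto.
    - intros x Hx. destruct (HX x Hx) as [H1 _]. split; apply np; auto. now apply (notInt_nat_sub x 2).
    - intros y Hy. destruct (HY y Hy) as [H1 _]. split; apply np; auto. now apply (notInt_nat_sub y 2). }
  assert (asyD := asymp_mult _ _ _ _ _ _ _ _ _ _ asyD0 (asymp_bounded_limit _ _ blL)).
  assert (asyU : asymp (fun N n => near_poch (- u + v) N n * nC (N - n) * left_core X Y (- u) N n * (sgn1 m * / poch (u - nC m + nC n) m) *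
     cutoff e L N (- u - nC n)) (growth_exp u v X Y) (left_residue_lim m u v X Y) (- S0 - 1) (Re (v - u) + INR e)).
  { assert (A : asymp (left_core X Y (- u)) (- sumC X + sumC Y + 2) (left_core_lim X Y (- u)) (Re (sumC X - sumC Y - 2)) (Re 0)).
    { apply asymp_left_core; auto.
      - replace (- - u) with u by ring. auto.
      - intros x Hx. replace (1 - x - - u) with (1 - (x - u)) by ring. apply np, notInt_1_sub, HX, Hx.
      - intros y Hy. replace (1 - y - - u) with (1 - (y - u)) by ring. apply np, notInt_1_sub, HY, Hy. }
    assert (Pm : asymp (fun _ n => sgn1 m * / poch (u - nC m + nC n) m) 0 (fun n => sgn1 m * / poch (u - nC m + nC n) m) (- INR m) 0).
    { eapply asymp_ext; [| | | | |apply asymp_mult; [apply (asymp_const (fun _ => sgn1 m) 0) |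
        apply (asymp_poch_shift_inv (u - nC m) m)]]; try reflexivity; try (rewrite ?Re_0; ring).
      - exists (Cmod (sgn1 m)). split; [apply Cmod_ge_0|]. intros n. rewrite succ_pow_0. lra.
      - apply np. now apply notInt_sub_nat. }
    eapply asymp_ext; [| | | | |apply asymp_mult; [apply asymp_mult; [apply asymp_mult; [apply asymp_mult;
      [apply (asymp_near' (- u + v)) | exact asymp_gap] | exact A] | exact Pm] | apply (asymp_cutoff_left e L (- u))]].
    - reflexivity.
    - intros n. cbv beta. unfold left_residue_lim. replace (1 - (- u + v)) with (1 - v + u) by ring.
      replace (- u + v) with (v - u) by ring. ring.
    - unfold growth_exp. ring.
    - unfold S0. rewrite !Re_minus, !Re_plus, !Re_minus, Re_opp, Re_plus, Re_opp, !Re_RtoC. ring.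
    - rewrite ?Re_0, !Re_minus, !Re_plus, Re_opp, Re_1. ring. }
  assert (asyY : forall k, In k I -> asymp (fun N n => - (right_core v u X (map d (others I k)) (1 - d k) N n * nC (N - n) *
      (/ near_poch (d k - 1) N n * / near_poch (d k - 1) N n) * / poch (2 - d k + nC n) m * cutoff e L N (1 - d k + nC n)))
     (growth_exp u v X Y) (right_residue_lim m u v X (map d (others I k)) (d k)) (- S0 - 1) (Re (sumC Y - sumC X + 2) + INR e)).
  { intros k Hk. destruct (others_split I k Hk HI) as [I1 [I2 [EI EO]]].
    set (y := d k). destruct (HYI k Hk) as [Hy1 [Hy2 Hy3]]. fold y in Hy1, Hy2, Hy3.
    set (Y' := map d (others I k)).
    assert (SY : sumC Y = y + sumC Y').
    { unfold Y, Y'. rewrite EI at 1. rewrite EO, !map_app, !sumC_app. cbn [map]. rewrite sumC_cons. fold y. ring. }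
    assert (LX : length X = S (S (S (length Y')))).
    { rewrite HXY. unfold Y'. rewrite length_map, EO, EI, !length_app. simpl. lia. }
    assert (A : asymp (right_core v u X Y' (1 - y)) (v - u - sumC X + sumC Y' - nC (length X) * (1 - y) + nC (length Y') * (1 - y))
      (right_core_lim v u X Y' (1 - y))
      (Re (u - v + (sumC X + nC (length X) * (1 - y - 1)) - (sumC Y' + nC (length Y') * (1 - y - 1))))
      (Re (- sumC X - nC (length X) * (1 - y) + sumC Y' + nC (length Y') * (1 - y)))).
    { apply asymp_right_core.
      - replace (1 - y + v) with (1 - (y - v)) by ring. now apply np, notInt_1_sub.
      - replace (1 - y + u) with (1 - (y - u)) by ring. now apply np, notInt_1_sub.
      - intros z Hz. unfold Y' in Hz. apply in_map_iff in Hz. destruct Hz as [i [<- Hi]].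
        apply in_others in Hi. destruct Hi as [Hi Hik].
        assert (Q : notInt (y - d i)) by (apply HYY; auto).
        split; apply np.
        + now replace (1 - d i - (1 - y)) with (y - d i) by ring.
        + replace (d i + (1 - y)) with (1 - (y - d i)) by ring. now apply notInt_1_sub. }
    assert (N1 : notInt (y - 1)) by now apply (notInt_sub_nat y 1).
    assert (B := asymp_near_inv' (y - 1) (np _ N1) (np _ (notInt_1_sub _ N1))).
    assert (P2 : nonpole (2 - y)) by now apply np, (notInt_nat_sub y 2).
    eapply asymp_ext; [| | | | |apply asymp_mult; [apply (asymp_const (fun _ => - (1)) 0) | apply asymp_mult; [apply asymp_mult; [apply asymp_mult; [apply asymp_mult;
      [exact A | exact asymp_gap] | apply asymp_mult; [exact B | exact B]] | apply (asymp_poch_shift_inv (2 - y) m P2)] | apply (asymp_cutoff_right e L (1 - y))]]].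
    - intros N n _. cbv beta. ring.
    - intros n. cbv beta. unfold right_residue_lim. replace (1 - (y - 1)) with (2 - y) by ring. ring.
    - unfold growth_exp. rewrite SY, LX, !nC_S. ring.
    - unfold S0. rewrite SY, LX, !nC_S.
      replace (u - v + (sumC X + (nC (length Y') + 1 + 1 + 1) * (1 - y - 1)) - (sumC Y' + nC (length Y') * (1 - y - 1)))
        with (u - v + sumC X - sumC Y' - y - y - y) by ring.
      rewrite !Re_minus, !Re_plus, !Re_minus, !Re_1. ring.
    - rewrite SY, LX, !nC_S.
      replace (- sumC X - (nC (length Y') + 1 + 1 + 1) * (1 - y) + sumC Y' + nC (length Y') * (1 - y))
        with (sumC Y' - sumC X + y + y + y - 1 - 1 - 1) by ring.
      rewrite !Re_minus, !Re_plus, !Re_minus, !Re_plus, !Re_RtoC. ring.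
    - exists 1%R. split; [lra|]. intros n. rewrite succ_pow_0, Cmod_opp, Cmod_1. lra. }
  (* The poles -1, ..., -m are fixed in number, so pointwise limits suffice here. *)
  assert (asyM : forall j, (j < m)%nat -> cvgC (fun N => near_poch (- (1) + v) N j * / near_poch (- (1) + u) N j * left_core X Y (- (1)) N j *
     (sgn1 j * / (nC (fact j) * nC (fact (m - j - 1)))) * cutoff e L N (- (1) - nC j) / cpow (INR N) (growth_exp u v X Y)) (int_residue_lim m u v X Y j)).
  { intros j Hj.
    assert (A : asymp (left_core X Y (- (1))) (- sumC X + sumC Y + 2) (left_core_lim X Y (- (1))) (Re (sumC X - sumC Y - 2)) (Re 0)).
    { apply asymp_left_core; auto.
      - replace (- - (1)) with (RtoC 1) by ring. apply (nonpole_nC_S 0).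
      - intros x Hx. replace (1 - x - - (1)) with (nC 2 - x) by (change (nC 2) with (RtoC 2); ring). apply np, notInt_nat_sub, HX, Hx.
      - intros y Hy. replace (1 - y - - (1)) with (nC 2 - y) by (change (nC 2) with (RtoC 2); ring). apply np, notInt_nat_sub, HY, Hy. }
    assert (N1 : notInt (- (1) + u)) by (replace (- (1) + u) with (u - nC 1) by (change (nC 1) with (RtoC 1); ring); now apply notInt_sub_nat).
    assert (B := asymp_near_inv' _ (np _ N1) (np _ (notInt_1_sub _ N1))).
    assert (D := asymp_mult _ _ _ _ _ _ _ _ _ _ (asymp_mult _ _ _ _ _ _ _ _ _ _ (asymp_mult _ _ _ _ _ _ _ _ _ _ (asymp_near' (- (1) + v)) B) A)
       (asymp_cutoff_left e L (- (1)))).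
    destruct D as [D _]. specialize (D j).
    assert (D' := cvgC_mult _ _ _ _ D (cvgC_const (sgn1 j * / (nC (fact j) * nC (fact (m - j - 1)))))).
    eapply cvgC_lim_eq; [eapply cvgC_ext; [|exact D']|].
    - intros N. cbv beta. replace (- (1) + v - 1 + (1 - (- (1) + u)) + (- sumC X + sumC Y + 2) + 0) with (growth_exp u v X Y) by (unfold growth_exp; ring).
      unfold Cdiv. ring.
    - cbv beta. unfold int_residue_lim. replace (1 - (- (1) + v)) with (2 - v) by ring. replace (1 - (- (1) + u)) with (2 - u) by ring.
      replace (- (1) + v) with (v - 1) by ring. replace (- (1) + u) with (u - 1) by ring. ring. }
  assert (Ha : (- S0 - 1 < -1)%R) by lra.
  destruct (asymp_series _ _ _ _ _ asyD0 Ha He1) as [D01 _].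
  assert (Ha' : (- S0 - 1 + 0 < -1)%R) by lra.
  destruct (asymp_series _ _ _ _ _ asyD Ha' ltac:(lra)) as [D1 D2].
  destruct (asymp_series _ _ _ _ _ asyU Ha He2) as [U1 U2].
  assert (Y12 := fun k Hk => asymp_series _ _ _ _ _ (asyY k Hk) Ha He1).
  split; [exact D01|]. split; [exact D1|]. split; [exact U1|].
  split; [intros k Hk; apply (proj1 (Y12 k Hk))|].
  destruct (poles_far_ev u Y) as [N0 HN0].
  assert (HG : poles_generic u Y).
  { split; auto. split; [intros y Hy; destruct (HY y Hy) as [? [? ?]]; auto|].
    unfold Y. clear - HI HYY. induction I as [|i I IH]; [constructor|]. simpl. inversion HI; subst. constructor.
    - rewrite Forall_forall. intros z Hz. apply in_map_iff in Hz. destruct Hz as [j [<- Hj]].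
      apply HYY; [now left | now right | intros ->; auto].
    - apply IH; auto. intros a b Ha Hb. apply HYY; now right. }
  set (R := fun N a => simple_residue (simple_poles m u Y N L) (roots_up 0 N) (numer_roots v X N e) a * cutoff_norm N e L).
  set (K := growth_exp u v X Y) in *.
  assert (TM : cvgC (fun N => csum (fun j => R N (- (1) - nC j)) m / cpow (INR N) K) (csum (int_residue_lim m u v X Y) m)).
  { eapply cvgC_ext; [intros N; apply csum_div|].
    apply (cvgC_csum (fun N j => R N (- (1) - nC j) / cpow (INR N) K)). intros j Hj.
    eapply (cvgC_ext_loc _ _ _ (S j)); [|apply (asyM j Hj)]. intros N HN. cbv beta. f_equal. symmetry.
    unfold R. apply simple_int_exact; auto; try lia.
    - intros x Hx. apply np, (notInt_nat_sub x 2), HX, Hx.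
    - intros y Hy. apply np, (notInt_nat_sub y 2), HY, Hy. }
  assert (TU : cvgC (fun N => csum (fun n => R N (- u - nC n)) N / cpow (INR N) K) (CSeries (left_residue_lim m u v X Y))).
  { eapply cvgC_ext; [intros N; apply csum_div|].
    eapply (cvgC_ext_loc _ _ _ N0); [|exact U2]. intros N HN. cbv beta. apply csum_ext. intros n Hn.
    f_equal. symmetry. unfold R. destruct (HN0 N HN) as [_ [Q _]].
    apply simple_left_exact; auto.
    - intros x Hx. replace (1 - x + u) with (1 - (x - u)) by ring. apply np, notInt_1_sub, HX, Hx.
    - intros y Hy. replace (1 - y + u) with (1 - (y - u)) by ring. apply np, notInt_1_sub, HY, Hy. }
  assert (TY : cvgC (fun N => sumC (map (fun y => csum (fun n => R N (1 - y + nC n)) N) Y) / cpow (INR N) K)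
     (sumC (map (fun k => CSeries (right_residue_lim m u v X (map d (others I k)) (d k))) I))).
  {
    apply (cvgC_ext (fun N => sumC (map (fun k => csum (fun n => R N (1 - d k + nC n)) N / cpow (INR N) K) I))).
    { intros N. unfold Cdiv. rewrite sumC_scal_r. unfold Y. now rewrite map_map. }
    apply (cvgC_sumC (fun N k => csum (fun n => R N (1 - d k + nC n)) N / cpow (INR N) K)).
    intros k Hk. eapply cvgC_ext; [intros N; apply csum_div|].
    eapply (cvgC_ext_loc _ _ _ N0); [|exact (proj2 (Y12 k Hk))].
    intros N HN. cbv beta. apply csum_ext. intros n Hn. f_equal. symmetry.
    destruct (others_split I k Hk HI) as [I1 [I2 [EI EO]]].
    unfold R. rewrite EO, map_app.
    apply (simple_right_exact m u v X Y (map d I1) (d k) (map d I2) N e L n Hn); auto.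
    - unfold Y. rewrite EI, map_app. reflexivity.
    - destruct (HN0 N HN) as [_ [_ Q]]. apply Q. unfold Y. now apply in_map.
    - replace (1 - d k + v) with (1 - (d k - v)) by ring. apply np, notInt_1_sub. now apply HYI.
    - replace (1 - d k + u) with (1 - (d k - u)) by ring. apply np, notInt_1_sub. now apply HYI.
    - now apply HYI.
    - intros z Hz. rewrite <- map_app, <- EO in Hz. apply in_map_iff in Hz. destruct Hz as [i [<- Hi]].
      apply in_others in Hi. destruct Hi as [Hi Hik]. apply HYY; auto. }
  assert (TF : cvgC (fun N => csum (fun l => R N (far_pole N l)) L / cpow (INR N) K) 0).
  { apply (cvgC_lim_eq _ (csum (fun _ => RtoC 0) L)); [|apply sumC_zero].
    eapply cvgC_ext; [intros N; apply csum_div|].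
    apply (cvgC_csum (fun N l => R N (far_pole N l) / cpow (INR N) K)). intros l Hl.
    unfold R, K, growth_exp. apply far_vanish; auto. }
  assert (TD : cvgC (fun N => csum (fun k => right_core v u X Y 0 N k * (nC (N - k) * nC (N - k)) * / poch (1 + nC k) m *
       cutoff e L N (0 + nC k) * log_deriv m u v X Y e L N k) N / cpow (INR N) K) (CSeries fD)).
  { eapply cvgC_ext; [intros N; apply csum_div|]. eapply cvgC_ext; [|exact D2].
    intros N. cbv beta. apply csum_ext. intros n _. now rewrite Cplus_0_r. }
  assert (T := cvgC_plus _ _ _ _ (cvgC_plus _ _ _ _ (cvgC_plus _ _ _ _ (cvgC_plus _ _ _ _ TM TU) TY) TF) TD).
  rewrite Cplus_0_r in T. apply (cvgC_unique _ _ _ T).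
  apply (cvgC_ext_loc (fun _ => RtoC 0) _ _ N0); [|apply cvgC_const].
  intros N HN. cbv beta.
  assert (Lv := level_identity m u v X Y N e L HG (HN0 N HN) ltac:(unfold L; lia) HXY' Hv (fun x Hx => proj1 (HX x Hx))).
  cbv zeta in Lv. fold (R N) in Lv. unfold Cdiv. rewrite <- !Cmult_plus_distr_r.
  etransitivity; [|apply (f_equal (fun t => t * / cpow (INR N) K) (eq_sym Lv))].
  symmetry. apply Cmult_0_l.
Qed.

(** * From the limiting residues to the terms of the theorem *)

Lemma prod_poch_over_fact (g h : C -> C) X n :
  prodC (map (fun x => poch_over_fact (g x) n * h x) X) =
  prodC (map (fun x => poch (g x) n) X) * (/ nC (fact n)) ^ length X * prodC (map h X).
Proof.
  rewrite (prodC_ext_in _ (fun x => (/ nC (fact n)) * (poch (g x) n * h x))) by (intros; unfold poch_over_fact, Cdiv; ring).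
  rewrite prodC_scal, prodC_mult. ring.
Qed.

Lemma prod_poch_over_fact_inv (g h : C -> C) X n : (forall x, In x X -> nonpole (g x)) ->
  prodC (map (fun x => / poch_over_fact (g x) n * h x) X) =
  / prodC (map (fun x => poch (g x) n) X) * nC (fact n) ^ length X * prodC (map h X).
Proof.
  intros H.
  rewrite (prodC_ext_in _ (fun x => nC (fact n) * (/ poch (g x) n * h x))).
  - rewrite prodC_scal, prodC_mult, prodC_inv; [ring|]. intros x Hx. apply poch_neq0; auto.
  - intros x Hx. unfold poch_over_fact. assert (A := poch_neq0 (g x) n (H x Hx)). assert (B := nC_fact_neq0 n). field. auto.
Qed.

Lemma pochV_map (g : C -> C) X n : pochV (map g X) n = prodC (map (fun x => poch (g x) n) X).
Proof. unfold pochV. now rewrite map_map. Qed.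

Lemma pochV_cons a l n : pochV (a :: l) n = poch a n * pochV l n. Proof. reflexivity. Qed.

(* The constant dividing all the terms of [limit_identity] to give the terms of the theorem. *)
Definition Omega0 (u v : C) (X Y : list C) : C :=
  RGamma v * / RGamma u * prodC (map (fun x => RGamma (1 - x)) X) *
  / prodC (map (fun y => RGamma (1 - y)) Y).

Lemma RGammaV_map (g : C -> C) X : RGammaV (map g X) = prodC (map (fun x => RGamma (g x)) X).
Proof. unfold RGammaV. now rewrite map_map. Qed.

Lemma GammaV_map (g : C -> C) X : (forall x, In x X -> nonpole (g x)) ->
  GammaV (map g X) = / prodC (map (fun x => RGamma (g x)) X).
Proof.
  intros H. unfold GammaV, CGamma. rewrite map_map. rewrite prodC_inv; auto.
  intros x Hx. apply RGamma_neq0; auto.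
Qed.

Lemma poch_shift_eq w m n : nonpole w -> poch (w + nC n) m = poch w m * poch (w + nC m) n / poch w n.
Proof.
  intros H. assert (P := poch_neq0 w n H).
  assert (Q : poch w m * poch (w + nC m) n = poch w n * poch (w + nC n) m).
  { rewrite <- 2!poch_add. f_equal. lia. }
  rewrite Q. field. auto.
Qed.

Lemma Cpow_fact_neq0 n k : nC (fact n) ^ k <> 0.
Proof. apply Cpow_nz, nC_fact_neq0. Qed.

Lemma Cinv_pow (a : C) k : a <> 0 -> (/ a) ^ k = / a ^ k.
Proof. intros; now apply Cpow_inv. Qed.

Lemma prod_RG_neq0 (g : C -> C) X : (forall x, In x X -> nonpole (g x)) ->
  prodC (map (fun x => RGamma (g x)) X) <> 0.
Proof. intros H. apply prodC_neq0. intros x Hx. apply RGamma_neq0; auto. Qed.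

Lemma prod_poch_neq0 (g : C -> C) X n : (forall x, In x X -> nonpole (g x)) ->
  prodC (map (fun x => poch (g x) n) X) <> 0.
Proof. intros H. apply prodC_neq0. intros x Hx. apply poch_neq0; auto. Qed.

Lemma Omega0_neq0 u v X Y : notInt u -> notInt v -> (forall x, In x X -> notInt x) ->
  (forall y, In y Y -> notInt y) -> Omega0 u v X Y <> 0.
Proof.
  intros Hu Hv HX HY. unfold Omega0. repeat apply Cmult_neq_0.
  - now apply RGamma_neq0, notInt_nonpole.
  - now apply Cinv_neq0, RGamma_neq0, notInt_nonpole.
  - apply (prod_RG_neq0 (fun x => 1 - x)). intros; now apply notInt_nonpole, notInt_1_sub, HX.
  - apply Cinv_neq0, (prod_RG_neq0 (fun x => 1 - x)). intros; now apply notInt_nonpole, notInt_1_sub, HY.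
Qed.

Definition series_term (m : nat) (cv dv : list C) (k : nat) : C :=
  pochV cv k / (pochV dv k * nC (fact (m + k)) * nC (fact k)).

Lemma double_coeff_lim_eq m u v X Y k : length X = S (S (length Y)) -> notInt u -> notInt v ->
  (forall y, In y Y -> notInt y) ->
  double_coeff_lim m u v X Y k = Omega0 u v X Y * series_term m (u :: X) (v :: Y) k.
Proof.
  intros HXY Hu Hv HY. unfold double_coeff_lim, right_core_lim, Omega0, series_term.
  rewrite !pochV_cons, !Cplus_0_l.
  rewrite (prodC_ext_in (fun x => poch_over_fact (x + 0) k * RGamma (1 - x - 0)) (fun x : C => poch_over_fact x k * RGamma (1 - x)))
    by (intros; do 2 f_equal; ring).
  rewrite (prodC_ext_in (fun y => / (poch_over_fact (y + 0) k * RGamma (1 - y - 0))) (fun y : C => / poch_over_fact y k * / RGamma (1 - y))).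
  2:{ intros y Hy. replace (y + 0) with y by ring. replace (1 - y - 0) with (1 - y) by ring.
      assert (A := poch_over_fact_neq0 y k (notInt_nonpole _ (HY y Hy))).
      assert (B := RGamma_neq0 _ (notInt_nonpole _ (notInt_1_sub _ (HY y Hy)))). field. auto. }
  rewrite (prod_poch_over_fact (fun x => x)), (prod_poch_over_fact_inv (fun x => x)) by (intros; now apply notInt_nonpole, HY).
  assert (NY : prodC (map (fun x => RGamma (1 - x)) Y) <> 0).
  { apply (prod_RG_neq0 (fun x => 1 - x)). intros; now apply notInt_nonpole, notInt_1_sub, HY. }
  rewrite (prodC_inv (fun y => RGamma (1 - y))) by (intros; now apply RGamma_neq0, notInt_nonpole, notInt_1_sub, HY).
  unfold pochV.
  assert (NP : prodC (map (fun x => poch x k) Y) <> 0).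
  { apply (prod_poch_neq0 (fun x => x)). intros; now apply notInt_nonpole, HY. }
  rewrite HXY, 2!Cpow_S, Cinv_pow by apply nC_fact_neq0.
  assert (NF := Cpow_fact_neq0 k (length Y)). set (W := nC (fact k) ^ length Y) in *.
  set (PX := prodC (map (fun x => poch x k) X)). set (PY := prodC (map (fun x => poch x k) Y)) in *.
  set (GX := prodC (map (fun x => RGamma (1 - x)) X)). set (GY := prodC (map (fun x => RGamma (1 - x)) Y)) in *.
  assert (F := nC_fact_neq0 k). assert (F2 := nC_fact_neq0 (m + k)).
  assert (G1 := RGamma_neq0 u (notInt_nonpole _ Hu)).
  assert (P1 := poch_neq0 v k (notInt_nonpole _ Hv)). assert (P2 := poch_neq0 u k (notInt_nonpole _ Hu)).
  (* The denominator (1+k)_m, left over from Gamma(-m-s), is what turns one k! into (m+k)!. *)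
  replace (poch (1 + nC k) m) with (nC (fact (m + k)) / nC (fact k)).
  2:{ rewrite (Nat.add_comm m k), <- (poch_nC_S k m), nC_S, (Cplus_comm (nC k)). field. auto. }
  unfold poch_over_fact. field. repeat split; auto.
Qed.

Lemma RGamma_1 : RGamma 1 = 1.
Proof.
  apply (cvgC_unique (gauss_quot 1)); [apply gauss_quot_cvg|].
  apply (cvgC_ext (fun _ => RtoC 1)); [|apply cvgC_const]. intros n. unfold gauss_quot.
  rewrite poch_1. replace (1 - 1) with (RtoC 0) by ring. rewrite cpow_0. field. apply nC_fact_neq0.
Qed.

Lemma RGamma_pred z : RGamma (z - 1) = (z - 1) * RGamma z.
Proof. rewrite RGamma_S. do 2 f_equal. ring. Qed.

Lemma RGamma_1_sub z : RGamma (1 - z) = (1 - z) * RGamma (2 - z).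
Proof. rewrite RGamma_S. do 2 f_equal. ring. Qed.

Lemma poch_one x : poch x 1 = x.
Proof. rewrite poch_S, poch_0, nC_0. ring. Qed.

Lemma left_core_lim_split X Y s0 n : (forall x, In x X -> nonpole (1 - x - s0)) ->
  (forall y, In y Y -> nonpole (1 - y - s0)) -> length X = S (S (length Y)) ->
  left_core_lim X Y s0 n =
  prodC (map (fun x => RGamma (1 - x - s0)) X) * / prodC (map (fun y => RGamma (1 - y - s0)) Y) *
  (prodC (map (fun y => poch (1 - y - s0) n) Y) * / prodC (map (fun x => poch (1 - x - s0) n) X)) *
  ((/ RGamma (- s0) * poch (- s0) n) * (/ RGamma (- s0) * poch (- s0) n)).
Proof.
  intros HX HY HXY. unfold left_core_lim.
  rewrite (prodC_ext_in (fun x => RGamma (1 - x - s0) * / poch_over_fact (1 - x - s0) n)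
    (fun x => / poch_over_fact (1 - x - s0) n * RGamma (1 - x - s0))) by (intros; ring).
  rewrite (prodC_ext_in (fun x => / RGamma (1 - x - s0) * poch_over_fact (1 - x - s0) n)
    (fun x => poch_over_fact (1 - x - s0) n * / RGamma (1 - x - s0))) by (intros; ring).
  rewrite (prod_poch_over_fact (fun x => 1 - x - s0)), (prod_poch_over_fact_inv (fun x => 1 - x - s0)) by auto.
  rewrite (prodC_inv (fun x => RGamma (1 - x - s0)) Y) by (intros; apply RGamma_neq0; auto).
  rewrite HXY, 2!Cpow_S, Cinv_pow by apply nC_fact_neq0.
  assert (NF := Cpow_fact_neq0 n (length Y)). assert (F := nC_fact_neq0 n).
  set (a1 := prodC (map (fun x => RGamma (1 - x - s0)) X)).
  set (a2 := / prodC (map (fun x => RGamma (1 - x - s0)) Y)).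
  set (a3 := / prodC (map (fun x => poch (1 - x - s0) n) X)).
  set (a4 := prodC (map (fun x => poch (1 - x - s0) n) Y)).
  set (a5 := / RGamma (- s0)). unfold poch_over_fact. field. auto.
Qed.

(** At s = -1-j the Gamma factors sit at 2-x, 2-y, u-1 and v-1. The recurrence moves them to the
    arguments in [Omega0] and leaves the quotient (1-d)_1/(1-c)_1; the signs in (v-1)/(u-1)
    cancel. *)
Lemma int_residue_lim_eq m u v X Y j : length X = S (S (length Y)) -> notInt u -> notInt v ->
  (forall x, In x X -> notInt x) -> (forall y, In y Y -> notInt y) ->
  int_residue_lim m u v X Y j = Omega0 u v X Y * (pochV (vsubr 1 (v :: Y)) 1 / pochV (vsubr 1 (u :: X)) 1 *
     (sgn1 j * pochV (vsubr 2 (v :: Y)) j * nC (fact j) / (pochV (vsubr 2 (u :: X)) j * nC (fact (m - 1 - j))))).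
Proof.
  intros HXY Hu Hv HX HY. unfold int_residue_lim.
  assert (E2 : forall z, 1 - z - - (1) = 2 - z) by (intros; ring).
  assert (N2 : forall z, notInt z -> nonpole (2 - z)) by (intros z Hz; apply notInt_nonpole, (notInt_nat_sub z 2 Hz)).
  rewrite left_core_lim_split; auto; try (intros; rewrite E2; auto).
  replace (- - (1)) with (RtoC 1) by ring. rewrite RGamma_1, poch_1.
  rewrite !(prodC_ext_in (fun x => RGamma (1 - x - - (1))) (fun x => RGamma (2 - x))) by (intros; now rewrite E2).
  rewrite !(prodC_ext_in (fun x => poch (1 - x - - (1)) j) (fun x => poch (2 - x) j)) by (intros; now rewrite E2).
  unfold Omega0, vsubr. cbn [map]. rewrite !pochV_cons, !pochV_map, 2!poch_one.
  rewrite !(prodC_ext_in (fun x => poch (1 - x) 1) (fun x => 1 - x)) by (intros; now rewrite poch_one).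
  rewrite !(prodC_ext_in (fun x => RGamma (1 - x)) (fun x => (1 - x) * RGamma (2 - x))) by (intros; now apply RGamma_1_sub).
  rewrite 2!prodC_mult, 2!RGamma_pred.
  assert (X1 : prodC (map (fun x => 1 - x) X) <> 0).
  { apply prodC_neq0. intros x Hx. now apply notInt_neq0, notInt_1_sub, HX. }
  assert (Y1 : prodC (map (fun x => 1 - x) Y) <> 0).
  { apply prodC_neq0. intros x Hx. now apply notInt_neq0, notInt_1_sub, HY. }
  assert (Y2 : prodC (map (fun x => RGamma (2 - x)) Y) <> 0).
  { apply (prod_RG_neq0 (fun x => 2 - x)). auto. }
  assert (X3 : prodC (map (fun x => poch (2 - x) j) X) <> 0).
  { apply (prod_poch_neq0 (fun x => 2 - x)). auto. }
  assert (G1 := RGamma_neq0 u (notInt_nonpole _ Hu)).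
  assert (U1 : u - 1 <> 0) by now apply notInt_neq0, (notInt_sub_nat u 1).
  assert (U2 : 1 - u <> 0) by now apply notInt_neq0, notInt_1_sub.
  assert (P1 := poch_neq0 _ j (N2 u Hu)). assert (F := nC_fact_neq0 j). assert (F2 := nC_fact_neq0 (m - 1 - j)).
  replace (m - j - 1)%nat with (m - 1 - j)%nat by lia.
  unfold poch_over_fact. set (a1 := prodC (map (fun x => 1 - x) X)) in *. set (a2 := prodC (map (fun x => 1 - x) Y)) in *.
  set (a3 := prodC (map (fun x => RGamma (2 - x)) Y)) in *. set (a4 := prodC (map (fun x => RGamma (2 - x)) X)) in *.
  set (a5 := prodC (map (fun x => poch (2 - x) j) X)) in *. set (a6 := prodC (map (fun x => poch (2 - x) j) Y)) in *.
  replace (1 - u) with (- (u - 1)) by ring.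
  assert (U3 : - (u - 1) <> 0) by (now replace (- (u - 1)) with (1 - u) by ring).
  field. repeat split; auto.
Qed.

(** The factor 1/(u-m+n)_m equals (u-m)_n / ((u-m)_m (u)_n): this creates the parameter c_1 - m,
    cancels one of two symbols (u)_n, and through (u-m)_m = (-1)^m (1-u)_m absorbs the sign. *)
Lemma left_residue_lim_eq m u v X Y n : length X = S (S (length Y)) -> notInt u -> notInt v -> notInt (v - u) ->
  (forall x, In x X -> notInt x /\ notInt (x - u)) -> (forall y, In y Y -> notInt y /\ notInt (y - u)) ->
  left_residue_lim m u v X Y n = Omega0 u v X Y * (CGamma u * CGamma v * GammaV (vsubr 1 X) * GammaV (vadd (vsubr 1 Y) u)
      * RGamma (v - u) * RGammaV (vadd (vsubr 1 X) u) * RGammaV (vsubr 1 Y) / poch (1 - u) m) *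
     (pochV (u :: (u - nC m) :: vadd (vsubr 1 (v :: Y)) u) n / (pochV (vadd (vsubr 1 X) u) n * nC (fact n))).
Proof.
  intros HXY Hu Hv Hvu HX HY. unfold left_residue_lim.
  assert (E2 : forall z, 1 - z - - u = 1 - z + u) by (intros; ring).
  assert (N2 : forall z, notInt (z - u) -> nonpole (1 - z + u)).
  { intros z Hz. replace (1 - z + u) with (1 - (z - u)) by ring. now apply notInt_nonpole, notInt_1_sub. }
  assert (NX : forall x, In x X -> nonpole (1 - x + u)) by (intros; now apply N2, HX).
  assert (NY : forall x, In x Y -> nonpole (1 - x + u)) by (intros; now apply N2, HY).
  rewrite left_core_lim_split; auto; try (intros; rewrite E2; auto).
  replace (- - u) with u by ring.
  rewrite !(prodC_ext_in (fun x => RGamma (1 - x - - u)) (fun x => RGamma (1 - x + u))) by (intros; now rewrite E2).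
  rewrite !(prodC_ext_in (fun x => poch (1 - x - - u) n) (fun x => poch (1 - x + u) n)) by (intros; now rewrite E2).
  unfold Omega0, vadd, vsubr, CGamma. cbn [map]. rewrite !map_map, !pochV_cons, !pochV_map, !RGammaV_map.
  rewrite !GammaV_map; auto; try (intros; now apply notInt_nonpole, notInt_1_sub, HX).
  assert (X1 : prodC (map (fun x => RGamma (1 - x)) X) <> 0).
  { apply (prod_RG_neq0 (fun x => 1 - x)). intros; now apply notInt_nonpole, notInt_1_sub, HX. }
  assert (Y1 : prodC (map (fun x => RGamma (1 - x)) Y) <> 0).
  { apply (prod_RG_neq0 (fun x => 1 - x)). intros; now apply notInt_nonpole, notInt_1_sub, HY. }
  assert (Y2 : prodC (map (fun x => RGamma (1 - x + u)) Y) <> 0) by (apply (prod_RG_neq0 (fun x => 1 - x + u)); auto).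
  assert (X3 : prodC (map (fun x => poch (1 - x + u) n) X) <> 0) by (apply (prod_poch_neq0 (fun x => 1 - x + u)); auto).
  assert (Hum : nonpole (u - nC m)) by now apply notInt_nonpole, notInt_sub_nat.
  rewrite (poch_shift_eq (u - nC m) m n Hum). replace (u - nC m + nC m) with u by ring.
  rewrite (poch_neg u m).
  assert (G1 := RGamma_neq0 u (notInt_nonpole _ Hu)). assert (G2 := RGamma_neq0 v (notInt_nonpole _ Hv)).
  assert (P1 := poch_neq0 u n (notInt_nonpole _ Hu)).
  assert (P2 := poch_neq0 (1 - u) m (notInt_nonpole _ (notInt_1_sub _ Hu))).
  assert (P3 := poch_neq0 (u - nC m) n Hum).
  assert (F := nC_fact_neq0 n). assert (Sg := sgn1_neq0 m).
  unfold poch_over_fact. field. repeat split; auto.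
Qed.

Definition right_coeff (m : nat) (u v : C) (X Y' : list C) (y : C) : C :=
  CGamma (y - nC m) * CGamma y * GammaV (vsubr y (v :: Y'))
    * Csin (RtoC PI * (y - v)) * RGammaV (vsubr y (u :: X))
    / ((y - nC m - 1) * (y - 1) * Csin (RtoC PI * (y - u))).

(** Reflection at y-u and y-v turns Gamma(1-y+u) and 1/Gamma(1-y+v) into the sines. The square of
    Gamma(y-1) divided by (2-y)_m is rewritten by the recurrence as (-1)^m Gamma(y-m) Gamma(y) /
    ((y-m-1)(y-1)). *)
Lemma right_residue_lim_eq m u v X Y' y n : length X = S (S (S (length Y'))) ->
  notInt y -> notInt (y - u) -> notInt (y - v) -> (forall y', In y' Y' -> notInt (y - y')) ->
  right_residue_lim m u v X Y' y n = - sgn1 m * right_coeff m u v X Y' y *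
   (pochV (vadd (u :: X) (1 - y)) n /
     (pochV ((2 - y) :: (2 - y + nC m) :: vadd (v :: Y') (1 - y)) n * nC (fact n))).
Proof.
  intros HXY Hy Hyu Hyv HY. unfold right_residue_lim, right_core_lim.
  assert (NY : forall z, In z Y' -> nonpole (z + (1 - y))).
  { intros z Hz. replace (z + (1 - y)) with (1 - (y - z)) by ring. now apply notInt_nonpole, notInt_1_sub, HY. }
  assert (NY2 : forall z, In z Y' -> nonpole (y - z)) by (intros; now apply notInt_nonpole, HY).
  rewrite (prodC_ext_in (fun x => poch_over_fact (x + (1 - y)) n * RGamma (1 - x - (1 - y))) (fun x => poch_over_fact (x + (1 - y)) n * RGamma (y - x)))
    by (intros; do 2 f_equal; ring).
  rewrite (prodC_ext_in (fun z => / (poch_over_fact (z + (1 - y)) n * RGamma (1 - z - (1 - y)))) (fun z => / poch_over_fact (z + (1 - y)) n * / RGamma (y - z))).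
  2:{ intros z Hz. replace (1 - z - (1 - y)) with (y - z) by ring.
      assert (A := poch_over_fact_neq0 _ n (NY z Hz)). assert (B := RGamma_neq0 _ (NY2 z Hz)). field. auto. }
  rewrite (prod_poch_over_fact (fun x => x + (1 - y))), (prod_poch_over_fact_inv (fun x => x + (1 - y))) by auto.
  rewrite (prodC_inv (fun z => RGamma (y - z))) by (intros; apply RGamma_neq0; auto).
  rewrite HXY, 3!Cpow_S, Cinv_pow by apply nC_fact_neq0.
  assert (NF := Cpow_fact_neq0 n (length Y')). set (W := nC (fact n) ^ length Y') in *.
  assert (H2 : notInt (2 - y)) by apply (notInt_nat_sub y 2 Hy).
  rewrite (poch_shift_eq (2 - y) m n (notInt_nonpole _ H2)).
  unfold right_coeff, vadd, vsubr, CGamma. cbn [map]. rewrite !pochV_cons, !pochV_map.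
  unfold GammaV, RGammaV. cbn [map]. rewrite 2!prodC_cons, !map_map.
  rewrite (prodC_ext_in (fun x => CGamma (y - x)) (fun x => / RGamma (y - x))) by reflexivity.
  rewrite (prodC_inv (fun z => RGamma (y - z))) by (intros; apply RGamma_neq0; auto).
  unfold CGamma.
  assert (Y1 : prodC (map (fun x => RGamma (y - x)) Y') <> 0) by (apply (prod_RG_neq0 (fun x => y - x)); auto).
  assert (Y2 : prodC (map (fun x => poch (x + (1 - y)) n) Y') <> 0) by (apply (prod_poch_neq0 (fun x => x + (1 - y))); auto).
  assert (R1 := RGamma_reflection (y - v)). assert (R2 := RGamma_reflection (y - u)).
  replace (1 - (y - v)) with (1 - y + v) in R1 by ring. replace (1 - (y - u)) with (1 - y + u) in R2 by ring.
  rewrite <- R1, <- R2.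
  assert (Hpi : RtoC PI <> 0) by (apply RtoC_neq0, PI_neq0).
  assert (Nu : notInt (1 - y + u)) by (replace (1 - y + u) with (1 - (y - u)) by ring; now apply notInt_1_sub).
  assert (Nv : notInt (1 - y + v)) by (replace (1 - y + v) with (1 - (y - v)) by ring; now apply notInt_1_sub).
  assert (G1 := RGamma_neq0 _ (notInt_nonpole _ Nu)). assert (G2 := RGamma_neq0 _ (notInt_nonpole _ Hyu)).
  assert (G3 := RGamma_neq0 _ (notInt_nonpole _ Hyv)). assert (G4 := RGamma_neq0 _ (notInt_nonpole _ Hy)).
  assert (Hym : notInt (y - nC m)) by now apply notInt_sub_nat.
  assert (G5 := RGamma_neq0 _ (notInt_nonpole _ Hym)).
  assert (Hym1 : notInt (y - nC m - 1)) by apply (notInt_sub_nat _ 1 Hym).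
  assert (D1 := notInt_neq0 _ Hym1).
  assert (Hy1 : notInt (y - 1)) by apply (notInt_sub_nat _ 1 Hy). assert (D2 := notInt_neq0 _ Hy1).
  assert (K1 : RGamma (y - 1) = (y - 1) * RGamma y) by apply RGamma_pred.
  assert (K2 : (y - nC m - 1) * RGamma (y - nC m) = sgn1 m * poch (2 - y) m * ((y - 1) * RGamma y)).
  { rewrite <- RGamma_pred, (RGamma_poch _ m), <- K1.
    replace (y - nC m - 1) with (y - 1 - nC m) by ring. rewrite poch_neg.
    replace (1 - (y - 1)) with (2 - y) by ring. replace (y - 1 - nC m + nC m) with (y - 1) by ring. ring. }
  assert (P1 := poch_neq0 _ n (notInt_nonpole _ Nu)). assert (P2 := poch_neq0 _ n (notInt_nonpole _ Nv)).
  assert (P3 := poch_neq0 _ m (notInt_nonpole _ H2)). assert (P4 := poch_neq0 _ n (notInt_nonpole _ H2)).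
  assert (P5 := poch_neq0 (2 - y + nC m) n (nonpole_add _ m (notInt_nonpole _ H2))).
  assert (F := nC_fact_neq0 n). assert (Sg := sgn1_neq0 m).
  replace (u + (1 - y)) with (1 - y + u) by ring. replace (v + (1 - y)) with (1 - y + v) by ring.
  (* Arranged so that Gamma(y-m) occurs only in the combination evaluated by [K2]. *)
  replace (/ RGamma (y - nC m) * / RGamma y) with
    ((y - nC m - 1) / (((y - nC m - 1) * RGamma (y - nC m)) * RGamma y))
    by (field; auto).
  rewrite K1, K2. unfold poch_over_fact.
  set (a1 := prodC (map (fun x => poch (x + (1 - y)) n) X)). set (a2 := prodC (map (fun x => RGamma (y - x)) X)).
  set (a3 := prodC (map (fun x => poch (x + (1 - y)) n) Y')) in *. set (a4 := prodC (map (fun x => RGamma (y - x)) Y')) in *.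
  field. repeat split; auto.
Qed.

(** Reflection at u and v identifies the prefactor of the last sum of the theorem as 1/[Omega0], up
    to the sign (-1)^m; this is why the right residues are computed without dividing by [Omega0]. *)
Lemma Omega0_prefactor u v X Y : notInt u -> notInt v -> (forall x, In x X -> notInt x) ->
  (forall y, In y Y -> notInt y) ->
  Omega0 u v X Y * (GammaV (vsubr 1 (u :: X)) * Csin (RtoC PI * u) * RGammaV (vsubr 1 (v :: Y)) / Csin (RtoC PI * v)) = 1.
Proof.
  intros Hu Hv HX HY. rewrite <- 2!RGamma_reflection. unfold Omega0, vsubr.
  rewrite RGammaV_map, GammaV_map.
  2:{ intros x [<-|Hx]; apply notInt_nonpole, notInt_1_sub; auto. }
  cbn [map]. rewrite 2!prodC_cons.
  assert (X1 : prodC (map (fun x => RGamma (1 - x)) X) <> 0).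
  { apply (prod_RG_neq0 (fun x => 1 - x)). intros; now apply notInt_nonpole, notInt_1_sub, HX. }
  assert (Y1 : prodC (map (fun x => RGamma (1 - x)) Y) <> 0).
  { apply (prod_RG_neq0 (fun x => 1 - x)). intros; now apply notInt_nonpole, notInt_1_sub, HY. }
  assert (Hpi : RtoC PI <> 0) by (apply RtoC_neq0, PI_neq0).
  assert (G1 := RGamma_neq0 u (notInt_nonpole _ Hu)). assert (G2 := RGamma_neq0 v (notInt_nonpole _ Hv)).
  assert (G3 := RGamma_neq0 _ (notInt_nonpole _ (notInt_1_sub _ Hu))).
  assert (G4 := RGamma_neq0 _ (notInt_nonpole _ (notInt_1_sub _ Hv))).
  field. repeat split; auto.
Qed.

Lemma digamma_psi0 z : digamma z = - RtoC EulerGamma + psi0 z. Proof. reflexivity. Qed.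

Lemma psi0_add_psi0_partial x k : nonpole x -> psi0 (x + nC k) = psi0 x + harmonic k - psi0_partial x k.
Proof.
  intros H. rewrite psi0_add by auto.
  rewrite (csum_ext _ (fun j => / (nC j + x))) by (intros; now rewrite Cplus_comm).
  rewrite psi0_partial_harmonic. ring.
Qed.

(** The source of the cotangents: psi at 2-x, coming from the roots with larger index, is reflected
    to psi at x. *)
Lemma psi0_partial_cvg x k : notInt x ->
  - psi0_partial x k + / (x - 1) + psi0 (2 - x) = psi0 (x + nC k) - harmonic k + RtoC PI * Ccot (RtoC PI * x).
Proof.
  intros H. assert (H1 := notInt_1_sub _ H).
  replace (2 - x) with (1 - x + 1) by ring. rewrite psi0_S by now apply notInt_nonpole.
  rewrite psi0_reflection, psi0_add_psi0_partial by (auto using notInt_nonpole).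
  assert (D := notInt_neq0 _ H1). assert (D2 := notInt_neq0 _ (notInt_sub_nat x 1 H)).
  change (nC 1) with (RtoC 1) in D2.
  replace (/ (1 - x)) with (- / (x - 1)) by (field; auto). ring.
Qed.

Definition bracket (m : nat) (cv dv : list C) (k : nat) : C :=
  sumC (map (fun x => digamma (x + nC k)) dv) + digamma (nC k + 1)
  + digamma (1 + nC m + nC k) - sumC (map (fun x => digamma (x + nC k)) cv).

(** The bracket contains |Y| + 3 psi values with plus and |X| + 1 with minus; these counts agree, so
    the Euler constant cancels between [digamma] and [psi0]. *)
Lemma log_deriv_lim_bracket m u v X Y k : length X = S (S (length Y)) -> notInt u -> notInt v ->
  (forall x, In x X -> notInt x) -> (forall y, In y Y -> notInt y) ->
  log_deriv_lim m u v X Y k = - bracket m (u :: X) (v :: Y) k +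
    RtoC PI * (sumC (map (fun x => Ccot (RtoC PI * x)) X) - sumC (map (fun x => Ccot (RtoC PI * x)) Y)).
Proof.
  intros HXY Hu Hv HX HY. unfold log_deriv_lim, bracket.
  assert (Q : forall Z, (forall z, In z Z -> notInt z) ->
    sumC (map (fun x => - psi0_partial x k + / (x - 1) + psi0 (2 - x)) Z) =
    sumC (map (fun x => digamma (x + nC k)) Z) + nC (length Z) * (RtoC EulerGamma - harmonic k)
      + RtoC PI * sumC (map (fun x => Ccot (RtoC PI * x)) Z)).
  { induction Z as [|z Z IH]; intros HZ.
    - unfold sumC; cbn [map fold_right length]. rewrite nC_0. ring.
    - cbn [map length]. rewrite 3!sumC_cons, IH by (intros; apply HZ; now right).
      rewrite psi0_partial_cvg by (apply HZ; now left). rewrite digamma_psi0, nC_S. ring. }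
  rewrite (Q X HX), (Q Y HY), HXY, !nC_S. cbn [map]. rewrite 2!sumC_cons.
  rewrite !digamma_psi0, (psi0_add_psi0_partial u), (psi0_add_psi0_partial v) by now apply notInt_nonpole.
  assert (N1 : nonpole 1) by apply (nonpole_nC_S 0).
  assert (HH : psi0 (1 + nC k) = harmonic k).
  { rewrite psi0_add, psi0_1 by auto. rewrite Cplus_0_l. apply csum_ext. intros j _. f_equal. rewrite nC_S. ring. }
  rewrite (Cplus_comm (nC k) 1).
  replace (1 + nC m + nC k) with (1 + nC k + nC m) by ring.
  rewrite (psi0_add (1 + nC k)) by now apply nonpole_add. rewrite HH.
  rewrite (csum_ext (fun i => / (1 + nC k + nC i)) (fun i => / (nC k + 1 + nC i))) by (intros; f_equal; ring).
  ring.
Qed.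

(** Convergence is known for f only. When c = 0 nothing is known about t, but both sides are 0; this
    occurs if some d_k - c_j is a nonpositive integer, where a reciprocal Gamma vanishes. *)
Lemma CSeries_scal f t (c : C) : cvgC (csum f) (CSeries f) -> (forall n, f n = c * t n) ->
  CSeries f = c * CSeries t.
Proof.
  intros H E. destruct (Ceq_dec c 0) as [->|Hc].
  - rewrite Cmult_0_l. apply cvgC_CSeries. apply (cvgC_ext (fun _ => RtoC 0)); [|apply cvgC_const].
    intros n. symmetry. unfold csum. rewrite (sumC_ext_in f (fun _ => RtoC 0)) by (intros; rewrite E; ring).
    apply sumC_zero.
  - assert (T : cvgC (csum t) (/ c * CSeries f)).
    { eapply cvgC_ext; [|apply (cvgC_mult _ _ _ _ (cvgC_const (/ c)) H)]. intros n. cbv beta.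
      rewrite <- csum_scal. apply csum_ext. intros i _. rewrite E. field. auto. }
    rewrite (cvgC_CSeries _ _ T). field. auto.
Qed.

(* 0-based indexing: c_j (j = 1..p+1) is  c (j-1),  d_j (j = 1..p-1) is  d (j-1). *)
Theorem mainTheorem2 (p m : nat) (c d : nat -> C)
  (hp : (2 <= p)%nat)
  (hc : forall i, (i <= p)%nat -> notInt (c i))
  (hd : forall i, (i < p - 1)%nat -> notInt (d i))
  (hcc : forall i j, (i <= p)%nat -> (j <= p)%nat -> i <> j -> notInt (c i - c j))
  (hdd : forall i j, (i < p - 1)%nat -> (j < p - 1)%nat -> i <> j -> notInt (d i - d j))
  (hdc : forall j, (j < p - 1)%nat -> notInt (d j - c 0%nat))
  (hre : (Re (sumC (map d (seq 0 (p - 1))) - sumC (map c (seq 0 (p + 1))))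
            > - INR m - 1)%R) :
  let cv := map c (seq 0 (p + 1)) in
  let dv := map d (seq 0 (p - 1)) in
  let c1 := c 0%nat in
  let d1 := d 0%nat in
  let cv1 := map c (seq 1 p) in
  let dv1 := map d (seq 1 (p - 2)) in
  let dvk := fun k => map d (filter (fun i => negb (Nat.eqb i k)) (seq 0 (p - 1))) in
  CSeries (fun k =>
      pochV cv k / (pochV dv k * nC (fact (m + k)) * nC (fact k)) *
      (sumC (map (fun x => digamma (x + nC k)) dv) + digamma (nC k + 1)
       + digamma (1 + nC m + nC k) - sumC (map (fun x => digamma (x + nC k)) cv)))
  =
    RtoC PI / nC (fact m) *
      (sumC (map (fun x => Ccot (RtoC PI * x)) cv1)
       - sumC (map (fun x => Ccot (RtoC PI * x)) dv1)) *
      hypF cv ((1 + nC m) :: dv)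
  + pochV (vsubr 1 dv) 1 / pochV (vsubr 1 cv) 1 *
      sumC (map (fun j => RtoC ((-1) ^ j) * pochV (vsubr 2 dv) j * nC (fact j)
                          / (pochV (vsubr 2 cv) j * nC (fact (m - 1 - j))))
                (seq 0 m))
  + CGamma c1 * CGamma d1 * GammaV (vsubr 1 cv1) * GammaV (vadd (vsubr 1 dv1) c1)
      * RGamma (d1 - c1) * RGammaV (vadd (vsubr 1 cv1) c1) * RGammaV (vsubr 1 dv1)
      / poch (1 - c1) m
      * hypF (c1 :: (c1 - nC m) :: vadd (vsubr 1 dv) c1) (vadd (vsubr 1 cv1) c1)
  - RtoC ((-1) ^ m) * GammaV (vsubr 1 cv) * Csin (RtoC PI * c1) * RGammaV (vsubr 1 dv)
      / Csin (RtoC PI * d1) *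
      sumC (map (fun k =>
         let dk := d k in
         CGamma (dk - nC m) * CGamma dk * GammaV (vsubr dk (dvk k))
           * Csin (RtoC PI * (dk - d1)) * RGammaV (vsubr dk cv)
           / ((dk - nC m - 1) * (dk - 1) * Csin (RtoC PI * (dk - c1)))
           * hypF (vadd cv (1 - dk)) ((2 - dk) :: (2 - dk + nC m) :: vadd (dvk k) (1 - dk)))
        (seq 1 (p - 2))).

Proof.
  intros cv dv c1 d1 cv1 dv1 dvk.
  (* With p = q + 2 the list [I] holds the 0-based indices 1, ..., q of d_2, ..., d_(p-1), and d_1
     is set apart as [v]. *)
  destruct p as [|[|q]]; [lia|lia|].
  set (I := seq 1 q). set (u := c1). set (v := d1).
  assert (Ecv1 : cv1 = map c (seq 1 (S (S q)))) by reflexivity.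
  assert (Edv1 : dv1 = map d I) by (unfold dv1, I; do 2 f_equal; lia).
  assert (Ecv : cv = u :: cv1) by (unfold cv; now rewrite Nat.add_1_r).
  assert (Edv : dv = v :: dv1).
  { rewrite Edv1. unfold dv, I. replace (S (S q) - 1)%nat with (S q) by lia. reflexivity. }
  assert (Edvk : forall k, In k I -> dvk k = v :: map d (others I k)).
  { intros k Hk. unfold dvk, others, I. replace (S (S q) - 1)%nat with (S q) by lia. cbn [seq filter].
    apply in_seq in Hk. destruct k as [|k]; [lia|]. reflexivity. }
  assert (HIin : forall i, In i I -> (1 <= i < S q)%nat) by (intros i Hi; apply in_seq in Hi; lia).
  assert (Hu : notInt u) by (apply hc; lia).
  assert (Hv : notInt v) by (apply hd; lia).
  assert (Hvu : notInt (v - u)) by (apply hdc; lia).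
  assert (HX : forall x, In x cv1 -> notInt x /\ notInt (x - u)).
  { intros x Hx. unfold cv1 in Hx. apply in_map_iff in Hx. destruct Hx as [i [<- Hi]]. apply in_seq in Hi.
    split; [apply hc; lia | apply hcc; lia]. }
  assert (HYI : forall i, In i I -> notInt (d i) /\ notInt (d i - u) /\ notInt (d i - v)).
  { intros i Hi. apply HIin in Hi. split; [apply hd; lia|]. split; [apply hdc; lia | apply hdd; lia]. }
  assert (HY : forall y, In y dv1 -> notInt y /\ notInt (y - u)).
  { intros y Hy. rewrite Edv1 in Hy. apply in_map_iff in Hy. destruct Hy as [i [<- Hi]].
    destruct (HYI i Hi) as [? [? ?]]; auto. }
  assert (HYY : forall i j, In i I -> In j I -> i <> j -> notInt (d i - d j)).
  { intros i j Hi Hj Hij. apply HIin in Hi. apply HIin in Hj. apply hdd; lia. }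
  assert (LX : length cv1 = S (S (length I))) by (unfold cv1, I; now rewrite length_map, 2!length_seq).
  assert (LXY : length cv1 = S (S (length dv1))) by (rewrite LX, Edv1, length_map; reflexivity).
  assert (HX' : forall x, In x cv1 -> notInt x) by (intros; now apply HX).
  assert (HY' : forall y, In y dv1 -> notInt y) by (intros; now apply HY).
  assert (HS : (0 < Re (v - u - sumC cv1 + sumC dv1) + INR m + 1)%R).
  { fold cv dv in hre. rewrite Ecv, Edv, 2!sumC_cons in hre.
    replace (v - u - sumC cv1 + sumC dv1) with (v + sumC dv1 - (u + sumC cv1)) by ring. lra. }
  assert (LI := limit_identity m u v cv1 d I (seq_NoDup q 1) Hu Hv HX HYI HYY LX).
  cbv zeta in LI. rewrite <- Edv1 in LI. destruct (LI HS) as [L0 [LD [LL' [LR LE]]]].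
  clear hc hd hcc hdd hdc hre LI.
  set (W := Omega0 u v cv1 dv1).
  assert (HW : W <> 0) by (apply Omega0_neq0; auto).
  set (kc := RtoC PI * (sumC (map (fun x => Ccot (RtoC PI * x)) cv1) - sumC (map (fun x => Ccot (RtoC PI * x)) dv1))).
  assert (E0 := fun k => double_coeff_lim_eq m u v cv1 dv1 k LXY Hu Hv HY').
  set (T := CSeries (series_term m cv dv)).
  assert (ET : CSeries (double_coeff_lim m u v cv1 dv1) = W * T).
  { apply CSeries_scal; auto. intros n. rewrite E0, <- Ecv, <- Edv. reflexivity. }
  assert (HT : cvgC (csum (series_term m cv dv)) T).
  { apply (cvgC_lim_eq _ (/ W * CSeries (double_coeff_lim m u v cv1 dv1))); [|rewrite ET; field; auto].
    eapply cvgC_ext; [|apply (cvgC_mult _ _ _ _ (cvgC_const (/ W)) L0)]. intros n. cbv beta.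
    rewrite <- csum_scal. apply csum_ext. intros i _. rewrite E0, <- Ecv, <- Edv. fold W. field. auto. }
  (* The factor m! comes from (m+k)! = m! (1+m)_k. *)
  assert (HF : hypF cv ((1 + nC m) :: dv) = nC (fact m) * T).
  { unfold hypF. apply cvgC_CSeries.
    eapply cvgC_ext; [|apply (cvgC_mult _ _ _ _ (cvgC_const (nC (fact m))) HT)]. intros n. cbv beta.
    rewrite <- csum_scal. apply csum_ext. intros k _. unfold series_term. rewrite pochV_cons.
    replace (1 + nC m) with (nC (S m)) by (rewrite nC_S; ring). rewrite <- (poch_nC_S m k).
    assert (P1 := poch_neq0 (nC (S m)) k (nonpole_nC_S m)).
    assert (P2 : pochV dv k <> 0).
    { rewrite Edv, pochV_cons. apply Cmult_neq_0; [now apply poch_neq0, notInt_nonpole|].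
      apply (prod_poch_neq0 (fun x => x)). intros; now apply notInt_nonpole, HY'. }
    assert (F1 := nC_fact_neq0 m). assert (F2 := nC_fact_neq0 k). field. auto. }
  (* Solving the double-pole series for the bracket: its cotangent part is independent of k and
     multiplies the plain series [T]. *)
  assert (HL : CSeries (fun k => series_term m cv dv k * bracket m cv dv k) =
     kc * T - / W * CSeries (fun k => double_coeff_lim m u v cv1 dv1 k * log_deriv_lim m u v cv1 dv1 k)).
  { apply cvgC_CSeries.
    eapply cvgC_ext; [|apply (cvgC_minus _ _ _ _ (cvgC_mult _ _ _ _ (cvgC_const kc) HT) (cvgC_mult _ _ _ _ (cvgC_const (/ W)) LD))].
    intros n. cbv beta. rewrite <- 2!csum_scal, <- csum_minus. apply csum_ext. intros k _.
    rewrite E0, log_deriv_lim_bracket, <- Ecv, <- Edv by auto. fold W kc. field. auto. }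
  (* The goal is restated by conversion only, with [series_term], [bracket], [csum] and [sgn1]
     folded. *)
  change (CSeries (fun k => series_term m cv dv k * bracket m cv dv k) =
    RtoC PI / nC (fact m) * (sumC (map (fun x => Ccot (RtoC PI * x)) cv1) - sumC (map (fun x => Ccot (RtoC PI * x)) dv1)) *
      hypF cv ((1 + nC m) :: dv)
  + pochV (vsubr 1 dv) 1 / pochV (vsubr 1 cv) 1 *
      csum (fun j => sgn1 j * pochV (vsubr 2 dv) j * nC (fact j)
                          / (pochV (vsubr 2 cv) j * nC (fact (m - 1 - j)))) m
  + CGamma u * CGamma v * GammaV (vsubr 1 cv1) * GammaV (vadd (vsubr 1 dv1) u)
      * RGamma (v - u) * RGammaV (vadd (vsubr 1 cv1) u) * RGammaV (vsubr 1 dv1)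
      / poch (1 - u) m
      * hypF (u :: (u - nC m) :: vadd (vsubr 1 dv) u) (vadd (vsubr 1 cv1) u)
  - sgn1 m * GammaV (vsubr 1 cv) * Csin (RtoC PI * u) * RGammaV (vsubr 1 dv)
      / Csin (RtoC PI * v) *
      sumC (map (fun k =>
         CGamma (d k - nC m) * CGamma (d k) * GammaV (vsubr (d k) (dvk k))
           * Csin (RtoC PI * (d k - v)) * RGammaV (vsubr (d k) cv)
           / ((d k - nC m - 1) * (d k - 1) * Csin (RtoC PI * (d k - u)))
           * hypF (vadd cv (1 - d k)) ((2 - d k) :: (2 - d k + nC m) :: vadd (dvk k) (1 - d k)))
        (seq 1 (S (S q) - 2)))).
  replace (S (S q) - 2)%nat with q by lia. fold I.
  rewrite HL, HF.
  set (C3 := CGamma u * CGamma v * GammaV (vsubr 1 cv1) * GammaV (vadd (vsubr 1 dv1) u)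
      * RGamma (v - u) * RGammaV (vadd (vsubr 1 cv1) u) * RGammaV (vsubr 1 dv1)
      / poch (1 - u) m) in *.
  assert (EL : CSeries (left_residue_lim m u v cv1 dv1) = W * C3 * hypF (u :: (u - nC m) :: vadd (vsubr 1 dv) u) (vadd (vsubr 1 cv1) u)).
  { unfold hypF. apply CSeries_scal; auto. intros n. rewrite Edv. apply left_residue_lim_eq; auto. }
  assert (EI : csum (int_residue_lim m u v cv1 dv1) m = W * (pochV (vsubr 1 dv) 1 / pochV (vsubr 1 cv) 1 *
      csum (fun j => sgn1 j * pochV (vsubr 2 dv) j * nC (fact j)
                          / (pochV (vsubr 2 cv) j * nC (fact (m - 1 - j)))) m)).
  { rewrite <- 2!csum_scal. apply csum_ext. intros j _. rewrite Ecv, Edv. now apply int_residue_lim_eq. }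
  assert (ER : sumC (map (fun k => CSeries (right_residue_lim m u v cv1 (map d (others I k)) (d k))) I) =
     - sgn1 m * sumC (map (fun k =>
         CGamma (d k - nC m) * CGamma (d k) * GammaV (vsubr (d k) (dvk k))
           * Csin (RtoC PI * (d k - v)) * RGammaV (vsubr (d k) cv)
           / ((d k - nC m - 1) * (d k - 1) * Csin (RtoC PI * (d k - u)))
           * hypF (vadd cv (1 - d k)) ((2 - d k) :: (2 - d k + nC m) :: vadd (dvk k) (1 - d k))) I)).
  { rewrite <- sumC_scal. apply sumC_ext_in. intros k Hk. destruct (HYI k Hk) as [H1 [H2 H3]].
    rewrite Edvk, Ecv by auto. rewrite Cmult_assoc. unfold hypF. apply CSeries_scal.
    - apply (LR k Hk).
    - intros n. apply right_residue_lim_eq; auto.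
      + destruct (others_split I k Hk (seq_NoDup q 1)) as [I1 [I2 [F1 F2]]].
        rewrite LX, length_map, F2, F1, !length_app. simpl. lia.
      + intros y' Hy'. apply in_map_iff in Hy'. destruct Hy' as [i [<- Hi]].
        apply in_others in Hi. apply HYY; intuition auto. }
  assert (EP := Omega0_prefactor u v cv1 dv1 Hu Hv HX' HY'). rewrite <- Ecv, <- Edv in EP. fold W in EP.
  rewrite EI, EL, ER in LE.
  set (SR := sumC (map (fun k =>
         CGamma (d k - nC m) * CGamma (d k) * GammaV (vsubr (d k) (dvk k))
           * Csin (RtoC PI * (d k - v)) * RGammaV (vsubr (d k) cv)
           / ((d k - nC m - 1) * (d k - 1) * Csin (RtoC PI * (d k - u)))
           * hypF (vadd cv (1 - d k)) ((2 - d k) :: (2 - d k + nC m) :: vadd (dvk k) (1 - d k))) I)) in *.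
  set (P0 := GammaV (vsubr 1 cv) * Csin (RtoC PI * u) * RGammaV (vsubr 1 dv) / Csin (RtoC PI * v)) in *.
  replace (sgn1 m * GammaV (vsubr 1 cv) * Csin (RtoC PI * u) * RGammaV (vsubr 1 dv) / Csin (RtoC PI * v))
    with (sgn1 m * P0) by (unfold P0, Cdiv; ring).
  (* Once the last prefactor is 1/W, the goal is the limit identity divided by -W and solved for the
     series on the left. *)
  assert (EP' : P0 = / W) by (replace P0 with (/ W * (W * P0)) by (field; auto); rewrite EP; ring).
  rewrite EP'.
  set (A1 := pochV (vsubr 1 dv) 1 / pochV (vsubr 1 cv) 1 * _) in *.
  set (A2 := hypF (u :: _) _) in *.
  set (A3 := CSeries (fun k => double_coeff_lim m u v cv1 dv1 k * log_deriv_lim m u v cv1 dv1 k)) in *.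
  assert (LE' : A3 = - (W * A1 + W * C3 * A2 + - sgn1 m * SR)).
  { replace A3 with ((W * A1 + W * C3 * A2 + - sgn1 m * SR + A3) - (W * A1 + W * C3 * A2 + - sgn1 m * SR)) by ring.
    rewrite LE. ring. }
  rewrite LE'. unfold kc. assert (F := nC_fact_neq0 m). field. auto.
Qed.
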